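(* Let $f:\mathbb{P}^2\dashrightarrow\mathbb{P}^2$ be a dominant rational map with equal algebraic and topological degrees $d(f)=\lambda_2(f)\ge 2$. Then there is a countable union $Z$ of proper algebraic subsets of $\mathrm{Aut}(\mathbb{P}^2)$ such that for every $T\in\mathrm{Aut}(\mathbb{P}^2)\setminus Z$, the map $f_T:=T\circ f$ is algebraically stable (so $\lambda_1(f_T)=\lambda_2(f_T)$), and there is no $f_T$-invariant singular holomorphic foliation of $\mathbb{P}^2$.
   Context: A dominant rational map $f=[f_1:f_2:f_3]$ of $\mathbb{P}^2$ has algebraic degree $d(f)$ = common degree of the homogeneous polynomials $f_j$ (no common nonconstant factor), topological degree $\lambda_2(f)$ = number of preimages of a generic point, first dynamical degree $\lambda_1(f)=\lim_n d(f^n)^{1/n}$. $f$ is algebraically stable if $d(f^n)=d(f)^n$ for all $n\ge 1$. $f_T:=T\circ f$ for $T\in\mathrm{Aut}(\mathbb{P}^2)\cong PGL_3(\mathbb{C})$. A singular holomorphic foliation $\mathcal F$ is $f$-invariant if $f^*\mathcal F=\mathcal F$. *)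

(* Defs.v *)
From HB Require Import structures.
From mathcomp Require Import all_boot all_order all_algebra.
From mathcomp Require Import reals.
From mathcomp Require Import complex.
From mathcomp Require Import mpoly.

Set Implicit Arguments.
Unset Strict Implicit.
Unset Printing Implicit Defensive.

Import Order.TTheory GRing.Theory Num.Theory.
Local Open Scope ring_scope.

(* Homogeneous coordinates on P^2 are indexed by 'I_3.  A triple of
   polynomials F : 'I_3 -> {mpoly K[3]} represents the map [F_0:F_1:F_2]. *)

Section RationalMaps.
Variable K : fieldType.

Definition triple := 'I_3 -> {mpoly K[3]}.

Definition no_common_factor (F : triple) : Prop :=
  forall h : {mpoly K[3]}, (forall i, exists q, F i = h * q) -> (msize h <= 1)%N.

Definition reduced_of_degree (F : triple) (d : nat) : Prop :=
  [/\ forall i, F i \is d.-homog, exists i, F i != 0 & no_common_factor F].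

Definition alg_degree (F : triple) (e : nat) : Prop :=
  exists (h : {mpoly K[3]}) (G : triple),
    [/\ h != 0, reduced_of_degree G e & forall i, F i = h * G i].

Definition comp_triple (F G : triple) : triple :=
  fun i => F i \mPo [tuple G j | j < 3].

Definition id_triple : triple := fun i => 'X_i.

Fixpoint iter_triple (n : nat) (F : triple) : triple :=
  match n with
  | 0 => id_triple
  | n'.+1 => comp_triple F (iter_triple n' F)
  end.

(* dominant: the image is not contained in any algebraic curve *)
Definition dominant (F : triple) : Prop :=
  forall P : {mpoly K[3]}, P \mPo [tuple F j | j < 3] = 0 -> P = 0.

Definition nonzero_vec (v : 'I_3 -> K) : Prop := exists i, v i != 0.
Definition proportional (v w : 'I_3 -> K) : Prop :=
  exists c : K, c != 0 /\ forall i, w i = c * v i.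
Definition eval_triple (F : triple) (v : 'I_3 -> K) : 'I_3 -> K :=
  fun i => (F i).@[v].

(* v represents a preimage of the point p under F (v not indeterminate) *)
Definition is_preimage (F : triple) (p v : 'I_3 -> K) : Prop :=
  [/\ nonzero_vec v, nonzero_vec (eval_triple F v)
    & proportional (eval_triple F v) p].

Definition top_degree (F : triple) (k : nat) : Prop :=
  exists Q : {mpoly K[3]}, Q != 0 /\ (exists e, Q \is e.-homog) /\
    forall p : 'I_3 -> K, nonzero_vec p -> Q.@[p] != 0 ->
      exists w : 'I_k -> ('I_3 -> K),
        [/\ forall j, is_preimage F p (w j),
            forall j j', j != j' -> ~ proportional (w j) (w j')
          & forall v, is_preimage F p v -> exists j, proportional (w j) v].

Definition alg_stable (F : triple) : Prop :=
  exists d, alg_degree F d /\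
    forall n, (0 < n)%N -> alg_degree (iter_triple n F) (d ^ n).

(* action of T in PGL_3 (represented by an invertible matrix): T o F *)
Definition act_triple (T : 'M[K]_3) (F : triple) : triple :=
  fun i => \sum_(j < 3) T i j *: F j.

Definition mat_coords (T : 'M[K]_3) : 'I_(3 * 3) -> K :=
  fun k => mxvec T 0 k.

(* A (saturated) singular foliation of degree k on P^2: a projective 1-form
   w = sum_i w_i dx_i with homogeneous coefficients of degree k+1, not all
   zero, without common factor (singular set of codim 2), satisfying the
   Euler condition sum_i x_i w_i = 0 (integrability is automatic). *)
Definition foliation (k : nat) (w : triple) : Prop :=
  [/\ reduced_of_degree w k.+1 & \sum_(i < 3) 'X_i * w i = 0].

(* pull-back F^* w = sum_i w_i(F) dF_i *)
Definition pullback (F w : triple) : triple :=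
  fun j => \sum_(i < 3) (w i \mPo [tuple F l | l < 3]) * (F i)^`M(j).

(* F^* (foliation of w) = (foliation of w): F^* w is nonzero and defines the
   same foliation, i.e. is proportional to w as a rational 1-form *)
Definition invariant_foliation (F w : triple) : Prop :=
  (exists j, pullback F w j != 0) /\
  forall i j, pullback F w i * w j = pullback F w j * w i.

End RationalMaps.

Section DynDeg.
Variable K : numClosedFieldType.
Definition first_dyn_degree (F : triple K) (l : K) : Prop :=
  forall eps : K, 0 < eps -> exists N : nat, forall n e : nat,
    (N <= n)%N -> (0 < n)%N -> alg_degree (iter_triple n F) e ->
    `| n.-root (e%:R) - l | < eps.
End DynDeg.

(* Main.v *)
(* A curve contracted by f meets a fixed generic line in a critical point, so the
   contracted values of f form a finite set P.  For T outside countably many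
   hypersurfaces the orbit of T p under F = T o f is infinite and avoids the critical
   curve for every p in P; nonemptiness of these conditions is tested on matrices
   v1 l1 + s v2 l2, along which the orbit is a_n v1 + s^(n+1) b_n v2 with a_n, b_n
   nonzero at s = 0.

   Stability: a common factor of F^(n+1) is a curve sent to a base point; pulling
   back, finiteness of the fibres can only fail over some T p, whose orbit never
   meets a base point.

   Foliations: if F^*w = g w, a point T p cannot be singular for w, since its whole
   orbit would be, so w(F) vanishes at finitely many points and g divides the
   Jacobian of F.  Comparing degrees, (d - 1)(k + 2) <= 3(d - 1), i.e. k <= 1.
   By Bezout's theorem topological degree d < d^2 forces a base point q.
   - For k = 1, w = (A x) x x for a linear A, and F semiconjugates the flow of A to
     that of a linear B with the same eigenvectors.  Then q is an eigenvector, and all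
     the preimages of q are eigenvectors of A for one and the same eigenvalue; as there
     are two of them, w vanishes on a line.
   - For k = 0, w = c x x, the map F sends lines through c to lines through c, which
     forces c = q, a condition that fails for general T. *)

Require Import Defs.
From HB Require Import structures.
From mathcomp Require Import all_boot all_order all_algebra.
From mathcomp Require Import ring zify.
From mathcomp Require Import reals.
From mathcomp Require Import complex.
From mathcomp Require Import separable.
From mathcomp Require Import mpoly.
From Stdlib Require Import Classical ClassicalEpsilon FunctionalExtensionality.
Import Order.TTheory GRing.Theory Num.Theory.

Set Implicit Arguments.
Unset Strict Implicit.
Unset Printing Implicit Defensive.

Local Open Scope ring_scope.

(** * Multivariate polynomials *)

Section MPolyGeneral.
Variables (R : comNzRingType) (n : nat).
Implicit Types p q : {mpoly R[n]}.

(** Dimension theory is replaced by one dichotomy: three forms of equal degree have finitely many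
    common zeros or a common factor. It comes from elimination, which puts a product of linear forms
    through a prescribed point into their ideal; the same product shows that a triple parallel to a
    coprime one is a multiple of it. The orbits have to avoid the critical curve and not merely the
    base points, because singularities of w are carried forward only where the differential is
    invertible. By Euler's formula base points are critical, so one condition serves both stability
    and foliations. Each condition is the nonvanishing of a polynomial on the space of all matrices,
    so a single matrix, even of rank one, may witness it. The multiplier g has degree (k+1)d + (d-1)
    - (k+1) = (k+2)(d-1), the Jacobian has degree 3(d-1). For k = 1 they agree, so g is the Jacobian
    up to a constant and can be cancelled; what remains is the identity from which the semiconjugacy
    is read off. *)

Lemma mpoly_struct_ind (P : {mpoly R[n]} -> Prop) :
  (forall c, P c%:MP) -> (forall i, P 'X_i) ->
  (forall p q, P p -> P q -> P (p + q)) ->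
  (forall p q, P p -> P q -> P (p * q)) -> forall p, P p.
Proof.
move=> PC PX PD PM p; rewrite (mpolyE p).
apply: big_ind => [|//|m _]; first by rewrite -[0]mpolyC0.
rewrite -mul_mpolyC; apply: (PM) => //; rewrite mpolyXE_id.
apply: (big_ind P) => [||i _]; [by rewrite -mpolyC1|exact: PM|].
by elim: (m i) => [|k IH]; rewrite ?expr0 -?mpolyC1 // exprS; apply: (PM).
Qed.

Lemma mderivXU (i j : 'I_n) : ('X_i : {mpoly R[n]})^`M(j) = (i == j)%:R.
Proof.
rewrite mderivX mnm1E; have [->|_] := eqVneq i j; last by rewrite scale0r.
have -> : (U_(j) - U_(j) = 0 :> 'X_{1..n})%MM by apply/mnmP => t; rewrite !mnmE; lia.
by rewrite mpolyX0 scale1r.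
Qed.

Lemma mderiv_comp k (lq : n.-tuple {mpoly R[k]}) p (j : 'I_k) :
  (p \mPo lq)^`M(j) = \sum_(i < n) (p^`M(i) \mPo lq) * (tnth lq i)^`M(j).
Proof.
elim/mpoly_struct_ind: p => [c|i|p q IHp IHq|p q IHp IHq].
- rewrite comp_mpolyC mderivC big1 // => i _.
  by rewrite mderivC comp_mpoly0 mul0r.
- rewrite comp_mpolyXU -tnth_nth (bigD1 i) //= big1 => [|l ne_li].
    by rewrite mderivXU eqxx comp_mpoly1 mul1r addr0.
  by rewrite mderivXU eq_sym (negbTE ne_li) comp_mpoly0 mul0r.
- rewrite !rmorphD /= mderivD IHp IHq -big_split /=; apply: eq_bigr => i _.
  by rewrite mderivD rmorphD mulrDl.
rewrite !rmorphM /= mderivM IHp IHq mulr_suml mulr_sumr -big_split /=.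
apply: eq_bigr => i _; rewrite mderivM rmorphD /= !rmorphM /=; ring.
Qed.

Lemma dhomog_mderiv d p (i : 'I_n) :
  p \is d.-homog -> p^`M(i) \is d.-1.-homog.
Proof.
move=> /dhomogP hp; apply/dhomogP => m; rewrite mcoeff_msupp mcoeff_mderiv.
move=> nz; have /hp : (m + U_(i))%MM \in msupp p.
  by rewrite mcoeff_msupp; apply: contraNneq nz => ->; rewrite mul0rn.
by move=> /= <-; rewrite mdegD mdeg1 addn1.
Qed.

Lemma Euler_homog d p : p \is d.-homog ->
  \sum_(i < n) 'X_i * p^`M(i) = p *+ d.
Proof.
move=> /dhomogP hp; rewrite [in LHS](mpolyE p) [in RHS](mpolyE p).
under eq_bigr => i _ do rewrite raddf_sum mulr_sumr /=.
rewrite exchange_big /= -sumrMnl; apply: eq_big_seq => m /hp /= <-.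
rewrite mdegE -sumrMnr; apply: eq_bigr => i _.
rewrite mderivZ mderivX scalerA.
case: (posnP (m i)) => [->|mi]; first by rewrite mulr0 scale0r mulr0 mulr0n.
rewrite -scalerAr -mpolyXD.
have -> : (U_(i) + (m - U_(i)) = m)%MM.
  by apply/mnmP => t; rewrite !mnmE; case: eqP => [<-|] /=; lia.
by rewrite -scaler_nat scalerA mulrC.
Qed.

Lemma meval_homogZ d p (c : R) (v : 'I_n -> R) : p \is d.-homog ->
  p.@[fun i => c * v i] = c ^+ d * p.@[v].
Proof.
move=> /dhomogP hp; rewrite !mevalE mulr_sumr; apply: eq_big_seq => m /hp /= <-.
rewrite mulrCA; congr (_ * _); rewrite mdegE -prodrXr -big_split /=.
by apply: eq_bigr => i _; rewrite exprMn.
Qed.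

Lemma dhomog_comp k (lq : n.-tuple {mpoly R[k]}) d e p :
  p \is e.-homog -> (forall i, tnth lq i \is d.-homog) ->
  p \mPo lq \is (e * d).-homog.
Proof.
move=> /dhomogP hp hq; rewrite comp_mpolyE; rewrite big_seq.
apply: rpred_sum => m /hp /= <-; apply: rpredZ.
rewrite mdegE big_distrl /=.
elim/big_ind2: _ => [|a x b y hx hy|i _]; first exact: dhomog1.
- by apply: dhomogM.
by rewrite mulnC; apply: dhomogMn.
Qed.

End MPolyGeneral.

(** * Polynomials as functions over an infinite field *)

Section Vanishing.
Variable K : numFieldType.

Lemma poly_vanish (p : {poly K}) : (forall x, p.[x] = 0) -> p = 0.
Proof.
move=> p0; apply/eqP; apply: contraT => nz.
have := @max_poly_roots K p [seq i%:R | i <- iota 0 (size p)] nz.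
rewrite size_map size_iota ltnn => -> //.
  by apply/allP => x _; apply/rootP.
by rewrite map_inj_uniq ?iota_uniq // => i j /eqP; rewrite eqr_nat => /eqP.
Qed.

(** Induction on the number of variables: [muni] regards [p] as a polynomial in the last variable,
    and its coefficients vanish by [poly_vanish] and the induction hypothesis. *)
Lemma mpoly_vanish n (p : {mpoly K[n]}) : (forall v, p.@[v] = 0) -> p = 0.
Proof.
elim: n p => [|n IHn] p p0.
  have /msize1_polyC E : (msize p <= 1)%N.
    rewrite leqNgt; apply/negP => h.
    by move: (p0 (fun=> 0)); rewrite (nvar0_mpolyC p) mevalC => h0; move: h;
       rewrite (nvar0_mpolyC p) h0 mpolyC0 msize0.
  by move: (p0 (fun=> 0)); rewrite E mevalC => ->; rewrite mpolyC0.
pose w i := widen_ord (leqnSn n) i.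
pose ev (v : 'I_n -> K) x (i : 'I_n.+1) := if insub (val i) is Some j then v j else x.
have munie v x : ((map_poly (meval v) (muni p)).[x]) = p.@[ev v x].
  have evw i : ev v x (w i) = v i.
    by rewrite /ev /=; case: insubP => [j _ /val_inj ->//|]; rewrite ltn_ord.
  have evm : ev v x ord_max = x.
    by rewrite /ev; case: insubP => //= j; rewrite ltnn.
  rewrite muniE rmorph_sum /= horner_sum mevalE; apply: eq_bigr => m _.
  rewrite map_polyZ hornerZ /= map_polyXn hornerXn mevalZ mevalX.
  rewrite big_ord_recr /= evm -mulrA; congr (_ * (_ * _)).
  by apply: eq_bigr => i _; rewrite mnmE evw.
have m0 : muni p = 0.
  apply/polyP => k; rewrite coef0; apply: IHn => v.
  have : map_poly (meval v) (muni p) = 0.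
    by apply: poly_vanish => x; rewrite munie.
  by move=> /polyP /(_ k); rewrite coef_map coef0.
apply/mpolyP => m; rewrite mcoeff0.
pose m' := [multinom m (w i) | i < n].
have : ((muni p)`_(m ord_max))@_m' = 0 by rewrite m0 coef0 mcoeff0.
have [mp|] := boolP (m \in msupp p); last by rewrite mcoeff_msupp negbK => /eqP.
rewrite muniE coef_sum raddf_sum /= (bigD1_seq m) ?msupp_uniq //= big1.
  by rewrite !coefZ coefXn eqxx mulr1 mcoeffZ mcoeffX eqxx mulr1 addr0.
move=> l ne_lm; rewrite !coefZ coefXn; case: eqP => [E|_]; last by rewrite mulr0 mcoeff0.
rewrite mulr1 mcoeffZ mcoeffX; case: eqP => [E'|_]; last by rewrite mulr0.
case/eqP: ne_lm; apply/mnmP => i.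
have [lt_j|ge_i] := ltnP i n; last first.
  by have -> : i = ord_max by apply: val_inj => /=; have := ltn_ord i; lia.
have -> : i = w (Ordinal lt_j) by apply: val_inj.
by move/mnmP: E' => /(_ (Ordinal lt_j)); rewrite !mnmE.
Qed.

Lemma mpoly_eval_inj n (p q : {mpoly K[n]}) : (forall v, p.@[v] = q.@[v]) -> p = q.
Proof.
by move=> h; apply/eqP; rewrite -subr_eq0; apply/eqP/mpoly_vanish => v; rewrite mevalB h subrr.
Qed.

Lemma mpoly_nonzero_at n (p : {mpoly K[n]}) : p != 0 -> exists v, p.@[v] != 0.
Proof.
move=> nz; apply: NNPP => h; case/eqP: nz; apply: mpoly_vanish => v.
by apply/eqP; apply: contraT => hv; case: h; exists v.
Qed.

(** Zariski density: an identity need only be checked off a hypersurface chosen for convenience. *)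
Lemma mpoly_cancel n (p q r : {mpoly K[n]}) : p != 0 ->
  (forall v, p.@[v] != 0 -> q.@[v] = r.@[v]) -> q = r.
Proof.
move=> nz h; apply: (mulfI nz); apply: mpoly_eval_inj => v; rewrite !mevalM.
by have [->|/h ->//] := eqVneq p.@[v] 0; rewrite !mul0r.
Qed.

End Vanishing.

(** * Vectors in dimension three *)

Definition i0 : 'I_3 := Ordinal (isT : 0 < 3)%N.
Definition i1 : 'I_3 := Ordinal (isT : 1 < 3)%N.
Definition i2 : 'I_3 := Ordinal (isT : 2 < 3)%N.

(** Cyclic successor of an index; it gives cross products and cofactors one formula without
    signs. *)
Definition nx (i : 'I_3) : 'I_3 :=
  match val i with 0 => i1 | 1 => i2 | _ => i0 end.

Lemma sum3 (R : nmodType) (F : 'I_3 -> R) : \sum_(i < 3) F i = F i0 + F i1 + F i2.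
Proof.
rewrite !big_ord_recl big_ord0 addr0 addrA.
by congr (F _ + F _ + F _); apply: val_inj.
Qed.

Lemma ord3_ind (P : 'I_3 -> Prop) : P i0 -> P i1 -> P i2 -> forall i, P i.
Proof.
move=> p0 p1 p2 [[|[|[|//]]] lt_i]; [move: p0|move: p1|move: p2];
  by congr P; apply: val_inj.
Qed.

Section Vectors.
Variable R : comPzRingType.
Implicit Types a b c x : 'I_3 -> R.

Definition dot a b := \sum_(i < 3) a i * b i.
Definition cross a b : 'I_3 -> R :=
  fun i => a (nx i) * b (nx (nx i)) - a (nx (nx i)) * b (nx i).
Definition det3 a b c := dot a (cross b c).
Definition lc2 (s : R) a (t : R) b : 'I_3 -> R := fun i => s * a i + t * b i.

Lemma dotE a b : dot a b = a i0 * b i0 + a i1 * b i1 + a i2 * b i2.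
Proof. exact: sum3. Qed.

Lemma crossE0 a b : cross a b i0 = a i1 * b i2 - a i2 * b i1. Proof. by []. Qed.
Lemma crossE1 a b : cross a b i1 = a i2 * b i0 - a i0 * b i2. Proof. by []. Qed.
Lemma crossE2 a b : cross a b i2 = a i0 * b i1 - a i1 * b i0. Proof. by []. Qed.
Definition crossE := (crossE0, crossE1, crossE2).

Lemma det3E a b c : det3 a b c =
  a i0 * (b i1 * c i2 - b i2 * c i1) + a i1 * (b i2 * c i0 - b i0 * c i2)
  + a i2 * (b i0 * c i1 - b i1 * c i0).
Proof. by rewrite /det3 dotE !crossE. Qed.

Lemma det_mx33 (M : 'M[R]_3) : \det M = det3 (M i0) (M i1) (M i2).
Proof.
rewrite det3E (expand_det_row M i0) sum3 /cofactor.
do 3 rewrite (expand_det_row _ ord0) !big_ord_recl !big_ord0 /cofactor !det_mx11 !mxE /=.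
rewrite /bump /=.
rewrite /=; repeat match goal with
| |- context [lift i0 ?j] => first
   [ rewrite (_ : lift i0 j = i1); last exact: val_inj
   | rewrite (_ : lift i0 j = i2); last exact: val_inj ]
| |- context [lift i1 ?j] => first
   [ rewrite (_ : lift i1 j = i0); last exact: val_inj
   | rewrite (_ : lift i1 j = i2); last exact: val_inj ]
| |- context [lift i2 ?j] => first
   [ rewrite (_ : lift i2 j = i0); last exact: val_inj
   | rewrite (_ : lift i2 j = i1); last exact: val_inj ]
end.
rewrite /= !(expr0, expr1, exprS); ring.
Qed.

End Vectors.

Section FieldVectors.
Variable K : fieldType.
Implicit Types (a b c x : 'I_3 -> K).

Lemma not_nonzero_vec a : ~ nonzero_vec a -> forall i, a i = 0.
Proof.
by move=> h i; apply/eqP; apply: contraT => hi; case: h; exists i.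
Qed.

Lemma cross0_eq a b : (forall i, cross a b i = 0) ->
  forall i j, a i * b j = a j * b i.
Proof.
move=> h; have /eqP := h i0; have /eqP := h i1; have /eqP := h i2.
rewrite !crossE !subr_eq0 => /eqP e2 /eqP e1 /eqP e0.
by do 2 elim/ord3_ind; rewrite // ?e0 ?e1 ?e2.
Qed.

Lemma cross0_proportional a b : nonzero_vec a -> (forall i, cross a b i = 0) ->
  exists t, forall i, b i = t * a i.
Proof.
move=> [k ak] h; exists (b k / a k) => i; apply: (mulfI ak).
by rewrite (cross0_eq h); field.
Qed.

Lemma span_of_dot_cross a b x : nonzero_vec (cross a b) ->
  dot (cross a b) x = 0 -> exists s t, forall i, x i = s * a i + t * b i.
Proof.
(* Cramer's rule, read off in a coordinate [k] where [cross a b] is nonzero; the error term is a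
   multiple of the vanishing determinant. *)
move=> [k ck] d0; exists (cross x b k / cross a b k), (cross a x k / cross a b k) => i.
apply: (mulfI ck).
transitivity (cross x b k * a i + cross a x k * b i); last first.
  by rewrite mulrDr !mulrA ![cross a b k * _]mulrC !mulfK.
have := d0; rewrite dotE.
move=> d1.
apply/eqP; rewrite -subr_eq0; apply/eqP.
transitivity ((k == i)%:R * (cross a b i0 * x i0 + cross a b i1 * x i1 + cross a b i2 * x i2)).
  by elim/ord3_ind: k {ck}; elim/ord3_ind: i; rewrite /= !crossE; ring.
by rewrite d1 mulr0.
Qed.

Lemma complete_basis a : nonzero_vec a -> exists b c : 'I_3 -> K, det3 a b c != 0.
Proof.
move=> [k ak]; exists (fun i => (i == nx k)%:R), (fun i => (i == nx (nx k))%:R).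
move: ak; elim/ord3_ind: k => ak; rewrite det3E -!val_eqE /=;
 by rewrite !(mulr1n, mulr0n, mulr1, mulr0, mul0r, mul1r, addr0, add0r, subr0, sub0r, oppr0).
Qed.

Lemma det3_nz_cross a b c : det3 a b c != 0 -> nonzero_vec (cross b c).
Proof.
move=> h; apply: NNPP => /not_nonzero_vec z; case/eqP: h.
by rewrite /det3 dotE !z !mulr0 !addr0.
Qed.

Lemma nonzero_proportional a b : nonzero_vec a -> proportional a b -> nonzero_vec b.
Proof. by move=> [i ai] [t [tn E]]; exists i; rewrite E mulf_neq0. Qed.

Lemma proportional_sym a b : proportional a b -> proportional b a.
Proof.
by move=> [t [tn E]]; exists t^-1; split; rewrite ?invr_eq0 // => i; rewrite E mulKf.
Qed.

Lemma proportional_trans a b c : proportional a b -> proportional b c -> proportional a c.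
Proof.
move=> [t [tn E]] [s [sn E']]; exists (s * t); split; first by rewrite mulf_neq0.
by move=> i; rewrite E' E mulrA.
Qed.

Lemma proportional_cross a b : proportional a b -> forall i, cross a b i = 0.
Proof. by move=> [t [_ E]]; elim/ord3_ind; rewrite !crossE !E; ring. Qed.

End FieldVectors.

(** * Linear forms and restriction to lines *)

Section LinearForms.
Variable K : numFieldType.
Implicit Types (a b x : 'I_3 -> K) (p q : {mpoly K[3]}).

Definition linf a : {mpoly K[3]} := \sum_(i < 3) a i *: 'X_i.

Lemma meval_linf a x : (linf a).@[x] = dot a x.
Proof.
by rewrite /linf raddf_sum; apply: eq_bigr => i _; rewrite /= mevalZ mevalXU.
Qed.

Lemma linf_homog a : linf a \is 1.-homog.
Proof. by apply: rpred_sum => i _; apply: rpredZ; rewrite dhomogX /= mdeg1. Qed.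

Lemma linf_neq0 a : nonzero_vec a -> linf a != 0.
Proof.
move=> [i ai]; apply: contraNneq ai => /(congr1 (meval (fun j => (j == i)%:R))).
rewrite meval_linf meval0 /dot (bigD1 i) //= eqxx mulr1 big1 ?addr0 => [->//|j ne_ji].
by rewrite (negbTE ne_ji) mulr0.
Qed.

Section Projection.
Variables (a : 'I_3 -> K) (k : 'I_3).
Hypothesis ak : a k != 0.

(** Projection onto the plane [dot a x = 0] along the axis [k]; composition with it is reduction
    modulo [linf a]. *)
Definition plproj : 3.-tuple {mpoly K[3]} :=
  [tuple 'X_j - (j == k)%:R / a k *: linf a | j < 3].

Lemma dot_plproj x : dot a (fun j => (tnth plproj j).@[x]) = 0.
Proof.
rewrite /dot; under eq_bigr => j _ do
  rewrite tnth_mktuple mevalB mevalZ mevalXU meval_linf mulrBr.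
rewrite sumrB -/(dot a x) [X in _ - X](bigD1 k) //= eqxx.
rewrite [X in _ - (_ + X)]big1 => [|j ne_jk]; last by rewrite (negbTE ne_jk) !mul0r mulr0.
by rewrite addr0 mul1r mulrA divff // mul1r subrr.
Qed.

Lemma plproj_mod p : exists q, p = p \mPo plproj + linf a * q.
Proof.
elim/mpoly_struct_ind: p => [c|i|p q [p' Ep] [q' Eq]|p q [p' Ep] [q' Eq]].
- by exists 0; rewrite comp_mpolyC mulr0 addr0.
- exists ((i == k)%:R / a k)%:MP; rewrite comp_mpolyXU -tnth_nth tnth_mktuple.
  by rewrite [linf a * _]mulrC mul_mpolyC subrK.
- by exists (p' + q'); rewrite rmorphD /= {1}Ep {1}Eq; ring.
exists (p' * (q \mPo plproj) + (p \mPo plproj) * q' + linf a * p' * q').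
by rewrite rmorphM /= {1}Ep {1}Eq; ring.
Qed.

End Projection.

Lemma linf_dvd a p : nonzero_vec a -> (forall x, dot a x = 0 -> p.@[x] = 0) ->
  exists q, p = linf a * q.
Proof.
move=> [k ak] h; have [q E] := plproj_mod a k p; exists q.
suff p0 : p \mPo plproj a k = 0 by rewrite {1}E p0 add0r.
by apply: mpoly_vanish => x; rewrite comp_mpoly_meval h // dot_plproj.
Qed.

(** Reduction modulo [linf a], realised by [plproj], is a ring morphism into a domain. *)
Lemma linf_prime a p q r : nonzero_vec a -> p * q = linf a * r ->
  (exists p', p = linf a * p') \/ (exists q', q = linf a * q').
Proof.
move=> [k ak] h; have nza : nonzero_vec a by exists k.
have la0 : linf a \mPo plproj a k = 0.
  apply: mpoly_vanish => x; rewrite comp_mpoly_meval meval_linf.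
  exact: dot_plproj.
have /eqP : (p \mPo plproj a k) * (q \mPo plproj a k) = 0.
  by rewrite -rmorphM h rmorphM /= la0 mul0r.
have [p' Ep] := plproj_mod a k p; have [q' Eq] := plproj_mod a k q.
rewrite mulf_eq0 => /orP [] /eqP z; [left; exists p'|right; exists q'].
  by rewrite {1}Ep z add0r.
by rewrite {1}Eq z add0r.
Qed.

End LinearForms.

(** * Restriction of forms to a parametrised line *)

Section LineRestriction.
Variable K : numFieldType.
Implicit Types (a b x : 'I_3 -> K) (p q : {mpoly K[3]}).

(** Restriction to the line t -> a + t b. Its point at infinity is [b]: for a form of degree d, the
    coefficient in degree d is the value there. *)
Definition rl a b p : {poly K} :=
  mmap (@polyC K) (fun i => (a i)%:P + b i *: 'X) p.

Lemma rlD a b p q : rl a b (p + q) = rl a b p + rl a b q.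
Proof. by rewrite /rl rmorphD. Qed.
Lemma rlM a b p q : rl a b (p * q) = rl a b p * rl a b q.
Proof. by rewrite /rl rmorphM. Qed.
Lemma rlZ a b c p : rl a b (c *: p) = c *: rl a b p.
Proof. by rewrite /rl mmapZ mul_polyC. Qed.
Lemma rl_sum a b (I : Type) (r : seq I) (F : I -> {mpoly K[3]}) :
  rl a b (\sum_(i <- r) F i) = \sum_(i <- r) rl a b (F i).
Proof. by rewrite /rl rmorph_sum. Qed.

Lemma horner_rl a b p t : (rl a b p).[t] = p.@[fun i => a i + t * b i].
Proof.
elim/mpoly_struct_ind: p => [c|i|p q IHp IHq|p q IHp IHq].
- by rewrite /rl mmapC mevalC hornerC.
- by rewrite /rl mmapX mmap1U mevalXU hornerD hornerC hornerZ hornerX mulrC.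
- by rewrite rlD hornerD mevalD IHp IHq.
by rewrite rlM hornerM mevalM IHp IHq.
Qed.

Lemma deriv_rl a b p : (rl a b p)^`() = \sum_(i < 3) b i *: rl a b p^`M(i).
Proof.
elim/mpoly_struct_ind: p => [c|i|p q IHp IHq|p q IHp IHq].
- rewrite /rl mmapC derivC big1 // => i _.
  by rewrite mderivC mmap0 scaler0.
- rewrite {1}/rl mmapX mmap1U derivD derivC add0r derivZ derivX.
  rewrite (bigD1 i) //= big1 => [|j ne_ji]; last first.
    by rewrite mderivXU eq_sym (negbTE ne_ji) /rl mmap0 scaler0.
  by rewrite mderivXU eqxx /rl rmorph1 addr0.
- rewrite rlD derivD IHp IHq -big_split /=; apply: eq_bigr => i _.
  by rewrite mderivD rlD scalerDr.
rewrite rlM derivM IHp IHq mulr_suml mulr_sumr -big_split /=.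
apply: eq_bigr => i _; rewrite mderivM rlD !rlM scalerDr.
by rewrite -scalerAl -scalerAr.
Qed.

Lemma coefM_top (p q : {poly K}) k l : (size p <= k.+1)%N -> (size q <= l.+1)%N ->
  (p * q)`_(k + l) = p`_k * q`_l.
Proof.
move=> sp sq; rewrite coefM (bigD1 (inord k)) //= inordK ?ltnS ?leq_addr //.
rewrite addKn big1 ?addr0 // => i ne_ik.
have ne_ik' : ((i : nat) != k) by apply: contraNneq ne_ik => E; apply/eqP/val_inj; rewrite /= inordK ?ltnS ?leq_addr.
have [lt_ik|ge_ik] := ltnP i k.
  by rewrite [q`_ _]nth_default ?mulr0 //; apply: leq_trans sq _; lia.
by rewrite [p`_ _]nth_default ?mul0r //; apply: leq_trans sp _; lia.
Qed.

Lemma rl_top a b p d : p \is d.-homog ->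
  (size (rl a b p) <= d.+1)%N /\ (rl a b p)`_d = p.@[b].
Proof.
pose top (P : {poly K}) k c := (size P <= k.+1)%N /\ P`_k = c.
have topM P Q k l c c' : top P k c -> top Q l c' -> top (P * Q) (k + l)%N (c * c').
  move=> [sP tP] [sQ tQ]; split; last by rewrite coefM_top ?tP ?tQ.
  by apply: leq_trans (size_polyMleq _ _) _; lia.
have top1 : top 1 0%N 1 by split; rewrite ?size_poly1 // coef1.
have topX i : top ((a i)%:P + b i *: 'X) 1%N (b i).
  split; last by rewrite coefD coefC coefZ coefX mulr1 add0r.
  apply: leq_trans (size_polyD _ _) _; rewrite geq_max.
  rewrite (leq_trans (size_polyC_leq1 _)) // (leq_trans (size_scale_leq _ _)) //.
  by rewrite size_polyX.
have topexp P k c m : top P k c -> top (P ^+ m) (k * m)%N (c ^+ m).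
  move=> tP; elim: m => [|m IH]; first by rewrite muln0 !expr0.
  by rewrite mulnS !exprS; apply: topM.
have topprod m : top (mmap1 (fun i => (a i)%:P + b i *: 'X) m) (mdeg m) (\prod_i b i ^+ m i).
  rewrite /mmap1 mdegE; elim/big_ind3: _ => [//|*|i _]; first exact: topM.
  by have := topexp _ _ _ (m i) (topX i); rewrite mul1n.
move=> /dhomogP hp; rewrite -/(top _ _ _) /rl /mmap mevalE !big_seq.
elim/big_ind2: _ => [|P c Q c' [sP tP] [sQ tQ]|m /hp /= <-].
- by split; rewrite ?size_poly0 ?coef0.
- split; last by rewrite coefD tP tQ.
  by apply: leq_trans (size_polyD _ _) _; rewrite geq_max sP sQ.
have [sm tm] := topprod m; split; last by rewrite coefCM tm.
by rewrite mul_polyC (leq_trans (size_scale_leq _ _)).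
Qed.

Lemma size_rl a b p d : p \is d.-homog -> p.@[b] != 0 -> size (rl a b p) = d.+1.
Proof.
move=> /(rl_top a b) [s1 t1] nz; apply/eqP; rewrite eqn_leq s1 /=.
by rewrite ltnNge; apply: contra nz => s2; rewrite -t1 nth_default.
Qed.

End LineRestriction.

(** * Projectively finite sets *)

Section ProjectivelyFinite.
Variable K : numClosedFieldType.
Implicit Types (a b x v : 'I_3 -> K) (p q : {mpoly K[3]}) (X Y : ('I_3 -> K) -> Prop).

(** Finiteness as a subset of the projective plane: representatives count up to a scalar and the
    zero vector is disregarded. *)
Definition pfinite X := exists s : seq ('I_3 -> K),
  forall x, X x -> nonzero_vec x -> exists v, List.In v s /\ proportional v x.

Lemma pfinite_sub X Y : (forall x, nonzero_vec x -> X x -> Y x) -> pfinite Y -> pfinite X.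
Proof. by move=> h [s hs]; exists s => x Xx nx; apply: hs => //; apply: h. Qed.

Lemma pfinite_or X Y : pfinite X -> pfinite Y -> pfinite (fun x => X x \/ Y x).
Proof.
move=> [s hs] [s' hs']; exists (s ++ s') => x [/hs h|/hs' h] /h [v [vs pv]];
  by exists v; split => //; apply/List.in_app_iff; first [by left|by right].
Qed.

Lemma pfinite_bigor (I : Type) (r : seq I) (X : I -> ('I_3 -> K) -> Prop) :
  (forall i, List.In i r -> pfinite (X i)) ->
  pfinite (fun x => exists i, List.In i r /\ X i x).
Proof.
elim: r => [_|i r IH h]; first by exists [::] => x [i []].
have h1 := h i (or_introl erefl).
have h2 : pfinite (fun x => exists i, List.In i r /\ X i x).
  by apply: IH => j jr; apply: h; right.
apply: pfinite_sub (pfinite_or h1 h2) => x _ [j [[<-|jr] Xj]]; first by left.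
by right; exists j.
Qed.

Lemma pfinite_pigeonhole X (x : nat -> 'I_3 -> K) : pfinite X ->
  (forall n, X (x n)) -> (forall n, nonzero_vec (x n)) ->
  exists m n, (m < n)%N /\ proportional (x m) (x n).
Proof.
move=> [s hs] Xx nzx.
have ex n : exists k : 'I_(size s), proportional (nth (fun=> 0) s k) (x n).
  have [v [vs pv]] := hs _ (Xx n) (nzx n).
  have [k [lt_k E]] := List.In_nth _ _ (fun=> 0) vs.
  have lt_k' : (k < size s)%N by move: lt_k; rewrite -[length s]/(size s); lia.
  exists (Ordinal lt_k'); move: pv; rewrite -E /=; congr proportional.
  by elim: (s) (k) => [|y s' IH] [|k'] //=.
pose g n := proj1_sig (constructive_indefinite_description _ (ex n)).
have gP n : proportional (nth (fun=> 0) s (g n)) (x n).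
  by rewrite /g; case: constructive_indefinite_description.
have : ~~ injectiveb (fun n : 'I_(size s).+1 => g n).
  apply/negP => /injectiveP inj; have := leq_card _ inj.
  by rewrite !card_ord ltnn.
move=> /injectivePn [m [n ne_mn E]].
have pr : proportional (x m) (x n).
  by apply: proportional_trans (proportional_sym (gP m)) _; rewrite E.
case: (ltngtP m n) => [lt|gt|eq]; first by exists m, n.
  by exists n, m; split => //; apply: proportional_sym.
by case/eqP: ne_mn; apply: val_inj.
Qed.

Lemma dot_lc2 a s x t y : dot a (lc2 s x t y) = s * dot a x + t * dot a y.
Proof. by rewrite !dotE /lc2; ring. Qed.

(** A general line through [b] misses every point of [X] other than [b] itself, which may belong to
    [X]; hence the condition [s != 0]. *)
Lemma pfinite_avoid_lines X b : nonzero_vec b -> pfinite X ->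
  exists P : {mpoly K[3]}, P != 0 /\ forall a, P.@[a] != 0 ->
    nonzero_vec (cross a b) /\ forall s t, s != 0 -> ~ X (lc2 s a t b).
Proof.
move=> nzb [s hs]; have [c [c' hc]] := complete_basis nzb.
have [P [nzP hP]] : exists P : {mpoly K[3]}, P != 0 /\ forall a, P.@[a] != 0 ->
    forall v, List.In v s -> nonzero_vec (cross b v) -> dot (cross b v) a != 0.
  elim: s {hs} => [|v s [P [nzP IH]]]; first by exists 1; rewrite oner_neq0.
  case: (classic (nonzero_vec (cross b v))) => hv.
    exists (linf (cross b v) * P); split; first by rewrite mulf_neq0 // linf_neq0.
    move=> a; rewrite mevalM mulf_eq0 negb_or meval_linf => /andP [h1 /IH h2] u.
    by case=> [<-|/h2].
  by exists P; split => // a /IH h u [<-|/h].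
have nzbc : nonzero_vec (cross b c).
  by apply: (@det3_nz_cross _ c'); rewrite -(mulr1 (det3 _ _ _)); move: hc; congr (_ != _);
     rewrite !det3E; ring.
(* The extra factor keeps [a] independent of [b]. *)
exists (linf (cross b c) * P); split; first by rewrite mulf_neq0 // linf_neq0.
move=> a; rewrite mevalM mulf_eq0 negb_or meval_linf => /andP [h1 h2].
have nab : nonzero_vec (cross a b).
  apply: (@det3_nz_cross _ c); move: h1; congr (_ != _).
  by rewrite det3E dotE !crossE; ring.
split=> // t u nzt Xx.
have nzx : nonzero_vec (lc2 t a u b).
  apply: NNPP => /not_nonzero_vec z; case: nab => i; case/eqP.
  apply: (mulfI nzt); rewrite mulr0.
  transitivity (cross (lc2 t a u b) b i); last by rewrite /cross !z; ring.
  by rewrite /cross /lc2; ring.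
have [v [vs [e [nze E]]]] := hs _ Xx nzx.
case: (classic (nonzero_vec (cross b v))) => hv.
  have /eqP := hP _ h2 _ vs hv; apply; apply: (mulfI nzt); rewrite mulr0.
  transitivity (dot (cross b v) (lc2 t a u b)).
    by rewrite dot_lc2 [X in _ + X](_ : _ = 0) ?addr0 // !dotE !crossE; ring.
  by rewrite dotE !E !crossE; ring.
have {hv}hv := not_nonzero_vec hv.
have [f Ef] := cross0_proportional nzb hv.
case: nab => i; case/eqP; apply: (mulfI nzt); rewrite mulr0.
transitivity (cross (lc2 t a u b) b i); first by rewrite /cross /lc2; ring.
by rewrite /cross !E !Ef; ring.
Qed.

Lemma poly_root (p : {poly K}) : (1 < size p)%N -> exists t, p.[t] = 0.
Proof.
move=> sp; have /closed_rootP [t /rootP h] : size p != 1%N by rewrite neq_ltn sp orbT.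
by exists t.
Qed.

Lemma curve_meets_line (h : {mpoly K[3]}) e a b : h \is e.-homog -> (0 < e)%N ->
  exists s t, (s != 0) || (t != 0) /\ h.@[lc2 s a t b] = 0.
Proof.
move=> hh e0; have [hb|hb] := eqVneq h.@[b] 0.
  exists 0, 1; rewrite oner_neq0 orbT; split => //.
  by rewrite -[RHS]hb; apply: meval_eq => i; rewrite /lc2; ring.
have [t ht] : exists t, (rl a b h).[t] = 0.
  by apply: poly_root; rewrite (size_rl a hh hb).
exists 1, t; rewrite oner_neq0; split => //; rewrite -[RHS]ht horner_rl.
by apply: meval_eq => i; rewrite /lc2; ring.
Qed.

(** Every line through a point [o] off the curve meets the curve, whereas a general one would miss a
    finite set. *)
Lemma curve_not_pfinite (h : {mpoly K[3]}) e : h != 0 -> h \is e.-homog -> (0 < e)%N ->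
  ~ pfinite (fun x => h.@[x] = 0).
Proof.
move=> nzh hh e0 fin; have [o ho] := mpoly_nonzero_at nzh.
have nzo : nonzero_vec o.
  apply: NNPP => /not_nonzero_vec z; case/eqP: ho.
  rewrite (_ : o = (fun i => 0 * o i)); last by apply: functional_extensionality => i; rewrite z mulr0.
  by rewrite (meval_homogZ _ _ hh) expr0n eqn0Ngt e0 mul0r.
have [P [nzP hP]] := pfinite_avoid_lines nzo fin.
have [a /hP [nab h2]] := mpoly_nonzero_at nzP.
have [s [t [st hz]]] := curve_meets_line a o hh e0.
have [s0|nzs] := eqVneq s 0; last exact: (h2 s t).
move: st hz; rewrite s0 eqxx /= => nzt /eqP.
rewrite (@meval_eq _ _ _ (fun i => t * o i)); last by move=> i; rewrite /lc2; ring.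
by rewrite (meval_homogZ _ _ hh) mulf_eq0 (negbTE ho) orbF expf_eq0 (negbTE nzt) andbF.
Qed.

Lemma plane_not_pfinite a b : nonzero_vec (cross a b) ->
  ~ pfinite (fun x => exists t, x = (fun i => a i + t * b i)).
Proof.
move=> nab fin; apply: (@curve_not_pfinite (linf (cross a b)) 1) => //.
- exact: linf_neq0.
- exact: linf_homog.
(* The points a + t b make up the whole projective line except [b]. *)
have fb : pfinite (fun x => exists t, x = (fun i => t * b i)).
  exists [:: b] => x [t ->] [i /=]; rewrite mulf_eq0 negb_or => /andP [nt _].
  by exists b; split; [left|exists t].
have [s hs] := pfinite_or fin fb.
exists s => x; rewrite meval_linf => /(span_of_dot_cross nab) [u [t E]] nzx.
have [u0|nu] := eqVneq u 0.
  apply: hs => //; right; exists t; apply: functional_extensionality => i.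
  by rewrite E u0; ring.
have [||v [vs pv]] := hs (fun i => a i + (t / u) * b i).
- by left; exists (t / u).
- case: nzx => i; rewrite E => nz; exists i; apply: contraNneq nz => z.
  apply/eqP; transitivity (u * (a i + t / u * b i)); first by field.
  by rewrite z mulr0.
exists v; split => //; apply: proportional_trans pv _; exists u; split => // i.
by rewrite E; field.
Qed.

(** A form that the equation of a line does not divide restricts to a nonzero polynomial in one
    variable on that line. *)
Lemma plane_zeros_pfinite (I : Type) (f : I -> {mpoly K[3]}) (d : I -> nat) a :
  nonzero_vec a -> (forall i, f i \is (d i).-homog) ->
  (exists i, ~ exists q, f i = linf a * q) ->
  pfinite (fun x => dot a x = 0 /\ forall i, (f i).@[x] = 0).
Proof.
move=> nza hf [i ndv].
have [b [c hbc]] := complete_basis nza.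
have [u [v [nuv E]]] : exists u v, nonzero_vec (cross u v) /\ proportional (cross u v) a.
  (* A basis of the plane orthogonal to [a]: the cross product of these two vectors is [det3 a b c]
     times [a]. *)
  exists (cross a b), (cross a c).
  have Ec j : cross (cross a b) (cross a c) j = det3 a b c * a j.
    by rewrite det3E; elim/ord3_ind: j; rewrite !crossE; ring.
  case: nza => j aj; split; first by exists j; rewrite Ec mulf_neq0.
  apply: proportional_sym; exists (det3 a b c); split => // l; exact: Ec.
have duv x : dot a x = 0 <-> dot (cross u v) x = 0.
  case: E => e [nze Ee]; rewrite !dotE !Ee.
  have -> : e * cross u v i0 * x i0 + e * cross u v i1 * x i1 + e * cross u v i2 * x i2
     = e * (cross u v i0 * x i0 + cross u v i1 * x i1 + cross u v i2 * x i2) by ring.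
  split=> [/eqP|->]; last by rewrite mulr0.
  by rewrite mulf_eq0 (negbTE nze) => /eqP.
pose r := rl u v (f i).
have nzr : r != 0.
  apply/eqP => r0; apply: ndv; apply: linf_dvd => // x /duv /(span_of_dot_cross nuv) [s [t Ex]].
  have z w : (f i).@[fun j => u j + w * v j] = 0 by rewrite -horner_rl -/r r0 horner0.
  have zv : (f i).@[v] = 0.
    have [_ <-] := rl_top u v (hf i).
    by rewrite -/r r0 coef0.
  have [s0|ns] := eqVneq s 0.
    rewrite (@meval_eq _ _ _ (fun j => t * v j)); last by move=> j; rewrite Ex s0; ring.
    by rewrite (meval_homogZ _ _ (hf i)) zv mulr0.
  rewrite (@meval_eq _ _ _ (fun j => s * (u j + (t / s) * v j))); last first.
    by move=> j; rewrite Ex; field.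
  by rewrite (meval_homogZ _ _ (hf i)) z mulr0.
have [rs Er] := closed_field_poly_normal r.
exists (v :: [seq (fun j => u j + w * v j) | w <- rs]) => x [/duv dx fx] nzx.
have [s [t Ex]] := span_of_dot_cross nuv dx.
have [s0|ns] := eqVneq s 0.
  exists v; split; first by left.
  exists t; split; last by move=> j; rewrite Ex s0; ring.
  by apply/eqP => t0; case: nzx => j; rewrite Ex s0 t0 !mul0r addr0 eqxx.
exists (fun j => u j + (t / s) * v j); split; last by exists s; split => // j; rewrite Ex; field.
right; apply/List.in_map_iff; exists (t / s); split => //.
have : root r (t / s).
  rewrite /root horner_rl.
  have /eqP := fx i; rewrite (@meval_eq _ _ _ (fun j => s * (u j + (t / s) * v j))); last first.
    by move=> j; rewrite Ex; field.
  by rewrite (meval_homogZ _ _ (hf i)) mulf_eq0 expf_eq0 (negbTE ns) andbF.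
rewrite Er rootZ ?lead_coef_eq0 // root_prod_XsubC.
elim: (rs) => //= w l IH; rewrite inE => /orP [/eqP ->|/IH]; first by left.
by right.
Qed.

End ProjectivelyFinite.

(** * Elimination *)

Section HomogDivision.
Variables (K : numFieldType) (n : nat).
Implicit Types p q h : {mpoly K[n]}.

Lemma pihomog_mul h q e k : h \is e.-homog ->
  pihomog mdeg (e + k) (h * q) = h * pihomog mdeg k q.
Proof.
move=> hh; have E := pihomog_partitionE (leqnn (mmeasure mdeg q)).
have [lt_k|ge_k] := ltnP k (mmeasure mdeg q).
  rewrite {1}E mulr_sumr raddf_sum (bigD1 (Ordinal lt_k)) //= big1 => [|i ne_ik].
    by rewrite addr0 pihomog_dE // dhomogM // pihomogP.
  apply: (@pihomog_ne0 _ _ _ (e + i)); last by rewrite dhomogM // pihomogP.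
  by rewrite eqn_add2l.
have z l : (forall i : 'I_(mmeasure mdeg q), (i : nat) != l) -> pihomog mdeg l q = 0.
  move=> hl; rewrite {1}E raddf_sum big1 // => i _.
  by apply: (@pihomog_ne0 _ _ _ i) => //; apply: pihomogP.
rewrite z ?mulr0; last by move=> i; have := ltn_ord i; lia.
rewrite {1}E mulr_sumr raddf_sum big1 // => i _.
apply: (@pihomog_ne0 _ _ _ (e + i)); last by rewrite dhomogM // pihomogP.
by have := ltn_ord i; lia.
Qed.

Lemma homog_cofactor h q p e d : h != 0 -> h \is e.-homog -> p \is d.-homog ->
  p = h * q -> q \is (d - e).-homog.
Proof.
move=> nzh hh hp E; have [le_ed|lt_de] := leqP e d.
  suff -> : q = pihomog mdeg (d - e) q by apply: pihomogP.
  apply: (mulfI nzh); rewrite -(pihomog_mul _ _ hh) -E subnKC //.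
  by rewrite pihomog_dE.
(* For d < e the truncated difference is harmless, since degrees force [q] to be 0. *)
have [->|nzq] := eqVneq q 0; first by apply: rpred0.
have nzp : p != 0 by rewrite E mulf_neq0.
have : (msize p).-1 = d by apply/esym/(dhomog_uniq nzp hp)/(dhomog_msize hp).
have : (msize h).-1 = e by apply/esym/(dhomog_uniq nzh hh)/(dhomog_msize hh).
have sq : (0 < msize q)%N by rewrite lt0n msize_poly_eq0.
have sh : (0 < msize h)%N by rewrite lt0n msize_poly_eq0.
rewrite E msizeM // => eh eq; exfalso.
have key (a b k l : nat) : (0 < a -> 0 < b -> a.-1 = k -> (a + b).-2 = l -> l < k -> False)%N by lia.
exact: key sh sq eh eq lt_de.
Qed.

End HomogDivision.

Section Elimination.
Variable K : numClosedFieldType.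
Implicit Types (a b x : 'I_3 -> K) (p q h : {mpoly K[3]}).

(** Only homogeneous factors are tested, which is what elimination can produce; for nonzero
    homogeneous triples this agrees with [no_common_factor]. *)
Definition hcoprime (f : triple K) := forall h e,
  h != 0 -> h \is e.-homog -> (forall i, exists q, f i = h * q) -> e = 0%N.

Definition inideal (f : triple K) p := exists C : triple K, p = \sum_(i < 3) C i * f i.

Lemma inidealD f p q : inideal f p -> inideal f q -> inideal f (p + q).
Proof.
move=> [C ->] [D ->]; exists (fun i => C i + D i); rewrite -big_split /=.
by apply: eq_bigr => i _; rewrite mulrDl.
Qed.

Lemma inidealM f p q : inideal f q -> inideal f (p * q).
Proof.
move=> [C ->]; exists (fun i => p * C i); rewrite mulr_sumr.
by apply: eq_bigr => i _; rewrite mulrA.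
Qed.

Lemma inideal_gen f i : inideal f (f i).
Proof.
exists (fun j => (j == i)%:R); rewrite (bigD1 i) //= eqxx mul1r big1 ?addr0 // => j ne.
by rewrite (negbTE ne) mul0r.
Qed.

Lemma inideal_eval f p x : inideal f p -> (forall i, (f i).@[x] = 0) -> p.@[x] = 0.
Proof.
by move=> [C ->] h; rewrite raddf_sum big1 // => i _; rewrite /= mevalM h mulr0.
Qed.

(** The chart x_1 = 1, with x_2 as outer variable and x_0 in the coefficients, so that eliminating
    x_2 leaves forms in x_0 and x_1. *)
Definition dehom_var (i : 'I_3) : {poly {poly K}} :=
  match val i with 0 => 'X%:P | 1 => 1 | _ => 'X end.

Definition dehom (p : {mpoly K[3]}) : {poly {poly K}} :=
  mmap (@polyC {poly K} \o @polyC K) dehom_var p.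

Lemma dehomD p q : dehom (p + q) = dehom p + dehom q.
Proof. by rewrite /dehom rmorphD. Qed.
Lemma dehomM p q : dehom (p * q) = dehom p * dehom q.
Proof. by rewrite /dehom rmorphM. Qed.
Lemma dehomB p q : dehom (p - q) = dehom p - dehom q.
Proof. by rewrite /dehom rmorphB. Qed.
Lemma dehom_sum (I : Type) (r : seq I) (F : I -> {mpoly K[3]}) :
  dehom (\sum_(i <- r) F i) = \sum_(i <- r) dehom (F i).
Proof. by rewrite /dehom rmorph_sum. Qed.
Lemma dehomC c : dehom c%:MP = c%:P%:P.
Proof. by rewrite /dehom mmapC. Qed.
Lemma dehomX i : dehom 'X_i = dehom_var i.
Proof. by rewrite /dehom mmapX mmap1U. Qed.

Definition pt3 (u v w : K) (i : 'I_3) : K := match val i with 0 => u | 1 => v | _ => w end.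

Lemma dehom_eval p s z : ((dehom p).[z%:P]).[s] = p.@[pt3 s 1 z].
Proof.
elim/mpoly_struct_ind: p => [c|i|p q IHp IHq|p q IHp IHq].
- by rewrite dehomC mevalC !hornerC.
- rewrite dehomX mevalXU; elim/ord3_ind: i; rewrite /dehom_var /pt3 /=.
  + by rewrite hornerC hornerX.
  + by rewrite !hornerC.
  + by rewrite hornerX hornerC.
- by rewrite dehomD mevalD !hornerD IHp IHq.
by rewrite dehomM mevalM !hornerM IHp IHq.
Qed.

Lemma dehom_inj N p : p \is N.-homog -> dehom p = 0 -> p = 0.
Proof.
move=> hp p0; have nz : ('X_i1 : {mpoly K[3]}) != 0.
  by apply/eqP => /(congr1 (meval (fun=> 1))); rewrite mevalXU meval0 => /eqP; rewrite oner_eq0.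
apply: (mpoly_cancel nz) => v; rewrite mevalXU meval0 => v1.
rewrite (@meval_eq _ _ _ (fun i => v i1 * pt3 (v i0 / v i1) 1 (v i2 / v i1) i)); last first.
  by elim/ord3_ind; rewrite /pt3 /=; field.
by rewrite (meval_homogZ _ _ hp) -dehom_eval p0 !horner0 mulr0.
Qed.

Lemma dehom_inj2 N p q : p \is N.-homog -> q \is N.-homog -> dehom p = dehom q -> p = q.
Proof.
move=> hp hq E; apply/eqP; rewrite -subr_eq0; apply/eqP.
by apply: (@dehom_inj N); [apply: rpredB | rewrite dehomB E subrr].
Qed.

(** Rehomogenisation is asked in every large degree, so that several lifts can be given a common
    one. *)
Definition liftable (P : {poly {poly K}}) := exists N0, forall N, (N0 <= N)%N ->
  exists p, p \is N.-homog /\ dehom p = P.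

Lemma liftableD P Q : liftable P -> liftable Q -> liftable (P + Q).
Proof.
move=> [N hP] [M hQ]; exists (maxn N M) => k; rewrite geq_max => /andP [/hP [p [hp Ep]] /hQ [q [hq Eq]]].
by exists (p + q); rewrite rpredD // dehomD Ep Eq.
Qed.

Lemma liftableM P Q : liftable P -> liftable Q -> liftable (P * Q).
Proof.
move=> [N hP] [M hQ]; exists (N + M)%N => k le_k.
have [p [hp Ep]] := hP N (leqnn _); have [|q [hq Eq]] := hQ (k - N)%N; first by lia.
exists (p * q); rewrite dehomM Ep Eq; split => //.
have -> : k = (N + (k - N))%N by lia.
by apply: dhomogM => //; rewrite addKn.
Qed.

Lemma dhomogU (i : 'I_3) : ('X_i : {mpoly K[3]}) \is 1.-homog.
Proof. by rewrite dhomogX /= mdeg1. Qed.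

Lemma dhomogXn (i : 'I_3) m : ('X_i ^+ m : {mpoly K[3]}) \is m.-homog.
Proof. by have := dhomogMn m (dhomogU i); rewrite mul1n. Qed.

Lemma liftable_var i : liftable (dehom_var i).
Proof.
exists 1%N => N le_N; exists ('X_i1 ^+ N.-1 * 'X_i); split.
  by have := dhomogM (dhomogXn i1 N.-1) (dhomogU i); rewrite addn1 prednK.
rewrite dehomM dehomX -[RHS]mul1r; congr (_ * _).
by elim: N.-1 => [|m IH]; rewrite ?expr0 -?mpolyC1 ?dehomC // exprS dehomM IH dehomX mulr1.
Qed.

Lemma liftable_const c : liftable c%:P%:P.
Proof.
exists 0%N => N _; exists (c *: 'X_i1 ^+ N); rewrite rpredZ ?dhomogXn //; split => //.
rewrite -mul_mpolyC dehomM dehomC -[RHS]mulr1; congr (_ * _).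
by elim: N => [|m IH]; rewrite ?expr0 -?mpolyC1 ?dehomC // exprS dehomM IH dehomX mulr1.
Qed.

Lemma liftable_all P : liftable P.
Proof.
elim/poly_ind: P => [|P c IH]; first exact: (liftable_const 0).
apply: liftableD; first by apply: liftableM => //; exact: (liftable_var i2).
elim/poly_ind: c => [|q c IHq]; first exact: (liftable_const 0).
rewrite polyCD polyCM; apply: liftableD; last exact: liftable_const.
by apply: liftableM => //; exact: (liftable_var i0).
Qed.

Lemma factor_XsubC_coefs (P : {poly {poly K}}) (t : K) :
  map_poly (horner_eval t) P = 0 -> exists Q, P = ('X - t%:P) *: Q.
Proof.
move=> h; exists (map_poly (fun c => c %/ ('X - t%:P)) P).
apply/polyP => i; rewrite coefZ coef_map_id0 ?div0p //.
move/polyP: h => /(_ i); rewrite coef_map coef0 /= /horner_eval => hi.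
rewrite mulrC divpK // dvdp_XsubCl; exact/rootP.
Qed.

(* Gauss's lemma over [K[s]], whose primes are the [s - t]. *)
Lemma gauss_clear (c : {poly K}) (G v : 'I_3 -> {poly {poly K}}) (g : {poly {poly K}}) :
  c != 0 -> (forall i, c *: G i = g * v i) ->
  exists g' : {poly {poly K}}, size g' = size g /\ forall i, exists v', G i = g' * v'.
Proof.
have [k] := ubnP (size c); elim: k c g v => // k IH c g v sc nzc E.
have [le1|gt1] := leqP (size c) 1.
  have [c0 Ec] : exists c0, c = c0%:P by exists c`_0; apply: size1_polyC.
  have nz0 : c0 != 0 by rewrite -polyC_eq0 -Ec.
  exists g; split => // i; exists (c0^-1%:P *: v i).
  rewrite -scalerAr -E scalerA Ec -polyCM mulVf // ?scale1r //.
have [t ht] := poly_root gt1.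
have [c' Ec] : exists c', c = ('X - t%:P) * c'.
  have /factor_theorem [c' ->] : root c t by apply/rootP.
  by exists c'; rewrite mulrC.
have nzX : 'X - t%:P != 0 by rewrite polyXsubC_eq0.
have nzc' : c' != 0 by apply: contraNneq nzc => z; rewrite Ec z mulr0.
have sc' : (size c' < k)%N.
  by move: sc; rewrite Ec size_mul // size_XsubC addSn /= ltnS.
have E0 i : map_poly (horner_eval t) g * map_poly (horner_eval t) (v i) = 0.
  rewrite -rmorphM /= -E -mul_polyC rmorphM /= map_polyC /= /horner_eval ht.
  by rewrite polyC0 mul0r.
have cancelX (P Q : {poly {poly K}}) : ('X - t%:P) *: P = ('X - t%:P) *: Q -> P = Q.
  by rewrite -!mul_polyC => /mulfI; apply; rewrite polyC_eq0.
have [g0|ng0] := eqVneq (map_poly (horner_eval t) g) 0.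
  have [g1 Eg] := factor_XsubC_coefs g0.
  have [|g' [sg' hg']] := IH c' g1 v sc' nzc'.
    by move=> i; apply: cancelX; rewrite scalerA -Ec E Eg scalerAl.
  exists g'; split => //; rewrite sg' Eg size_scale //.
have hv i : exists w, v i = ('X - t%:P) *: w.
  by apply: factor_XsubC_coefs; have /eqP := E0 i; rewrite mulf_eq0 (negbTE ng0) => /eqP.
pose w i := proj1_sig (constructive_indefinite_description _ (hv i)).
have Ew i : v i = ('X - t%:P) *: w i by rewrite /w; case: constructive_indefinite_description.
apply: (IH c' g w) => // i; apply: cancelX.
by rewrite scalerA -Ec E Ew scalerAr.
Qed.

End Elimination.

Section EliminationLemma.
Variable K : numClosedFieldType.
Implicit Types (a b x : 'I_3 -> K) (p q h : {mpoly K[3]}).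

Definition e1v : 'I_3 -> K := pt3 0 1 0.

Lemma linf_e1v : linf e1v = 'X_i1.
Proof. by rewrite /linf sum3 /e1v /pt3 /= !scale0r scale1r add0r addr0. Qed.

Lemma e1v_nz : nonzero_vec e1v.
Proof. by exists i1; rewrite oner_neq0. Qed.

Lemma dehomX1n m : dehom ('X_i1 ^+ m : {mpoly K[3]}) = 1.
Proof.
by elim: m => [|m IH]; rewrite ?expr0 -?mpolyC1 ?dehomC // exprS dehomM IH dehomX mulr1.
Qed.

(** An affine common factor lifts only up to powers of ['X_i1]. Since that variable is prime, each
    power can be cancelled against [G] or against all the [V i], without changing [dehom G]. *)
Lemma peel_X1 (f : triple K) m (G : {mpoly K[3]}) e (V : triple K) :
  G != 0 -> G \is e.-homog -> (forall i, 'X_i1 ^+ m * f i = G * V i) ->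
  exists G' e', [/\ G' != 0, G' \is e'.-homog, dehom G' = dehom G
                  & forall i, exists q, f i = G' * q].
Proof.
have nzX : ('X_i1 : {mpoly K[3]}) != 0 by rewrite -linf_e1v linf_neq0 //; exact: e1v_nz.
elim: m G e V => [|m IH] G e V nzG hG E.
  by exists G, e; split=> // i; exists (V i); rewrite -E expr0 mul1r.
have P i : (exists p', G = 'X_i1 * p') \/ (exists q', V i = 'X_i1 * q').
  rewrite -linf_e1v; apply: (@linf_prime _ _ _ _ ('X_i1 ^+ m * f i)); first exact: e1v_nz.
  by rewrite -E linf_e1v exprS mulrA.
case: (classic (exists p', G = 'X_i1 * p')) => [[G1 EG]|ndG].
  have nzG1 : G1 != 0 by apply: contraNneq nzG => z; rewrite EG z mulr0.
  have hG1 := homog_cofactor nzX (dhomogU K i1) hG EG.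
  have [|G' [e' [h1 h2 h3 h4]]] := IH G1 _ V nzG1 hG1.
    by move=> i; apply: (mulfI nzX); rewrite mulrA -exprS E EG mulrA.
  by exists G', e'; split=> //; rewrite h3 EG dehomM dehomX mul1r.
have hV i : exists q', V i = 'X_i1 * q' by case: (P i).
pose W i := proj1_sig (constructive_indefinite_description _ (hV i)).
have EW i : V i = 'X_i1 * W i by rewrite /W; case: constructive_indefinite_description.
by apply: (IH G e W) => // i; apply: (mulfI nzX); rewrite mulrA -exprS E EW mulrCA.
Qed.

Lemma dehom_product (rs : seq K) :
  dehom (\prod_(t <- rs) linf (pt3 1 (- t) 0)) = (\prod_(t <- rs) ('X - t%:P))%:P.
Proof.
elim: rs => [|t rs IH]; first by rewrite !big_nil -mpolyC1 dehomC.
rewrite !big_cons dehomM IH polyCM; congr (_ * _).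
rewrite /linf sum3 /pt3 /= scale0r addr0 scale1r dehomD dehomX /dehom_var /= -mul_mpolyC.
by rewrite dehomM dehomC dehomX mulr1 polyCD !polyCN.
Qed.

Lemma prod_linf_homog (rs : seq ('I_3 -> K)) : \prod_(a <- rs) linf a \is (size rs).-homog.
Proof.
elim: rs => [|a rs IH]; first by rewrite big_nil; apply: dhomog1.
by rewrite big_cons; apply: (dhomogM (linf_homog a) IH).
Qed.

(** Elimination of x_2 in the chart: Bezout's identity over K(x_0) puts a polynomial in x_0 alone
    into the ideal. It splits, and its factors homogenise to linear forms without x_2, that is, to
    lines through (0,0,1). *)
Lemma elimination_std (f : triple K) d : (forall i, f i \is d.-homog) -> hcoprime f ->
  exists r : seq ('I_3 -> K), (forall a, List.In a r -> nonzero_vec a /\ a i2 = 0) /\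
    inideal f (\prod_(a <- r) linf a).
Proof.
move=> hf cop; pose G i := dehom (f i).
pose g01 := gcdp (G i0) (G i1); pose g := gcdp g01 (G i2).
have dvg i : exists cv : {poly K} * {poly {poly K}}, cv.1 != 0 /\ cv.1 *: G i = g * cv.2.
  have : g %| G i.
    elim/ord3_ind: i; last exact: dvdp_gcdr.
      exact: dvdp_trans (dvdp_gcdl _ _) (dvdp_gcdl _ _).
    exact: dvdp_trans (dvdp_gcdl _ _) (dvdp_gcdr _ _).
  by move=> /Pdiv.Idomain.dvdpP [cv nz E]; exists cv; rewrite mulrC.
have nzg : g != 0.
  apply/negP; rewrite gcdp_eq0 gcdp_eq0 => /andP [/andP [/eqP z0 /eqP z1] /eqP z2].
  have z i : f i = 0 by apply: (dehom_inj (hf i)); elim/ord3_ind: i.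
  have := cop 'X_i1 1%N; rewrite -linf_e1v linf_neq0 ?linf_homog; last exact: e1v_nz.
  by move=> /(_ isT isT) H; have // := H (fun i => ex_intro _ 0 _); move=> HH;
     have : (1 = 0)%N by apply: HH => i; rewrite z mulr0.
(* A gcd of positive degree in x_2 would give a common form of positive degree, by Gauss's lemma,
   rehomogenisation and [peel_X1]. *)
have [le1|gt1] := leqP (size g) 1; last first.
  exfalso.
  pose cv i := proj1_sig (constructive_indefinite_description _ (dvg i)).
  have Ecv i : (cv i).1 != 0 /\ (cv i).1 *: G i = g * (cv i).2.
    by rewrite /cv; case: constructive_indefinite_description.
  pose c := (cv i0).1 * (cv i1).1 * (cv i2).1.
  have nzcv i : (cv i).1 != 0 by case: (Ecv i).
  have nzc : c != 0 by rewrite !mulf_neq0.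
  have hv i : exists v, c *: G i = g * v.
    have [_ E] := Ecv i; elim/ord3_ind: i E => E.
    - by exists (((cv i1).1 * (cv i2).1) *: (cv i0).2); rewrite -scalerAr -E scalerA; congr (_ *: _); rewrite /c; ring.
    - by exists (((cv i0).1 * (cv i2).1) *: (cv i1).2); rewrite -scalerAr -E scalerA; congr (_ *: _); rewrite /c; ring.
    by exists (((cv i0).1 * (cv i1).1) *: (cv i2).2); rewrite -scalerAr -E scalerA; congr (_ *: _); rewrite /c; ring.
  pose v i := proj1_sig (constructive_indefinite_description _ (hv i)).
  have Ev i : c *: G i = g * v i by rewrite /v; case: constructive_indefinite_description.
  have [g' [sg' hg']] := gauss_clear nzc Ev.
  pose w i := proj1_sig (constructive_indefinite_description _ (hg' i)).
  have Ew i : G i = g' * w i by rewrite /w; case: constructive_indefinite_description.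
  have [N0 hN0] := liftable_all g'.
  have [M0 hM0] := liftable_all (w i0); have [M1 hM1] := liftable_all (w i1).
  have [M2 hM2] := liftable_all (w i2).
  have [Gh [hGh EGh]] := hN0 N0 (leqnn _).
  pose M := (d + M0 + M1 + M2)%N.
  have hW i : exists q, q \is M.-homog /\ dehom q = w i.
    by elim/ord3_ind: i; [apply: hM0|apply: hM1|apply: hM2]; rewrite /M; lia.
  pose W i := proj1_sig (constructive_indefinite_description _ (hW i)).
  have EW i : W i \is M.-homog /\ dehom (W i) = w i.
    by rewrite /W; case: constructive_indefinite_description.
  have nzGh : Gh != 0.
    by apply/eqP => z; move: gt1; rewrite -sg' -EGh z /dehom mmap0 size_poly0.
  have E i : 'X_i1 ^+ (N0 + M - d) * f i = Gh * W i.
    have [hWi EWi] := EW i.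
    apply: (@dehom_inj2 _ (N0 + M)); last by rewrite !dehomM dehomX1n mul1r EGh EWi -Ew.
      have -> : (N0 + M = (N0 + M - d) + d)%N by rewrite /M; lia.
      by apply: dhomogM; [rewrite addnK; exact: dhomogXn|].
    exact: dhomogM.
  have [G' [e' [nzG' hG' EG' dvG']]] := peel_X1 nzGh hGh E.
  have e0 := cop _ _ nzG' hG' dvG'; rewrite e0 in hG'.
  have sG : (msize G' <= 1)%N.
    have := dhomog_uniq nzG' hG' (dhomog_msize hG') => /esym.
    by case: (mmeasure _ _) => [|[|k]].
  move: gt1; rewrite -sg' -EGh -EG' (msize1_polyC sG) dehomC.
  by rewrite ltnNge size_polyC_leq1.
(* Bezout's identity with denominators cleared; as [g] does not involve x_2, its right-hand side
   lies in K[x_0]. *)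
have [A [r [nzr E]]] : exists (A : 'I_3 -> {poly {poly K}}) (r : {poly K}), r != 0 /\
    \sum_(i < 3) A i * G i = r%:P.
  have [u /Pdiv.Idomain.eqpP [[c1 c2] /= /andP [n1 n2] Eu]] := Pdiv.Idomain.Bezoutp g01 (G i2).
  have [v /Pdiv.Idomain.eqpP [[c3 c4] /= /andP [n3 n4] Ev]] := Pdiv.Idomain.Bezoutp (G i0) (G i1).
  exists (fun i => match val i with
    | 0 => (c1 * c3) *: (u.1 * v.1) | 1 => (c1 * c3) *: (u.1 * v.2) | _ => (c1 * c4) *: u.2 end).
  exists (c4 * c2 * g`_0); split.
    rewrite !mulf_neq0 //; apply: contraNneq nzg => z.
    by rewrite (size1_polyC le1) z polyC0.
  have Eg : g = (g`_0)%:P := size1_polyC le1.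
  have -> : (c4 * c2 * g`_0)%:P = c4 *: (c2 *: g) by rewrite scalerA polyCM -Eg mul_polyC.
  rewrite sum3 /= -Eu -!mul_polyC.
  rewrite -!mul_polyC in Ev.
  transitivity (c1%:P * u.1 * (c3%:P * (v.1 * G i0 + v.2 * G i1)) + c1%:P * c4%:P * u.2 * G i2).
    by rewrite !polyCM; ring.
  by rewrite Ev -/g01; ring.
have [rs Er] := closed_field_poly_normal r.
have hA i : exists N0, forall N, (N0 <= N)%N -> exists p, p \is N.-homog /\ dehom p = A i.
  exact: liftable_all.
have [M0 hM0] := hA i0; have [M1 hM1] := hA i1; have [M2 hM2] := hA i2.
pose N := (d + M0 + M1 + M2 + size rs)%N.
have hC i : exists q, q \is (N - d).-homog /\ dehom q = A i.
  by elim/ord3_ind: i; [apply: hM0|apply: hM1|apply: hM2]; rewrite /N; lia.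
pose C i := proj1_sig (constructive_indefinite_description _ (hC i)).
have EC i : C i \is (N - d).-homog /\ dehom (C i) = A i.
  by rewrite /C; case: constructive_indefinite_description.
(* The roots [t] of [r] give the forms x_0 - t x_1; copies of [e1v], whose form is ['X_i1], raise
   the degree to [N], where all the coefficients [A i] lift. *)
exists (nseq (N - size rs) e1v ++ [seq pt3 1 (- t) 0 | t <- rs]); split.
  move=> a /List.in_app_iff [h|/List.in_map_iff [t [<- _]]].
    have -> : a = e1v by elim: (_ - _)%N h => //= k IH [<-|/IH].
    by split=> //; exact: e1v_nz.
  by split=> //; exists i0; rewrite oner_neq0.
rewrite big_cat big_map /=.
have -> : \prod_(a <- nseq (N - size rs) e1v) linf a = 'X_i1 ^+ (N - size rs).
  by elim: (N - size rs)%N => [|k IH]; rewrite ?big_nil //= big_cons IH linf_e1v exprS.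
exists (fun i => (lead_coef r)^-1 *: C i).
apply: (@dehom_inj2 _ N).
- have := dhomogM (dhomogXn K i1 (N - size rs)) (prod_linf_homog [seq pt3 1 (- t) 0 | t <- rs]).
  by rewrite size_map big_map subnK // /N; lia.
- apply: rpred_sum => i _; have [hCi _] := EC i.
  have := dhomogM (rpredZ (lead_coef r)^-1 hCi) (hf i).
  by rewrite subnK // /N; lia.
rewrite dehomM dehomX1n mul1r dehom_product dehom_sum.
have -> : \sum_(i < 3) dehom ((lead_coef r)^-1 *: C i * f i) =
     (lead_coef r)^-1%:P%:P * \sum_(i < 3) A i * G i.
  rewrite mulr_sumr; apply: eq_bigr => i _; case: (EC i) => _ EA.
  by rewrite dehomM -mul_mpolyC dehomM dehomC EA -mulrA.
rewrite E -polyCM; congr (_%:P); rewrite [X in _ * X]Er mul_polyC scalerA mulVf ?scale1r //.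
by rewrite lead_coef_eq0.
Qed.

End EliminationLemma.

(** * Coprime triples of forms *)

Section Coprimality.
Variable K : numClosedFieldType.
Implicit Types (a b o x : 'I_3 -> K) (p q h : {mpoly K[3]}).

(** The linear change of coordinates that carries the standard basis to [b], [c], [o]; [frame_from]
    is its inverse by Cramer's rule. *)
Definition frame_to (b c o : 'I_3 -> K) : 3.-tuple {mpoly K[3]} :=
  [tuple linf (pt3 (b j) (c j) (o j)) | j < 3].
Definition frame_from (b c o : 'I_3 -> K) : 3.-tuple {mpoly K[3]} :=
  [tuple (det3 b c o)^-1 *: linf
     (match val j with 0 => cross c o | 1 => cross o b | _ => cross b c end) | j < 3].

Lemma frame_to_from b c o p : det3 b c o != 0 -> (p \mPo frame_to b c o) \mPo frame_from b c o = p.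
Proof.
move=> D; apply: mpoly_eval_inj => x; rewrite !comp_mpoly_meval.
apply: meval_eq => j; rewrite tnth_mktuple meval_linf dotE !tnth_mktuple !mevalZ !meval_linf.
move: D; rewrite /pt3 /= !dotE !det3E !crossE => D.
by apply: (mulfI D); elim/ord3_ind: j; field.
Qed.

Lemma frame_from_to b c o p : det3 b c o != 0 -> (p \mPo frame_from b c o) \mPo frame_to b c o = p.
Proof.
move=> D; apply: mpoly_eval_inj => x; rewrite !comp_mpoly_meval.
apply: meval_eq => j; rewrite tnth_mktuple mevalZ meval_linf dotE !tnth_mktuple !meval_linf.
move: D; rewrite /pt3 !dotE !det3E /= => D.
by elim/ord3_ind: j; rewrite /= !crossE; field.
Qed.

(** Transport of [elimination_std] by a frame that moves the centre (0,0,1) to [o]. *)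
Lemma elimination (f : triple K) d o : (forall i, f i \is d.-homog) -> hcoprime f ->
  nonzero_vec o ->
  exists r : seq ('I_3 -> K), (forall a, List.In a r -> nonzero_vec a /\ dot a o = 0) /\
    inideal f (\prod_(a <- r) linf a).
Proof.
move=> hf cop nzo; have [b [c D']] := complete_basis nzo.
have D : det3 b c o != 0 by move: D'; congr (_ != _); rewrite !det3E; ring.
set T := frame_to b c o; set T' := frame_from b c o.
have hT i : tnth T i \is 1.-homog by rewrite tnth_mktuple linf_homog.
have hT' i : tnth T' i \is 1.-homog by rewrite tnth_mktuple rpredZ ?linf_homog.
have [||r [hr [C EC]]] := @elimination_std K (fun i => f i \mPo T) d.
- by move=> i; have := dhomog_comp (hf i) hT; rewrite muln1.
- move=> h e nzh hh dv; apply: (cop (h \mPo T')).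
  + by apply: contraNneq nzh => z; rewrite -(frame_from_to h D) -/T' z comp_mpoly0.
  + by have := dhomog_comp hh hT'; rewrite muln1.
  move=> i; have [q Eq] := dv i; exists (q \mPo T').
  by rewrite -(frame_to_from (f i) D) -/T -/T' Eq rmorphM.
pose tr a := fun j => (det3 b c o)^-1 * (a i0 * cross c o j + a i1 * cross o b j + a i2 * cross b c j).
have Etr a : linf a \mPo T' = linf (tr a).
  apply: mpoly_eval_inj => x; rewrite comp_mpoly_meval !meval_linf !dotE.
  by rewrite !tnth_mktuple !mevalZ !meval_linf !dotE /tr; ring.
exists [seq tr a | a <- r]; split.
  move=> a' /List.in_map_iff [a [<- /hr [nza a2]]]; split; last first.
    by rewrite dotE /tr a2 !crossE; ring.
  apply: NNPP => /not_nonzero_vec z; case/eqP: (linf_neq0 nza).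
  rewrite -(frame_from_to (linf a) D) -/T' Etr /linf big1 ?comp_mpoly0 // => j _.
  by rewrite z scale0r.
exists (fun i => C i \mPo T').
rewrite big_map -(eq_bigr _ (fun a _ => Etr a)) -rmorph_prod /= EC rmorph_sum.
by apply: eq_bigr => i _; rewrite rmorphM /= frame_to_from.
Qed.

Lemma hcoprime_linf (f : triple K) a : hcoprime f -> nonzero_vec a ->
  exists i, ~ exists q, f i = linf a * q.
Proof.
move=> cop nza; apply: NNPP => h.
have // := cop (linf a) 1%N (linf_neq0 nza) (linf_homog a) _.
by move=> H; have // : (1 = 0)%N by apply: H => i; apply: NNPP => hi; apply: h; exists i.
Qed.

(** By elimination the common zeros lie on finitely many lines, and none of these divides all three
    forms. *)
Lemma hcoprime_zeros_pfinite (f : triple K) d : (forall i, f i \is d.-homog) ->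
  hcoprime f -> pfinite (fun x => forall i, (f i).@[x] = 0).
Proof.
move=> hf cop; have [r [hr Ir]] := elimination hf cop (e1v_nz K).
have fin : pfinite (fun x => exists a, List.In a r /\ (dot a x = 0 /\ forall i, (f i).@[x] = 0)).
  apply: pfinite_bigor => a /hr [nza _].
  exact: (plane_zeros_pfinite nza hf (hcoprime_linf cop nza)).
apply: pfinite_sub fin => x _ fx.
have /eqP := inideal_eval Ir fx.
elim: (r) => [|a l IH]; first by rewrite big_nil meval1 oner_eq0.
rewrite big_cons mevalM mulf_eq0 meval_linf => /orP [/eqP h|/IH [a' [la' h]]].
  by exists a; split=> //; left.
by exists a'; split=> //; right.
Qed.

Lemma common_factor_of_infinite (f : triple K) d : (forall i, f i \is d.-homog) ->
  ~ pfinite (fun x => forall i, (f i).@[x] = 0) ->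
  exists h e, [/\ h != 0, h \is e.-homog, (0 < e)%N & forall i, exists q, f i = h * q].
Proof.
move=> hf inf; apply: NNPP => H; apply: inf; apply: (hcoprime_zeros_pfinite hf).
move=> h [//|e] nzh hh dv; exfalso; apply: H; exists h, e.+1; split=> //.
Qed.

(** If a product of linear forms is the combination of the [w j] with coefficients [C j],
    parallelism turns that product times [O i] into a common multiplier times [w i]. The linear
    factors then cancel one by one, since none divides every [w i]. *)
Lemma parallel_multiple (w O : triple K) d : (forall i, w i \is d.-homog) -> hcoprime w ->
  (forall i j, O i * w j = O j * w i) -> exists g, forall i, O i = g * w i.
Proof.
move=> hw cop par; have [r [hr [C EC]]] := elimination hw cop (e1v_nz K).
have [S ES] : exists S, forall i, (\prod_(a <- r) linf a) * O i = S * w i.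
  exists (\sum_(j < 3) C j * O j) => i; rewrite EC !mulr_suml; apply: eq_bigr => j _.
  by rewrite -!mulrA -par [w j * _]mulrC.
have {EC}hr' : forall a, List.In a r -> nonzero_vec a by move=> a /hr [].
elim: r hr' {hr} S ES => [|a r IH] hr S ES.
  by exists S => i; rewrite -ES big_nil mul1r.
have nza : nonzero_vec a by apply: hr; left.
have [i ndv] := hcoprime_linf cop nza.
have [|[S' ES']|[q Eq]] := @linf_prime _ a S (w i) (\prod_(a <- r) linf a * O i) nza.
- by rewrite -ES big_cons mulrA.
- apply: (IH _ S') => [a' h|j]; first by apply: hr; right.
  apply: (mulfI (linf_neq0 nza)); rewrite !mulrA -ES' -ES big_cons; ring.
by case: ndv; exists q.
Qed.

Lemma pihomog_large (p : {mpoly K[3]}) k : (msize p <= k)%N -> pihomog mdeg k p = 0.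
Proof.
move=> le_k; rewrite pihomogE big_seq_cond big_pred0 // => m.
apply/negbTE/negP => /andP [mp /eqP Em]; have := msize_mdeg_lt mp.
by move: Em => /= ->; rewrite ltnNge le_k.
Qed.

Lemma hcoprime_no_common_factor (f : triple K) d : (forall i, f i \is d.-homog) ->
  (exists i, f i != 0) -> hcoprime f -> no_common_factor f.
Proof.
move=> hf [k nzk] cop h dv.
have nzh : h != 0.
  by have [q Eq] := dv k; apply: contraNneq nzk => z; rewrite Eq z mul0r.
(* The top form of a common factor again divides every [f i], because these are homogeneous. *)
pose e := (msize h).-1; pose t := pihomog mdeg e h.
have top i q : f i = h * q -> exists q', f i = t * q'.
  move=> Eq; have [->|nzf] := eqVneq (f i) 0; first by exists 0; rewrite mulr0.
  have nzq : q != 0 by apply: contraNneq nzf => z; rewrite Eq z mulr0.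
  have Ed : (e + (msize q).-1)%N = d.
    have -> : d = (msize (f i)).-1 by apply: (dhomog_uniq nzf (hf i)); apply: (dhomog_msize (hf i)).
    rewrite Eq msizeM // /e; move: nzh nzq; rewrite -!msize_poly_eq0.
    by case: (msize h) => // k' _; case: (msize q) => // l' _ /=; rewrite addnS.
  exists (pihomog mdeg (msize q).-1 q).
  rewrite -(@pihomog_mul _ _ t _ e); last exact: pihomogP.
  rewrite Ed -{1}(pihomog_dE (hf i)) Eq.
  have Eh : h = \sum_(l < e) pihomog mdeg l h + t.
    have := @pihomog_partitionE _ _ mdeg e.+1 h; rewrite big_ord_recr /=; apply.
    exact: leqSpred.
  rewrite {1}Eh mulrDl raddfD /= mulr_suml raddf_sum big1 ?add0r // => l _.
  have lt_l := ltn_ord l.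
  have := pihomog_mul q (d - l) (pihomogP mdeg l h); rewrite subnKC; last by lia.
  move=> H; apply: (etrans H); rewrite (@pihomog_large q (d - l)) ?mulr0 //; rewrite -Ed.
  move: nzq; rewrite -msize_poly_eq0; case: (msize q) => // s' _ /=; lia.
have dvt i : exists q', f i = t * q' by have [q /top] := dv i.
have nzt : t != 0.
  by have [q Eq] := dvt k; apply: contraNneq nzk => z; rewrite Eq z mul0r.
have := cop t e nzt (pihomogP _ _ _) dvt; rewrite /e.
by case: (msize h) => [|[|?]].
Qed.

Lemma no_common_factor_hcoprime (f : triple K) : no_common_factor f -> hcoprime f.
Proof.
move=> ncf h e nzh hh /ncf; rewrite (dhomog_uniq nzh hh (dhomog_msize hh)).
by case: (mmeasure _ _) => [|[|?]].
Qed.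

Lemma no_common_factor_of_pfinite (f : triple K) d : (forall i, f i \is d.-homog) ->
  (exists i, f i != 0) -> pfinite (fun x => forall i, (f i).@[x] = 0) ->
  no_common_factor f.
Proof.
move=> hf nzf fin; apply: (hcoprime_no_common_factor hf nzf) => h [//|e] nzh hh dv.
exfalso; apply: (curve_not_pfinite nzh hh) => //; apply: pfinite_sub fin => x _ hx i.
by have [q ->] := dv i; rewrite mevalM hx mul0r.
Qed.

End Coprimality.

(** * Algebraic dependence and the Jacobian *)

Section AlgebraicDependence.
Variable K : fieldType.

Lemma msizeM_leD (p q : {mpoly K[3]}) : (msize (p * q) <= msize p + msize q)%N.
Proof.
have [->|np] := eqVneq p 0; first by rewrite mul0r msize0.
have [->|nq] := eqVneq q 0; first by rewrite mulr0 msize0.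
by rewrite msizeM // leq_pred.
Qed.

Lemma msize_exp_le (p : {mpoly K[3]}) M k : (msize p <= M -> msize (p ^+ k) <= k * M + 1)%N.
Proof.
move=> hp; elim: k => [|k IH]; first by rewrite expr0 msize1.
rewrite exprS (leq_trans (msizeM_leD _ _)) // mulSn -addnA.
by rewrite leq_add.
Qed.

(** Linear algebra: the N^4 monomials in [g] with exponents below N have degree linear in N, so they
    lie in a space of dimension of order N^3. *)
Lemma alg_dependent (g : 'I_4 -> {mpoly K[3]}) :
  exists P : {mpoly K[4]}, P != 0 /\ P \mPo [tuple g i | i < 4] = 0.
Proof.
(* [D] bounds the size of the monomials in [g] and [D <= N * A]; thus D^3 <= N^3 A^3 < N^4, which
   dictates [N]. *)
pose M := \max_(i < 4) msize (g i); pose A := (4 * M + 5)%N; pose N := (A ^ 3).+1.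
pose D := (4 * (N * M + 1) + 1)%N.
pose E := {ffun 'I_4 -> 'I_N}; pose B := 'X_{1..3 < D}.
have cE : #|{: E}| = (N ^ 4)%N by rewrite card_ffun !card_ord.
have cB : (#|{: B}| <= D ^ 3)%N.
  have -> : (D ^ 3 = #|{: {ffun 'I_3 -> 'I_D}}|)%N by rewrite card_ffun !card_ord.
  have mlt (m : B) i : (bmnm m i < D)%N.
    by apply: leq_ltn_trans (bmdeg m); rewrite mdegE (bigD1 i) //= leq_addr.
  apply: (leq_card (fun m : B => [ffun i => Ordinal (mlt m i)])) => m1 m2 /ffunP eqm.
  apply: val_inj; apply/mnmP => i; have := eqm i; rewrite !ffunE => /(congr1 val) /=.
  by [].
have lt_card : (#|{: B}| < #|{: E}|)%N.
  apply: leq_ltn_trans cB _; rewrite cE.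
  have le_D : (D <= N * A)%N by rewrite /D /A; lia.
  have := le_D; rewrite -(leq_exp2r _ _ (isT : 0 < 3)%N) => le3.
  apply: leq_ltn_trans le3 _.
  by rewrite expnMn (expnSr N 3) ltn_pmul2l ?expn_gt0.
pose mon (e : E) := [multinom (e i : nat) | i < 4].
pose G (e : E) : {mpoly K[3]} := 'X_[mon e] \mPo [tuple g i | i < 4].
have sG e : (msize (G e) <= D)%N.
  rewrite /G comp_mpolyX.
  have h i : (msize ((tnth [tuple g i | i < 4] i) ^+ mon e i) <= N * M + 1)%N.
    rewrite tnth_mktuple mnmE.
    have hM : (msize (g i) <= M)%N by exact: (leq_bigmax i).
    apply: leq_trans (msize_exp_le _ hM) _; rewrite leq_add2r leq_mul2r.
    by rewrite (ltnW (ltn_ord _)) orbT.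
  have gen (r : seq 'I_4) : (msize (\prod_(i <- r) (tnth [tuple g i | i < 4] i) ^+ mon e i)
      <= size r * (N * M + 1) + 1)%N.
    elim: r => [|i r IH]; first by rewrite big_nil msize1.
    rewrite big_cons (leq_trans (msizeM_leD _ _)) //= mulSn -addnA.
    by rewrite leq_add.
  by have := gen (enum 'I_4); rewrite size_enum_ord big_enum.
pose MA : 'M[K]_(#|{: E}|, #|{: B}|) :=
  \matrix_(i, j) (G (enum_val i))@_(enum_val j : B).
have nk : kermx MA != 0.
  rewrite kermx_eq0 /row_free neq_ltn; apply/orP; left.
  exact: leq_ltn_trans (rank_leq_col _) lt_card.
have [i0' nzr] : exists i, row i (kermx MA) != 0.
  apply: NNPP => h; case/eqP: nk; apply/row_matrixP => i; rewrite row0.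
  by apply/eqP; apply: contraT => hi; case: h; exists i.
set v := row i0' _ in nzr.
have vM : v *m MA = 0 by rewrite -row_mul mulmx_ker row0.
pose P := \sum_(i < #|{: E}|) v 0 i *: 'X_[mon (enum_val i)].
have moninj : injective mon.
  move=> e1 e2 /mnmP h; apply/ffunP => i; apply: val_inj.
  by have := h i; rewrite !mnmE.
exists P; split.
  have [j vj] : exists j, v 0 j != 0.
    apply: NNPP => h; case/eqP: nzr; apply/rowP => j; rewrite [RHS]mxE.
    by apply/eqP; apply: contraT => hj; case: h; exists j.
  apply: contraNneq vj => /(congr1 (mcoeff (mon (enum_val j)))).
  rewrite mcoeff0 /P raddf_sum (bigD1 j) //= mcoeffZ mcoeffX eqxx mulr1 big1 => [|i ne_ij]; first by rewrite addr0 => ->.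
  rewrite mcoeffZ mcoeffX; case: eqP => [/moninj /enum_val_inj Eij|]; last by rewrite mulr0.
  by case/eqP: ne_ij.
have EP : P \mPo [tuple g i | i < 4] = \sum_(i < #|{: E}|) v 0 i *: G (enum_val i).
  by rewrite /P raddf_sum; apply: eq_bigr => i _; rewrite /= comp_mpolyZ.
apply/mpolyP => m; rewrite mcoeff0 EP raddf_sum /=.
have [lt_m|ge_m] := ltnP (mdeg m) D.
  pose b : B := BMultinom lt_m; have := congr1 (fun X : 'rV_ _ => X 0 (enum_rank b)) vM.
  rewrite [LHS]mxE [RHS]mxE => h; rewrite -[RHS]h; apply: eq_bigr => i _.
  by rewrite mcoeffZ [MA _ _]mxE enum_rankK.
rewrite big1 // => i _; rewrite mcoeffZ.
have /msize_mdeg_ge := leq_trans (sG (enum_val i)) ge_m.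
by rewrite mcoeff_msupp negbK => /eqP ->; rewrite mulr0.
Qed.

End AlgebraicDependence.

(** * Relations, the Jacobian determinant and images of curves *)

Section Jacobian.
Variable K : numClosedFieldType.
Implicit Types (x v : 'I_3 -> K) (p q h : {mpoly K[3]}) (f : triple K).

Definition tup f : 3.-tuple {mpoly K[3]} := [tuple f j | j < 3].

Lemma meval_comp f p x : (p \mPo tup f).@[x] = p.@[eval_triple f x].
Proof. by rewrite comp_mpoly_meval; apply: meval_eq => i; rewrite tnth_mktuple. Qed.

(** A relation between f_0, f_1, f_2 and [h] is kept as a polynomial in the slot of [h], so that its
    degree in [h] can be minimised. *)
Definition compc f (Q : {poly {mpoly K[3]}}) : {poly {mpoly K[3]}} :=
  map_poly (comp_mpoly (tup f)) Q.

Lemma poly_dependent f h : exists Q : {poly {mpoly K[3]}}, Q != 0 /\ (compc f Q).[h] = 0.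
Proof.
pose g (i : 'I_4) := if insub (val i) is Some j then f j else h.
have [P [nzP EP]] := alg_dependent g; exists (muni P).
pose w (j : 'I_3) := widen_ord (leqnSn 3) j.
have gw j : g (w j) = f j.
  by rewrite /g /=; case: insubP => [l _ /val_inj ->//|]; rewrite ltn_ord.
have gm : g ord_max = h by rewrite /g; case: insubP => //= j; rewrite ltnn.
split; last first.
  rewrite -[RHS]EP muniE /compc rmorph_sum /= horner_sum comp_mpolyE; apply: eq_bigr => m _.
  rewrite map_polyZ hornerZ /= map_polyXn hornerXn comp_mpolyZ comp_mpolyX.
  rewrite [X in _ = _ *: X]big_ord_recr /= (tnth_mktuple g ord_max) gm -scalerAl; congr (_ *: (_ * _)).
  by apply: eq_bigr => i _; rewrite mnmE !tnth_mktuple gw.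
apply: contraNneq nzP => z; apply/eqP; apply: mpoly_vanish => v.
have munie (u : 'I_3 -> K) t : v = (fun i => if insub (val i) is Some j then u j else t) ->
    P.@[v] = (map_poly (meval u) (muni P)).[t].
  move=> Ev; have vw j : v (w j) = u j.
    by rewrite Ev /=; case: insubP => [l _ /val_inj ->//|]; rewrite ltn_ord.
  have vm : v ord_max = t by rewrite Ev; case: insubP => //= j; rewrite ltnn.
  rewrite muniE rmorph_sum /= horner_sum mevalE; apply: eq_bigr => m _.
  rewrite map_polyZ hornerZ /= map_polyXn hornerXn mevalZ mevalX.
  rewrite big_ord_recr /= vm -mulrA; congr (_ * (_ * _)).
  by apply: eq_bigr => i _; rewrite mnmE vw.
rewrite (munie (fun j => v (w j)) (v ord_max)); first by rewrite z rmorph0 horner0.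
apply: functional_extensionality => i; case: insubP => [j lt_i Ej|ge_i].
  by congr v; apply: val_inj; rewrite /= Ej.
by congr v; apply: val_inj => /=; have := ltn_ord i; move: ge_i; rewrite /=; lia.
Qed.

Lemma poly_dependent_min f h : exists Q : {poly {mpoly K[3]}}, [/\ Q != 0,
  (compc f Q).[h] = 0 & forall Q', (compc f Q').[h] = 0 -> (size Q' < size Q)%N -> Q' = 0].
Proof.
have [Q [nzQ EQ]] := poly_dependent f h; have [n] := ubnP (size Q).
elim: n Q nzQ EQ => // n IH Q nzQ EQ sQ.
case: (classic (exists Q', [/\ Q' != 0, (compc f Q').[h] = 0 & (size Q' < size Q)%N])).
  by move=> [Q' [nz E lt]]; apply: (IH Q') => //; apply: leq_trans lt _.
move=> hn; exists Q; split=> // Q' E lt; apply/eqP; apply: contraT => nz.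
by case: hn; exists Q'.
Qed.

(** The chain rule for Q(f_0, f_1, f_2, h). *)
Lemma compc_deriv_horner f h Q j : ((compc f Q).[h])^`M(j) =
  (compc f Q^`()).[h] * h^`M(j) +
  \sum_(l < 3) (compc f (map_poly (mderiv l) Q)).[h] * (f l)^`M(j).
Proof.
have cfE P c : compc f (P * 'X + c%:P) = compc f P * 'X + (c \mPo tup f)%:P.
  by rewrite /compc rmorphD rmorphM /= map_polyX map_polyC.
elim/poly_ind: Q => [|Q c IH].
  rewrite deriv0 /compc !rmorph0 !horner0 mderiv0 mul0r add0r big1 // => l _.
  by rewrite map_poly0 rmorph0 horner0 mul0r.
have Em l : map_poly (mderiv l) (Q * 'X + c%:P) = map_poly (mderiv l) Q * 'X + (mderiv l c)%:P.
  apply/polyP => k; rewrite coefD coefMX coefC !coef_map_id0 ?mderiv0 // coefD coefMX coefC.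
  by case: k => [|k] /=; rewrite mderivD ?mderiv0.
rewrite cfE hornerMXaddC mderivD mderivM IH mderiv_comp derivMXaddC.
rewrite (_ : compc f (Q + _) = compc f Q + compc f Q^`() * 'X); last first.
  by rewrite /compc rmorphD rmorphM /= map_polyX.
rewrite hornerD hornerMX.
under [in RHS]eq_bigr => l _ do rewrite Em cfE hornerMXaddC mulrDl.
rewrite big_split /=.
under [X in _ + X = _]eq_bigr => l _ do rewrite tnth_mktuple.
have -> : \sum_(i < 3) (compc f (map_poly (mderiv i) Q)).[h] * h * (f i)^`M(j) =
   (\sum_(i < 3) (compc f (map_poly (mderiv i) Q)).[h] * (f i)^`M(j)) * h.
  by rewrite mulr_suml; apply: eq_bigr => i _; ring.
ring.
Qed.

Definition jacmx f : 'M[{mpoly K[3]}]_3 := \matrix_(i, j) (f i)^`M(j).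
Definition jac f : {mpoly K[3]} := \det (jacmx f).
Definition dmx f x : 'M[K]_3 := \matrix_(i, j) ((f i)^`M(j)).@[x].

Lemma meval_jac f x : (jac f).@[x] = \det (dmx f x).
Proof.
by rewrite /jac -det_map_mx; congr (\det _); apply/matrixP => i j; rewrite !mxE.
Qed.

Lemma jac_homog f d : (forall i, f i \is d.-homog) -> jac f \is (3 * d.-1).-homog.
Proof.
move=> hf; rewrite /jac det_mx33 det3E.
have h i j : (f i)^`M(j) \is (d.-1).-homog by apply: dhomog_mderiv.
have -> : (3 * d.-1 = d.-1 + (d.-1 + d.-1))%N by lia.
by rewrite !mxE !rpredD // dhomogM // rpredB // dhomogM.
Qed.

(** Each variable satisfies a relation Q(f, x_i) = 0 of minimal degree. In characteristic 0,
    minimality and dominance keep its derivative in x_i nonzero, so differentiation writes an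
    invertible diagonal matrix as a multiple of the Jacobian matrix. *)
Lemma dominant_jac_neq0 f : dominant f -> jac f != 0.
Proof.
move=> dom.
have H (i : 'I_3) : exists (A : {mpoly K[3]}) (N : 'I_3 -> {mpoly K[3]}), A != 0 /\
    forall j, A * (i == j)%:R = \sum_(l < 3) N l * (f l)^`M(j).
  have [Q [nzQ EQ minQ]] := poly_dependent_min f 'X_i.
  exists (compc f Q^`()).['X_i], (fun l => - (compc f (map_poly (mderiv l) Q)).['X_i]).
  split; last first.
    move=> j; have := compc_deriv_horner f 'X_i Q j; rewrite EQ mderiv0 mderivXU => /esym/eqP.
    rewrite addr_eq0 => /eqP ->; rewrite -sumrN; apply: eq_bigr => l _.
    by rewrite mulNr.
  have sQ : (1 < size Q)%N.
    rewrite ltnNge; apply/negP => le1; have Ec := size1_polyC le1.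
    move: EQ nzQ; rewrite Ec /compc map_polyC hornerC => /dom ->.
    by rewrite polyC0 eqxx.
  apply/eqP => /minQ h; have lt : (size Q^`() < size Q)%N by apply: lt_size_deriv.
  have := h lt => /polyP /(_ (size Q).-2); rewrite coef_deriv coef0.
  have -> : (size Q).-2.+1 = (size Q).-1 by lia.
  move=> /eqP; rewrite -mulr_natr mulf_eq0 -lead_coefE lead_coef_eq0 (negbTE nzQ) /=.
  rewrite -mpolyC_nat mpolyC_eq0 pnatr_eq0.
  by move: sQ; case: (size Q) => [|[|s]].
pose A i := proj1_sig (constructive_indefinite_description _ (H i)).
have HA i : exists N : 'I_3 -> {mpoly K[3]}, A i != 0 /\
    forall j, A i * (i == j)%:R = \sum_(l < 3) N l * (f l)^`M(j).
  by rewrite /A; case: constructive_indefinite_description.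
pose N i := proj1_sig (constructive_indefinite_description _ (HA i)).
have HN i : A i != 0 /\ forall j, A i * (i == j)%:R = \sum_(l < 3) N i l * (f l)^`M(j).
  by rewrite /N; case: constructive_indefinite_description.
have E : diag_mx (\row_i A i) = (\matrix_(i, l) N i l) *m jacmx f.
  apply/matrixP => i j; rewrite !mxE -mulr_natr; case: (HN i) => _ ->.
  by apply: eq_bigr => l _; rewrite !mxE.
apply/eqP => z; have := congr1 determinant E; rewrite det_mulmx -/(jac f) z mulr0 det_diag.
move=> /eqP; rewrite prodf_seq_eq0 => /hasP [i _ /=]; rewrite mxE => /eqP Ai.
by case: (HN i); rewrite Ai eqxx.
Qed.

Lemma homog_component_vanish p v k : (forall t, p.@[fun i => t * v i] = 0) ->
  (pihomog mdeg k p).@[v] = 0.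
Proof.
move=> h; pose N := (k.+1 + msize p)%N.
have le_N : (msize p <= N)%N by rewrite leq_addl.
have E := pihomog_partitionE (mf := mdeg) le_N.
pose u := \poly_(i < N) (pihomog mdeg i p).@[v].
have u0 : u = 0.
  apply: poly_vanish => t; rewrite horner_poly -[RHS](h t) [in RHS]E raddf_sum /=.
  apply: eq_bigr => i _; rewrite (meval_homogZ _ _ (pihomogP _ _ _)) mulrC //.
have : u`_k = 0 by rewrite u0 coef0.
by rewrite coef_poly /N addSn ltnS leq_addr.
Qed.

Lemma nonzero_component p : p != 0 -> exists k, pihomog mdeg k p != 0.
Proof.
move=> nz; apply: NNPP => h; case/eqP: nz.
rewrite (pihomog_partitionE (leqnn (mmeasure mdeg p))) big1 // => i _.
by apply/eqP; apply: contraT => hi; case: h; exists i.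
Qed.

(** In a minimal relation Q(f, h) = 0 the constant term is nonzero, as otherwise [h] could be
    cancelled; where h = 0 it vanishes at f(x). A homogeneous component of it is the required
    form. *)
Lemma image_of_curve f h d e : (forall i, f i \is d.-homog) -> (0 < d)%N ->
  h != 0 -> h \is e.-homog ->
  exists Q k, [/\ Q != 0, Q \is k.-homog & forall x, h.@[x] = 0 -> Q.@[eval_triple f x] = 0].
Proof.
move=> hf d0 nzh hh.
have [Q [nzQ EQ minQ]] := poly_dependent_min f h.
have nz0 : Q`_0 != 0.
  apply/eqP => z.
  have [Q' EQ'] : exists Q', Q = Q' * 'X.
    exists (\poly_(i < (size Q).-1) Q`_i.+1); apply/polyP => [[|k]]; rewrite coefMX //=.
    rewrite coef_poly; case: ltnP => // ge; rewrite nth_default //; lia.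
  have nzQ' : Q' != 0 by apply: contraNneq nzQ => z'; rewrite EQ' z' mul0r.
  have lt : (size Q' < size Q)%N by rewrite EQ' size_mulX.
  case/eqP: nzQ'; apply: minQ lt.
  move: EQ; rewrite EQ' /compc rmorphM /= map_polyX hornerMX => /eqP.
  by rewrite mulf_eq0 (negbTE nzh) orbF => /eqP.
have [k nzk] := nonzero_component nz0.
exists (pihomog mdeg k Q`_0), k; split=> //; first exact: pihomogP.
move=> x hx; apply: homog_component_vanish => t.
(* Rescaling x by d-th roots makes f(x) run through its whole line, so every homogeneous component
   vanishes. *)
have [s Es] : exists s : K, s ^+ d = t.
  have [|s] := @poly_root K ('X^d - t%:P); first by rewrite size_XnsubC.
  by rewrite !hornerE => /eqP; rewrite subr_eq0 => /eqP; exists s.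
rewrite (@meval_eq _ _ _ (eval_triple f (fun i => s * x i))); last first.
  by move=> i; rewrite /eval_triple (meval_homogZ _ _ (hf i)) Es.
rewrite -meval_comp.
have hsx : h.@[fun i => s * x i] = 0 by rewrite (meval_homogZ _ _ hh) hx mulr0.
have := congr1 (meval (fun i => s * x i)) EQ.
rewrite meval0 -horner_map /= hsx horner_coef0 coef_map /compc coef_map.
by [].
Qed.

End Jacobian.

(** * A lower bound of Bezout type *)

Section Sylvester.
Variable R : comNzRingType.
Implicit Types p q A B : {poly R}.

(** The Sylvester matrix for two polynomials of nominal degree [d], whatever their true degrees, so
    that it commutes with specialisation of the coefficients. *)
Definition Syl d p q : 'M[R]_(d + d) :=
  col_mx (\matrix_(i < d, j < d + d) ('X^i * p)`_j) (\matrix_(i < d, j < d + d) ('X^i * q)`_j).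

Lemma SylEu d p q i j : Syl d p q (lshift d i) j = ('X^i * p)`_j.
Proof. by rewrite col_mxEu mxE. Qed.
Lemma SylEd d p q i j : Syl d p q (rshift d i) j = ('X^i * q)`_j.
Proof. by rewrite col_mxEd mxE. Qed.

Lemma coef_rVpoly_mul d (r : 'rV[R]_d) p j :
  \sum_(i < d) r 0 i * ('X^i * p)`_j = (rVpoly r * p)`_j.
Proof.
rewrite /rVpoly poly_def mulr_suml coef_sum; apply: eq_bigr => i _.
by rewrite valK -scalerAl coefZ.
Qed.

Lemma Syl_row d p q (r : 'rV[R]_(d + d)) j :
  (r *m Syl d p q) 0 j = (rVpoly (lsubmx r) * p + rVpoly (rsubmx r) * q)`_j.
Proof.
rewrite mxE big_split_ord /= coefD -!coef_rVpoly_mul; congr (_ + _);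
  by apply: eq_bigr => i _; rewrite ?SylEu ?SylEd !mxE.
Qed.

Lemma size_rVpoly_mul d (r : 'rV[R]_d) p : (size p <= d.+1)%N -> (size (rVpoly r * p)%R <= d + d)%N.
Proof.
move=> sp; apply: leq_trans (size_polyMleq _ _) _.
have h : (size (rVpoly r) <= d)%N by apply: size_poly.
lia.
Qed.

Lemma Syl_null d p q (r : 'rV[R]_(d + d)) : (size p <= d.+1)%N -> (size q <= d.+1)%N ->
  r *m Syl d p q = 0 -> rVpoly (lsubmx r) * p + rVpoly (rsubmx r) * q = 0.
Proof.
move=> sp sq h; apply/polyP => k; rewrite coef0.
have [lt_k|ge_k] := ltnP k (d + d); first by rewrite -(Syl_row p q r (Ordinal lt_k)) h mxE.
rewrite nth_default // (leq_trans (size_polyD _ _)) // geq_max.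
by rewrite !(leq_trans (size_rVpoly_mul _ _)).
Qed.

(** At a common root z the column of powers of z is thereby a null vector. *)
Lemma Syl_col d p q z : (size p <= d.+1)%N -> (size q <= d.+1)%N ->
  Syl d p q *m (\col_j z ^+ j) =
  col_mx (\col_(i < d) (z ^+ i * p.[z])) (\col_(i < d) (z ^+ i * q.[z])).
Proof.
move=> sp sq.
have H (P : {poly R}) (i : 'I_d) : (size P <= d.+1)%N ->
    \sum_(j < d + d) ('X^i * P)`_j * z ^+ j = z ^+ i * P.[z].
  move=> sP; rewrite -[z ^+ i]hornerXn -hornerM (@horner_coef_wide _ (d + d)) //.
  apply: leq_trans (size_polyMleq _ _) _; rewrite size_polyXn.
  have key (a b : nat) : (a <= d.+1 -> b < d -> (b.+1 + a).-1 <= d + d)%N by lia.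
  exact: key sP (ltn_ord i).
apply/colP => k; rewrite mxE; under eq_bigr => j _ do rewrite [(\col__ _) _ _]mxE.
case: (splitP k) => i Ei.
  have -> : k = lshift d i by apply: val_inj.
  by rewrite col_mxEu mxE -H //; apply: eq_bigr => j _; rewrite SylEu.
have -> : k = rshift d i by apply: val_inj.
by rewrite col_mxEd mxE -H //; apply: eq_bigr => j _; rewrite SylEd.
Qed.

End Sylvester.

Lemma map_Syl (R S : comNzRingType) (f : {rmorphism R -> S}) d (p q : {poly R}) :
  map_mx f (Syl d p q) = Syl d (map_poly f p) (map_poly f q).
Proof.
rewrite map_col_mx; congr col_mx; apply/matrixP => i j; rewrite !mxE;
  by rewrite -coef_map rmorphM /= map_polyXn.
Qed.

Section SylvesterField.
Variable K : fieldType.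
Implicit Types p q A B : {poly K}.

(** Weighted homogeneity of the resultant, by rescaling columns by c^j and rows by c^(d+i); the
    weight d^2 is the number in Bezout's theorem. *)
Lemma Syl_scale d p q p' q' (c : K) : c != 0 ->
  (size p <= d.+1)%N -> (size q <= d.+1)%N -> (size p' <= d.+1)%N -> (size q' <= d.+1)%N ->
  (forall k, (k <= d)%N -> p'`_k = c ^+ (d - k) * p`_k) ->
  (forall k, (k <= d)%N -> q'`_k = c ^+ (d - k) * q`_k) ->
  \det (Syl d p' q') = c ^+ (d * d) * \det (Syl d p q).
Proof.
move=> nzc sp sq sp' sq' Ep Eq.
pose D1 : 'rV[K]_(d + d) := \row_j c ^+ j.
pose D2 : 'rV[K]_(d + d) := row_mx (\row_(i < d) c ^+ (d + i)) (\row_(i < d) c ^+ (d + i)).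
have H (P P' : {poly K}) : (size P <= d.+1)%N -> (size P' <= d.+1)%N ->
   (forall k, (k <= d)%N -> P'`_k = c ^+ (d - k) * P`_k) ->
   forall (i : 'I_d) j, ('X^i * P')`_j * c ^+ j = c ^+ (d + i) * ('X^i * P)`_j.
  move=> sP sP' E i j; rewrite !coefXnM; case: ltnP => [_|le_ij]; first by rewrite mul0r mulr0.
  have [le|gt] := leqP (j - i)%N d; last by rewrite !nth_default ?mul0r ?mulr0 ?(leq_trans sP) ?(leq_trans sP').
  rewrite E // mulrAC -exprD; congr (_ ^+ _ * _); lia.
have E : Syl d p' q' *m diag_mx D1 = diag_mx D2 *m Syl d p q.
  apply/matrixP => k j; rewrite mul_mx_diag mul_diag_mx !mxE.
  by case: splitP => i _; rewrite !mxE; [rewrite (H p p')|rewrite (H q q')].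
have := congr1 determinant E; rewrite !det_mulmx !det_diag.
rewrite (eq_bigr (fun j : 'I_(d + d) => c ^+ j)); last by move=> j _; rewrite mxE.
rewrite !big_split_ord /=.
have ED : \prod_(i < d) D2 0 (lshift d i) = \prod_(i < d) c ^+ (d + i).
  by apply: eq_bigr => i _; rewrite row_mxEl mxE.
have ED' : \prod_(i < d) D2 0 (rshift d i) = \prod_(i < d) c ^+ (d + i).
  by apply: eq_bigr => i _; rewrite row_mxEr mxE.
rewrite ED ED'.
have nz1 : \prod_(i < d) c ^+ i != 0 by apply/prodf_neq0 => i _; rewrite expf_neq0.
have nz2 : \prod_(i < d) c ^+ (d + i) != 0 by apply/prodf_neq0 => i _; rewrite expf_neq0.
have E3 : \prod_(i < d) c ^+ (d + i) = c ^+ (d * d) * \prod_(i < d) c ^+ i.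
  under eq_bigr => i _ do rewrite exprD.
  by rewrite big_split /= prodr_const card_ord -exprM.
rewrite {1}mulrA => h; apply: (mulIf nz2); apply: (mulIf nz1).
rewrite mulrAC h {1}E3; ring.
Qed.

(** A null row is a relation A p + B q = 0 with A and B of degree below [d], and coprimality makes q
    divide A. *)
Lemma Syl_coprime_det d p q : coprimep p q -> size p = d.+1 -> size q = d.+1 ->
  \det (Syl d p q) != 0.
Proof.
move=> cpq sp sq; apply/det0P => [[r nzr hr]].
have E := Syl_null (eq_leq sp) (eq_leq sq) hr.
set A := rVpoly (lsubmx r) in E; set B := rVpoly (rsubmx r) in E.
have sA : (size A <= d)%N by apply: size_poly.
have sB : (size B <= d)%N by apply: size_poly.
have dA : q %| A.
  rewrite -(Gauss_dvdpl _ (q := p)); last by rewrite coprimep_sym.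
  by move/eqP: E; rewrite addr_eq0 => /eqP ->; rewrite dvdpNr dvdp_mull.
have A0 : A = 0.
  apply/eqP; apply: contraT => nz; have := dvdp_leq nz dA; rewrite sq; lia.
have B0 : B = 0.
  move: E; rewrite A0 mul0r add0r => /eqP; rewrite mulf_eq0 => /orP [/eqP //|/eqP q0].
  by move: sq; rewrite q0 size_poly0.
case/eqP: nzr; rewrite -[r]hsubmxK; apply/rowP => j; rewrite mxE [RHS]mxE.
have l0 : lsubmx r = 0 by rewrite -[LHS]rVpolyK -/A A0 linear0.
have r0 : rsubmx r = 0 by rewrite -[LHS]rVpolyK -/B B0 linear0.
by rewrite l0 r0; case: splitP => k _; rewrite mxE.
Qed.

(* The adjugate does not vanish at a matrix of corank one. *)
Lemma Syl_adj_neq0 d (p q P Q : {poly K}) z : p = ('X - z%:P) * P -> q = ('X - z%:P) * Q ->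
  coprimep P Q -> size p = d.+1 -> size q = d.+1 -> \adj (Syl d p q) != 0.
Proof.
move=> Ep Eq cPQ sp sq.
have d0 : (0 < d)%N.
  case: (posnP d) sp => // d0; rewrite d0 Ep => s1.
  have nP : P != 0 by apply/eqP => P0; move: s1; rewrite P0 mulr0 size_poly0.
  by move: s1; rewrite size_mul ?polyXsubC_eq0 // size_XsubC addSn /= => - [] /eqP; rewrite size_poly_eq0 (negbTE nP).
have nP : P != 0 by apply/eqP => P0; move: sp; rewrite Ep P0 mulr0 size_poly0.
have nQ : Q != 0 by apply/eqP => Q0; move: sq; rewrite Eq Q0 mulr0 size_poly0.
have sP : size P = d by move: sp; rewrite Ep size_mul ?polyXsubC_eq0 // size_XsubC addSn /= => - [].
have sQ : size Q = d by move: sq; rewrite Eq size_mul ?polyXsubC_eq0 // size_XsubC addSn /= => - [].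
apply/eqP => adj0.
have lt_d : (d.-1 < d)%N by rewrite prednK.
(* If the adjugate vanished, perturbing one entry would keep the determinant 0. A null row of the
   perturbed matrix, paired with the powers of z, has entry 0 at [i0'], hence is null for [S] and
   has no coefficient of A in degree d-1; but A is a multiple of Q, which has that degree. *)
pose i0' := lshift d (Ordinal lt_d); pose j0 : 'I_(d + d) := lshift d (Ordinal d0).
pose S := Syl d p q; pose S' := S + delta_mx i0' j0.
have y0 : S *m (\col_j z ^+ j) = 0.
  rewrite Syl_col ?sp ?sq // Ep Eq !hornerM hornerXsubC subrr !mul0r.
  by apply/colP => k; rewrite !mxE; case: splitP => i _; rewrite mxE mulr0.
have det0 : \det S = 0.
  apply/eqP; rewrite -det_tr; apply/det0P; exists (\col_j z ^+ j)^T.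
    apply/eqP => /rowP /(_ j0); rewrite !mxE /= expr0 => /eqP; rewrite oner_eq0 //.
  by rewrite -trmx_mul y0 trmx0.
have det0' : \det S' = 0.
  rewrite (expand_det_row _ i0').
  have cof j : cofactor S' i0' j = cofactor S i0' j.
    congr (_ * \det _); apply/matrixP => a b; rewrite !mxE.
    by rewrite eq_sym (negbTE (neq_lift _ _)) addr0.
  under eq_bigr => j _ do rewrite cof mxE mulrDl.
  rewrite big_split /= -expand_det_row det0 add0r big1 // => j _.
  have -> : cofactor S i0' j = \adj S j i0' by rewrite mxE.
  by rewrite adj0 [X in _ * X]mxE mulr0.
move/eqP: det0' => /det0P [r nzr hr].
have ri0 : r 0 i0' = 0.
  have := congr1 (fun X => (X *m (\col_j z ^+ j)) 0 0) hr.
  rewrite mulmxDr mulmxDl -mulmxA y0 mulmx0 add0r mul0mx [RHS]mxE.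
  rewrite mxE (bigD1 j0) //= big1 => [|j ne_j].
    rewrite addr0 !mxE (bigD1 i0') //= big1 => [|i ne_i].
      by rewrite !mxE !eqxx /= expr0 !mulr1 addr0.
    by rewrite !mxE (negbTE ne_i) mulr0.
  by rewrite [X in X * _]mxE big1 ?mul0r // => i _; rewrite mxE (negbTE ne_j) andbF mulr0.
have hrS : r *m S = 0.
  rewrite -[RHS]hr mulmxDr (_ : r *m delta_mx _ _ = 0) ?addr0 //.
  apply/rowP => j; rewrite !mxE (bigD1 i0') //= ri0 mul0r add0r big1 // => i ne_i.
  by rewrite mxE (negbTE ne_i) mulr0.
have E := Syl_null (eq_leq sp) (eq_leq sq) hrS.
set A := rVpoly (lsubmx r) in E; set B := rVpoly (rsubmx r) in E.
have sA : (size A <= d)%N by apply: size_poly.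
have sB : (size B <= d)%N by apply: size_poly.
have E2 : A * P + B * Q = 0.
  by apply: (@mulfI _ ('X - z%:P)); rewrite ?polyXsubC_eq0 // mulr0 -[RHS]E Ep Eq; ring.
have dA : Q %| A.
  rewrite -(Gauss_dvdpl _ (q := P)); last by rewrite coprimep_sym.
  by move/eqP: E2; rewrite addr_eq0 => /eqP ->; rewrite dvdpNr dvdp_mull.
have A0 : A = 0.
  case/dvdpP: dA => C EA; have [C0|nC] := eqVneq C 0; first by rewrite EA C0 mul0r.
  have sC : size C = 1%N.
    have c0 : (0 < size C)%N by rewrite lt0n size_poly_eq0.
    have key (a : nat) : (0 < d -> 0 < a -> (a + d).-1 <= d -> a = 1)%N by lia.
    by apply: (key _ d0 c0); move: sA; rewrite EA size_mul // sQ.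
  have : A`_(d.-1) = 0.
    by move: ri0; rewrite /A (coef_rVpoly_ord _ (Ordinal lt_d)) mxE.
  rewrite EA (size1_polyC (eq_leq sC)) coefCM => /eqP; rewrite mulf_eq0.
  rewrite -sQ -lead_coefE lead_coef_eq0 (negbTE nQ) orbF => /eqP ->.
  by rewrite polyC0 mul0r.
have B0 : B = 0.
  by move: E2; rewrite A0 mul0r add0r => /eqP; rewrite mulf_eq0 (negbTE nQ) orbF => /eqP.
case/eqP: nzr; rewrite -[r]hsubmxK; apply/rowP => j; rewrite mxE [RHS]mxE.
have l0 : lsubmx r = 0 by rewrite -[LHS]rVpolyK -/A A0 linear0.
have r0 : rsubmx r = 0 by rewrite -[LHS]rVpolyK -/B B0 linear0.
by rewrite l0 r0; case: splitP => k _; rewrite mxE.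
Qed.

End SylvesterField.

(** * The resultant along a pencil of lines *)

Section Bezout.
Variable K : numClosedFieldType.
Implicit Types (a b o x : 'I_3 -> K) (p q u v : {mpoly K[3]}).

Definition grad p x : 'I_3 -> K := fun i => (p^`M(i)).@[x].

(** The form [p] at b0 + t b1 + z o, with z as outer variable and t in the coefficients: t selects a
    line through [o], and z a point on it. *)
Definition biv b0 b1 o p : {poly {poly K}} :=
  mmap (@polyC {poly K} \o @polyC K)
    (fun i => ((b0 i)%:P + b1 i *: 'X)%:P + (o i)%:P *: 'X) p.

Lemma bivD b0 b1 o p q : biv b0 b1 o (p + q) = biv b0 b1 o p + biv b0 b1 o q.
Proof. by rewrite /biv rmorphD. Qed.
Lemma bivM b0 b1 o p q : biv b0 b1 o (p * q) = biv b0 b1 o p * biv b0 b1 o q.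
Proof. by rewrite /biv rmorphM. Qed.

Definition mov b0 b1 (t : K) : 'I_3 -> K := fun i => b0 i + t * b1 i.

Lemma biv_spec b0 b1 o p t : map_poly (horner_eval t) (biv b0 b1 o p) = rl (mov b0 b1 t) o p.
Proof.
elim/mpoly_struct_ind: p => [c|i|p q IHp IHq|p q IHp IHq].
- by rewrite /biv /rl !mmapC /= map_polyC /= /horner_eval hornerC.
- rewrite /biv /rl !mmapX !mmap1U rmorphD /= map_polyC /= -[(o i)%:P *: 'X]mul_polyC.
  rewrite rmorphM /= map_polyC /= map_polyX /horner_eval !hornerE mul_polyC.
  by rewrite /mov [b1 i * t]mulrC.
- by rewrite rlD -IHp -IHq -rmorphD bivD.
by rewrite rlM -IHp -IHq -rmorphM bivM.
Qed.

(** The partial derivative in the pencil parameter, at the value [t]. *)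
Definition tder (t : K) (P : {poly {poly K}}) : {poly K} := map_poly (fun c => c^`().[t]) P.

Lemma coef_tder t P k : (tder t P)`_k = (P`_k)^`().[t].
Proof. by rewrite coef_map_id0 // deriv0 horner0. Qed.

Lemma tderD t P Q : tder t (P + Q) = tder t P + tder t Q.
Proof. by apply/polyP => k; rewrite coefD !coef_tder coefD derivD hornerD. Qed.

Lemma tderM t P Q : tder t (P * Q) = tder t P * map_poly (horner_eval t) Q +
  map_poly (horner_eval t) P * tder t Q.
Proof.
apply/polyP => k; rewrite coefD coef_tder !coefM raddf_sum horner_sum -big_split /=.
apply: eq_bigr => i _; rewrite derivM hornerD !hornerM !coef_tder !coef_map /=.
by rewrite /horner_eval.
Qed.

Lemma biv_tder b0 b1 o p t :
  tder t (biv b0 b1 o p) = \sum_(i < 3) b1 i *: rl (mov b0 b1 t) o p^`M(i).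
Proof.
elim/mpoly_struct_ind: p => [c|i|p q IHp IHq|p q IHp IHq].
- rewrite big1 => [|i _]; last by rewrite mderivC /rl mmap0 scaler0.
  apply/polyP => k; rewrite coef_tder /biv mmapC /= coefC coef0.
  by case: eqP => _; rewrite ?derivC ?deriv0 horner0.
- rewrite (bigD1 i) //= big1 => [|j ne_ji]; last first.
    by rewrite mderivXU eq_sym (negbTE ne_ji) /rl mmap0 scaler0.
  rewrite mderivXU eqxx /rl rmorph1 addr0; apply/polyP => k.
  rewrite coef_tder /biv mmapX mmap1U coefD coefC coefZ coefX coefZ coef1.
  case: k => [|[|k]] /=;
    by rewrite ?(mulr0, mulr1, addr0, add0r, derivD, derivC, derivZ, derivX, deriv0, horner0,
                 hornerZ, hornerC, mulr1n, mulr0n).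
- rewrite bivD tderD IHp IHq -big_split /=.
  by apply: eq_bigr => i _; rewrite mderivD rlD scalerDr.
rewrite bivM tderM IHp IHq !biv_spec.
rewrite mulr_suml mulr_sumr -big_split /=.
by apply: eq_bigr => i _; rewrite mderivM rlD !rlM scalerDr -scalerAl -scalerAr.
Qed.

Section Resultant.
Variables (d : nat) (b0 b1 o : 'I_3 -> K) (u v : {mpoly K[3]}).
Hypotheses (hu : u \is d.-homog) (hv : v \is d.-homog) (uo : u.@[o] != 0) (vo : v.@[o] != 0).

Definition res : {poly K} := \det (Syl d (biv b0 b1 o u) (biv b0 b1 o v)).

Lemma res_eval t : res.[t] = \det (Syl d (rl (mov b0 b1 t) o u) (rl (mov b0 b1 t) o v)).
Proof. by rewrite -/(horner_eval t res) -det_map_mx map_Syl !biv_spec. Qed.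

Lemma rl_nocommon_root b : (forall z, u.@[mov b o z] = 0 -> v.@[mov b o z] = 0 -> False) ->
  \det (Syl d (rl b o u) (rl b o v)) != 0.
Proof.
move=> h; apply: Syl_coprime_det; rewrite ?(size_rl _ hu) ?(size_rl _ hv) //.
rewrite /coprimep eqn_leq; apply/andP; split; last first.
  rewrite lt0n size_poly_eq0 gcdp_eq0 negb_and -size_poly_eq0.
  by rewrite (size_rl _ hu).
rewrite leqNgt; apply/negP => gt1; have [z hz] := poly_root gt1.
have rz : root (gcdp (rl b o u) (rl b o v)) z by apply/rootP.
move: rz; rewrite root_gcd => /andP [/rootP r1 /rootP r2].
by apply: (h z); rewrite -horner_rl.
Qed.

(* Simplicity of a root: at a corank-one point the derivative of the resultant
   is the pairing of the null vectors with the derivative of the matrix, which is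
   the Jacobian determinant of the two curves. *)
Lemma res_simple t z : let x := mov (mov b0 b1 t) o z in
  u.@[x] = 0 -> v.@[x] = 0 ->
  (forall z', u.@[mov (mov b0 b1 t) o z'] = 0 -> v.@[mov (mov b0 b1 t) o z'] = 0 -> z' = z) ->
  dot (grad u x) b1 * dot (grad v x) o - dot (grad v x) b1 * dot (grad u x) o != 0 ->
  res^`().[t] != 0.
Proof.
move=> x ux vx uniq nzJ; apply/eqP => dres.
pose bt := mov b0 b1 t; pose p := rl bt o u; pose q := rl bt o v.
have sp : size p = d.+1 by apply: size_rl.
have sq : size q = d.+1 by apply: size_rl.
have dp0 : dot (grad u x) o = p^`().[z].
  rewrite deriv_rl horner_sum /dot; apply: eq_bigr => i _.
  by rewrite hornerZ horner_rl mulrC.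
have dq0 : dot (grad v x) o = q^`().[z].
  rewrite deriv_rl horner_sum /dot; apply: eq_bigr => i _.
  by rewrite hornerZ horner_rl mulrC.
pose tp := tder t (biv b0 b1 o u); pose tq := tder t (biv b0 b1 o v).
have tp0 : dot (grad u x) b1 = tp.[z].
  rewrite /tp biv_tder horner_sum /dot; apply: eq_bigr => i _.
  by rewrite hornerZ horner_rl mulrC.
have tq0 : dot (grad v x) b1 = tq.[z].
  rewrite /tq biv_tder horner_sum /dot; apply: eq_bigr => i _.
  by rewrite hornerZ horner_rl mulrC.
have rp : root p z by apply/rootP; rewrite horner_rl.
have rq : root q z by apply/rootP; rewrite horner_rl.
have [P Ep] : exists P, p = ('X - z%:P) * P.
  by have /factor_theorem [P ->] := rp; exists P; rewrite mulrC.
have [Q Eq] : exists Q, q = ('X - z%:P) * Q.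
  by have /factor_theorem [Q ->] := rq; exists Q; rewrite mulrC.
have dP : p^`().[z] = P.[z].
  by rewrite Ep derivM derivXsubC mul1r hornerD hornerM hornerXsubC subrr mul0r addr0.
have dQ : q^`().[z] = Q.[z].
  by rewrite Eq derivM derivXsubC mul1r hornerD hornerM hornerXsubC subrr mul0r addr0.
rewrite dp0 dq0 tp0 tq0 dP dQ in nzJ.
have nP : P != 0 by apply/eqP => P0; move: sp; rewrite Ep P0 mulr0 size_poly0.
have nQ : Q != 0 by apply/eqP => Q0; move: sq; rewrite Eq Q0 mulr0 size_poly0.
have sP : size P = d by move: sp; rewrite Ep size_mul ?polyXsubC_eq0 // size_XsubC addSn /= => - [].
have sQ : size Q = d by move: sq; rewrite Eq size_mul ?polyXsubC_eq0 // size_XsubC addSn /= => - [].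
have cPQ : coprimep P Q.
  rewrite /coprimep eqn_leq; apply/andP; split; last first.
    by rewrite lt0n size_poly_eq0 gcdp_eq0 negb_and nP.
  rewrite leqNgt; apply/negP => gt1; have [z' hz] := poly_root gt1.
  have : root (gcdp P Q) z' by apply/rootP.
  rewrite root_gcd => /andP [/rootP r1 /rootP r2].
  have Ez : z' = z by apply: uniq; rewrite -horner_rl -/bt -/p -/q ?Ep ?Eq hornerM ?r1 ?r2 mulr0.
  by move: nzJ; rewrite -Ez r1 r2 !mulr0 subrr eqxx.
pose S := Syl d (biv b0 b1 o u) (biv b0 b1 o v); pose M := \adj S.
have ES : map_mx (horner_eval t) S = Syl d p q by rewrite map_Syl !biv_spec.
have res0 : res.[t] = 0.
  rewrite res_eval -/bt -/p -/q; apply/eqP; rewrite -det_tr; apply/det0P.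
  exists (\col_(j < d + d) z ^+ j)^T.
    have d0 : (0 < d)%N by rewrite lt0n -sP size_poly_eq0.
    apply/eqP => /rowP /(_ (lshift d (Ordinal d0))); rewrite !mxE /= expr0 => /eqP.
    by rewrite oner_eq0.
  rewrite -trmx_mul Syl_col ?sp ?sq // (rootP rp) (rootP rq).
  by apply/rowP => k; rewrite !mxE; case: splitP => i _; rewrite mxE mulr0.
have M0 : map_mx (horner_eval t) M = \adj (Syl d p q) by rewrite -ES map_mx_adj.
have /eqP := Syl_adj_neq0 Ep Eq cPQ sp sq; apply; rewrite -M0.
have MS := mul_adj_mx S; rewrite -/M -/res in MS.
pose y : 'cV[K]_(d + d) := \col_j z ^+ j.
pose s : 'cV[K]_(d + d) := col_mx (\col_(i < d) (z ^+ i * tp.[z])) (\col_(i < d) (z ^+ i * tq.[z])).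
have stp : (size tp <= d.+1)%N.
  rewrite /tp biv_tder; apply: leq_trans (size_sum _ _ _) _; apply/bigmax_leqP => i _.
  apply: leq_trans (size_scale_leq _ _) _.
  have [h _] := rl_top (mov b0 b1 t) o (dhomog_mderiv i hu).
  by apply: leq_trans h _; rewrite ltnS leq_pred.
have stq : (size tq <= d.+1)%N.
  rewrite /tq biv_tder; apply: leq_trans (size_sum _ _ _) _; apply/bigmax_leqP => i _.
  apply: leq_trans (size_scale_leq _ _) _.
  have [h _] := rl_top (mov b0 b1 t) o (dhomog_mderiv i hv).
  by apply: leq_trans h _; rewrite ltnS leq_pred.
have DS : \matrix_(i, j) (S i j)^`().[t] = Syl d tp tq.
  have H (i : 'I_d) (B : {poly {poly K}}) j : (('X^i * B)`_j)^`().[t] = ('X^i * tder t B)`_j.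
    by rewrite !coefXnM; case: ltnP => _; rewrite ?deriv0 ?horner0 // coef_tder.
  apply/matrixP => k j; rewrite !mxE.
  by case: splitP => i _; rewrite !mxE H.
(* Differentiating M S = res I at [t] and applying both sides to the null column [y] kills the term
   with the derivative of M; [s] is the derivative of S applied to [y]. *)
have Ms i : \sum_(k < d + d) (M i k).[t] * s k 0 = 0.
  have E1 j : \sum_(k < d + d) ((M i k)^`().[t] * (Syl d p q) k j + (M i k).[t] * (Syl d tp tq) k j) = 0.
    have := congr1 (fun A : 'M_(d + d) => (A i j)^`().[t]) MS.
    rewrite [in RHS]mxE derivMn hornerMn dres mul0rn => E; rewrite -[RHS]E mxE raddf_sum horner_sum.
    apply: eq_bigr => k _; rewrite /= derivM hornerD !hornerM -ES -DS !mxE.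
    by rewrite /horner_eval.
  have E2 : \sum_(j < d + d) (\sum_(k < d + d) ((M i k)^`().[t] * (Syl d p q) k j +
      (M i k).[t] * (Syl d tp tq) k j)) * y j 0 = 0.
    by rewrite big1 // => j _; rewrite E1 mul0r.
  rewrite -[RHS]E2.
  under [RHS]eq_bigr => j _ do rewrite mulr_suml.
  rewrite exchange_big /=; apply: eq_bigr => k _.
  under [RHS]eq_bigr => j _ do rewrite mulrDl -!mulrA.
  rewrite big_split /= -!mulr_sumr.
  have -> : \sum_(j < d + d) Syl d p q k j * y j 0 = 0.
    have := congr1 (fun A : 'cV_(d + d) => A k 0) (@Syl_col _ d p q z (eq_leq sp) (eq_leq sq)).
    rewrite [LHS]mxE => ->; rewrite (rootP rp) (rootP rq) mxE.
    by case: splitP => l _; rewrite mxE mulr0.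
  rewrite mulr0 add0r; congr (_ * _).
  have := congr1 (fun A : 'cV_(d + d) => A k 0) (@Syl_col _ d tp tq z stp stq).
  by rewrite [LHS]mxE => ->.
apply/matrixP => i; pose r := row i (map_mx (horner_eval t) M).
suff r0 : r = 0 by move=> j; have := congr1 (fun A : 'rV_(d + d) => A 0 j) r0; rewrite !mxE.
have rS : r *m Syl d p q = 0.
  rewrite -row_mul -ES -map_mxM MS; apply/rowP => j; rewrite !mxE /= /horner_eval hornerMn res0.
  by rewrite mul0rn.
have E := Syl_null (eq_leq sp) (eq_leq sq) rS.
set A := rVpoly (lsubmx r) in E; set B := rVpoly (rsubmx r) in E.
have sA : (size A <= d)%N by apply: size_poly.
have sB : (size B <= d)%N by apply: size_poly.
have E2 : A * P + B * Q = 0.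
  by apply: (@mulfI _ ('X - z%:P)); rewrite ?polyXsubC_eq0 // mulr0 -[RHS]E Ep Eq; ring.
have E3 : A.[z] * tp.[z] + B.[z] * tq.[z] = 0.
  have := Ms i; rewrite big_split_ord /= => E3; rewrite -[RHS]E3.
  rewrite (@horner_coef_wide _ d A) // (@horner_coef_wide _ d B) // !mulr_suml; congr (_ + _).
    apply: eq_bigr => k _; rewrite coef_rVpoly_ord [s _ _]col_mxEu !mxE /horner_eval; ring.
  apply: eq_bigr => k _; rewrite coef_rVpoly_ord [s _ _]col_mxEd !mxE /horner_eval; ring.
(* The relation A P + B Q = 0 makes (A, B) a constant multiple of (Q, -P), and [E3] says that this
   constant times the Jacobian is 0. *)
have dA : Q %| A.
  rewrite -(Gauss_dvdpl _ (q := P)); last by rewrite coprimep_sym.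
  by move/eqP: E2; rewrite addr_eq0 => /eqP ->; rewrite dvdpNr dvdp_mull.
case/dvdpP: dA => C EA.
have EB : B = - (C * P).
  apply: (mulIf nQ); apply/eqP; rewrite -subr_eq0 -[X in _ == X]E2 EA; apply/eqP; ring.
have sC : (size C <= 1)%N.
  have [->|nC] := eqVneq C 0; first by rewrite size_poly0.
  have d0 : (0 < d)%N by rewrite lt0n -sP size_poly_eq0.
  have key (l : nat) : (0 < d -> (l + d).-1 <= d -> l <= 1)%N by lia.
  by apply: (key _ d0); move: sA; rewrite EA size_mul // sQ.
have C0 : C = 0.
  rewrite (size1_polyC sC); suff -> : C`_0 = 0 by [].
  have Az : A.[z] = C`_0 * Q.[z] by rewrite EA {1}(size1_polyC sC) hornerM hornerC.
  have Bz : B.[z] = - (C`_0 * P.[z]) by rewrite EB {1}(size1_polyC sC) hornerN hornerM hornerC.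
  have : C`_0 * (tp.[z] * Q.[z] - tq.[z] * P.[z]) = 0 by rewrite -[RHS]E3 Az Bz; ring.
  by move=> /eqP; rewrite mulf_eq0 (negbTE nzJ) orbF => /eqP.
have A0 : A = 0 by rewrite EA C0 mul0r.
have B0 : B = 0 by rewrite EB C0 mul0r oppr0.
rewrite -[r]hsubmxK; apply/rowP => j; rewrite mxE [RHS]mxE.
have l0 : lsubmx r = 0 by rewrite -[LHS]rVpolyK -/A A0 linear0.
have rr0 : rsubmx r = 0 by rewrite -[LHS]rVpolyK -/B B0 linear0.
by rewrite l0 rr0; case: splitP => k _; rewrite mxE.
Qed.

End Resultant.

End Bezout.

(** * Counting transversal intersections *)

Section BezoutLower.
Variable K : numClosedFieldType.
Implicit Types (b o x : 'I_3 -> K) (p q u v : {mpoly K[3]}).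

Lemma not_proportional_cross (a b : 'I_3 -> K) : nonzero_vec a -> nonzero_vec b ->
  ~ proportional a b -> nonzero_vec (cross a b).
Proof.
move=> nza nzb np; apply: NNPP => /not_nonzero_vec z; apply: np.
have [c Ec] := cross0_proportional nza z; exists c; split => //.
by apply/eqP => c0; case: nzb => i; rewrite Ec c0 mul0r eqxx.
Qed.

Lemma det3_mov b0 b1 o t z : det3 (mov (mov b0 b1 t) o z) b1 o = det3 b0 b1 o.
Proof. by rewrite !det3E /mov; ring. Qed.

Lemma grad_homogZ p d x c i : p \is d.-homog ->
  grad p (fun j => c * x j) i = c ^+ d.-1 * grad p x i.
Proof. by move=> hp; rewrite /grad (meval_homogZ _ _ (dhomog_mderiv i hp)). Qed.

Lemma det3_nonzero (a b c : 'I_3 -> K) : det3 a b c != 0 -> nonzero_vec a.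
Proof.
move=> h; apply: NNPP => /not_nonzero_vec z; case/eqP: h; rewrite det3E !z; ring.
Qed.

(** Swapping [b0] and [b1] replaces t by 1/t. By [Syl_scale], a resultant of degree at most [d * d]
    becomes its reversal in that degree, whose value at 0 is the coefficient of degree [d * d]. *)
Lemma res_reverse d b0 b1 o u v : u \is d.-homog -> v \is d.-homog ->
  (res d b1 b0 o u v).[0] != 0 -> (d * d < size (res d b0 b1 o u v))%N.
Proof.
move=> hu hv; apply: contraR; rewrite -leqNgt => sR.
set R := res d b0 b1 o u v in sR *.
have rev p t k : p \is d.-homog -> t != 0 -> (k <= d)%N ->
    (rl (mov b1 b0 t) o p)`_k = t ^+ (d - k) * (rl (mov b0 b1 t^-1) o p)`_k.
  move=> hp nzt le_k; set P := rl _ o p; set Q := rl (mov b0 _ _) o p.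
  have [sQ _] := rl_top (mov b0 b1 t^-1) o hp.
  have -> : P = \poly_(k < d.+1) (t ^+ (d - k) * Q`_k).
    apply/eqP; rewrite -subr_eq0; apply/eqP; apply: poly_vanish => z.
    rewrite hornerD hornerN horner_poly horner_rl.
    rewrite (@meval_eq _ _ _ (fun i => t * (mov b0 b1 t^-1 i + (z / t) * o i))); last first.
      by move=> i; rewrite /mov; field.
    rewrite (meval_homogZ _ _ hp) -horner_rl -/Q (@horner_coef_wide _ d.+1) // mulr_sumr.
    apply/eqP; rewrite subr_eq0; apply/eqP; apply: eq_bigr => i _.
    have le_i : (i <= d)%N by rewrite -ltnS.
    have -> : t ^+ d = t ^+ (d - i) * t ^+ i by rewrite -exprD subnK.
    by rewrite exprMn exprVn; field; rewrite expf_neq0.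
  by rewrite coef_poly ltnS le_k.
have ER : res d b1 b0 o u v = \poly_(k < (d * d).+1) R`_(d * d - k).
  (* The factor ['X] absorbs t = 0, where t -> 1/t is undefined. *)
  apply: (@mulfI _ 'X); first by rewrite polyX_eq0.
  apply/eqP; rewrite -subr_eq0 -mulrBr; apply/eqP; apply: poly_vanish => t.
  rewrite hornerM hornerX; have [->|nzt] := eqVneq t 0; first by rewrite mul0r.
  suff E : (res d b1 b0 o u v).[t] = (\poly_(k < (d * d).+1) R`_(d * d - k)).[t].
    by rewrite hornerD hornerN E subrr mulr0.
  rewrite res_eval.
  have s1 := rl_top (mov b0 b1 t^-1) o hu; have s2 := rl_top (mov b0 b1 t^-1) o hv.
  have s3 := rl_top (mov b1 b0 t) o hu; have s4 := rl_top (mov b1 b0 t) o hv.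
  rewrite (Syl_scale nzt s1.1 s2.1 s3.1 s4.1); last 2 first.
  - by move=> k lk; apply: rev.
  - by move=> k lk; apply: rev.
  rewrite -res_eval -/R horner_poly (@horner_coef_wide _ (d * d).+1); last exact: leqW.
  rewrite mulr_sumr (reindex_inj rev_ord_inj) /=; apply: eq_bigr => i _.
  rewrite subSS; have le_i : (i <= d * d)%N by rewrite -ltnS.
  have -> : t ^+ (d * d) = t ^+ (d * d - i) * t ^+ i by rewrite -exprD subnK.
  by rewrite exprVn; field; rewrite expf_neq0.
by rewrite ER horner_coef0 coef_poly /= subn0 nth_default // eqxx.
Qed.

(** Seen from a general centre, the resultant has degree at least d^2. Transversality makes its
    roots simple, and distinct roots come from distinct common zeros. *)
Lemma bezout_lower d n u v (a : 'I_n -> 'I_3 -> K) :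
  u != 0 -> v != 0 -> u \is d.-homog -> v \is d.-homog -> (0 < d)%N ->
  (forall j, nonzero_vec (a j)) ->
  (forall j, u.@[a j] = 0) -> (forall j, v.@[a j] = 0) ->
  (forall x, nonzero_vec x -> u.@[x] = 0 -> v.@[x] = 0 -> exists j, proportional (a j) x) ->
  (forall i j, i != j -> ~ proportional (a i) (a j)) ->
  (forall j b, dot (grad u (a j)) b = 0 -> dot (grad v (a j)) b = 0 ->
     exists c, forall i, b i = c * a j i) ->
  (d * d <= n)%N.
Proof.
move=> nzu nzv hu hv d0 nza ua va cov dist trans.
(* Off both curves, [o] keeps the degree [d] on every line through it; off the lines joining two
   common zeros, it sees at most one of them on each line. *)
have [o [uo vo co]] : exists o, [/\ u.@[o] != 0, v.@[o] != 0 &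
    forall i j, i != j -> dot (cross (a i) (a j)) o != 0].
  pose P := u * v * \prod_(ij : 'I_n * 'I_n | ij.1 != ij.2) linf (cross (a ij.1) (a ij.2)).
  have nzP : P != 0.
    rewrite !mulf_neq0 //; apply/prodf_neq0 => ij ne; apply: linf_neq0.
    by apply: not_proportional_cross => //; apply: dist.
  have [o] := mpoly_nonzero_at nzP; rewrite !mevalM !mulf_eq0 !negb_or -andbA => /and3P [h1 h2 h3].
  exists o; split=> // i j ne; move: h3; rewrite rmorph_prod => /prodf_neq0 /(_ (i, j) ne).
  by rewrite /= meval_linf.
have aznz j c : ~ (forall i, o i = c * a j i).
  move=> E; case/eqP: uo; rewrite (@meval_eq _ _ _ (fun i => c * a j i)) //.
  by rewrite (meval_homogZ _ _ hu) ua mulr0.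
have nzo : nonzero_vec o.
  apply: NNPP => /not_nonzero_vec z; case/eqP: uo.
  rewrite (@meval_eq _ _ _ (fun i => 0 * o i)); last by move=> i; rewrite z mulr0.
  by rewrite (meval_homogZ _ _ hu) expr0n eqn0Ngt d0 mul0r.
(* The line through [b1] and [o] is the member t = infinity of the pencil; as it contains no common
   zero, no root of the resultant escapes to infinity. *)
have [b1 [cb1 ab1]] : exists b1, nonzero_vec (cross b1 o) /\ forall j, det3 (a j) b1 o != 0.
  have [c [c' hc]] := complete_basis nzo.
  pose P := linf (cross o c) * \prod_(j < n) linf (cross o (a j)).
  have nzP : P != 0.
    rewrite mulf_neq0 //.
      apply: linf_neq0; apply: (@det3_nz_cross _ c').
      by move: hc; congr (_ != _); rewrite !det3E; ring.
    apply/prodf_neq0 => j _; apply: linf_neq0; apply: not_proportional_cross => //.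
    by move=> /proportional_sym [e [_ E]]; apply: (aznz j e).
  have [b1] := mpoly_nonzero_at nzP; rewrite mevalM mulf_eq0 negb_or meval_linf => /andP [h1 h2].
  exists b1; split.
    apply: (@det3_nz_cross _ c); move: h1; congr (_ != _).
    by rewrite det3E dotE !crossE; ring.
  move=> j; move: h2; rewrite rmorph_prod => /prodf_neq0 /(_ j isT).
  by rewrite /= meval_linf; congr (_ != _); rewrite det3E dotE !crossE; ring.
have [b0 D] : exists b0, det3 b0 b1 o != 0.
  have [b0 h] := mpoly_nonzero_at (linf_neq0 cb1); exists b0; move: h; rewrite meval_linf.
  by congr (_ != _); rewrite det3E dotE !crossE; ring.
set R := res d b0 b1 o u v.
have sR : (d * d < size R)%N.
  apply: res_reverse => //; rewrite res_eval; apply: rl_nocommon_root => // z uz vz.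
  have nzx : nonzero_vec (mov (mov b1 b0 0) o z).
    case: cb1 => i nz; apply: NNPP => /not_nonzero_vec zz.
    case/eqP: nz; transitivity (cross (mov (mov b1 b0 0) o z) o i); last by rewrite /cross !zz; ring.
    by rewrite /cross /mov; ring.
  have [j [c [nzc E]]] := cov _ nzx uz vz.
  have /eqP := ab1 j; apply; apply: (mulfI nzc); rewrite mulr0.
  transitivity (det3 (mov (mov b1 b0 0) o z) b1 o); last by rewrite !det3E /mov; ring.
  by rewrite !det3E !E; ring.
have nzR : R != 0 by apply/eqP => R0; move: sR; rewrite R0 size_poly0.
have nzx t z : nonzero_vec (mov (mov b0 b1 t) o z).
  by apply: (@det3_nonzero _ b1 o); rewrite det3_mov.
have rootR t : root R t -> exists z j, [/\ u.@[mov (mov b0 b1 t) o z] = 0,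
    v.@[mov (mov b0 b1 t) o z] = 0 & proportional (a j) (mov (mov b0 b1 t) o z)].
  move=> rt; apply: NNPP => H; have : R.[t] != 0; last by rewrite (rootP rt) eqxx.
  rewrite res_eval; apply: rl_nocommon_root => // z uz vz.
  by have [j pj] := cov _ (nzx t z) uz vz; apply: H; exists z, j.
(* [det3] against [b1] and [o] fixes the scale of a representative, so a projective point determines
   both t and z. *)
have same j t z t' z' : proportional (a j) (mov (mov b0 b1 t) o z) ->
    proportional (a j) (mov (mov b0 b1 t') o z') -> t = t' /\ z = z'.
  move=> p1 p2; have [c [nzc E]] := proportional_trans (proportional_sym p1) p2.
  have c1 : c = 1.
    apply: (mulIf D); rewrite mul1r -{2}(det3_mov b0 b1 o t' z') -(det3_mov b0 b1 o t z).
    by rewrite !det3E !E; ring.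
  have E' i : mov (mov b0 b1 t') o z' i = mov (mov b0 b1 t) o z i by rewrite E c1 mul1r.
  split.
    apply: (mulIf D); apply: (@addIr _ (det3 b0 b0 o)).
    transitivity (det3 b0 (mov (mov b0 b1 t) o z) o); first by rewrite !det3E /mov; ring.
    transitivity (det3 b0 (mov (mov b0 b1 t') o z') o); last by rewrite !det3E /mov; ring.
    by rewrite !det3E !E'.
  apply: (mulIf D); apply: (@addIr _ (det3 b0 b1 b0)).
  transitivity (det3 b0 b1 (mov (mov b0 b1 t) o z)); first by rewrite !det3E /mov; ring.
  transitivity (det3 b0 b1 (mov (mov b0 b1 t') o z')); last by rewrite !det3E /mov; ring.
  by rewrite !det3E !E'.
have simple t : root R t -> ~~ root R^`() t.
  move=> /rootR [z [j [uz vz pj]]]; apply/negP => /rootP.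
  apply/eqP; apply: (@res_simple K d b0 b1 o u v hu hv uo vo t z) => //.
    move=> z' uz' vz'; have [j' pj'] := cov _ (nzx t z') uz' vz'.
    have [Ej|ne] := eqVneq j j'; first by rewrite -Ej in pj'; have [_ ->] := same _ _ _ _ _ pj pj'.
    have /eqP := co _ _ ne; case.
    have [c [nzc E]] := pj; have [c' [nzc' E']] := pj'.
    apply: (mulfI nzc); apply: (mulfI nzc'); rewrite !mulr0.
    transitivity (det3 o (mov (mov b0 b1 t) o z) (mov (mov b0 b1 t) o z')).
      by rewrite det3E dotE !crossE !E !E'; ring.
    by rewrite det3E /mov; ring.
  set x := mov (mov b0 b1 t) o z in uz vz pj *.
  have Dx : det3 x b1 o != 0 by rewrite det3_mov.
  have transx b : dot (grad u x) b = 0 -> dot (grad v x) b = 0 -> exists c, forall i, b i = c * x i.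
    have [c [nzc E]] := pj; move=> gu gv.
    have Ex : x = (fun i => c * a j i) by apply: functional_extensionality.
    have nzcd : c ^+ d.-1 != 0 by rewrite expf_neq0.
    have [||e Ee] := trans j b.
    - apply: (mulfI nzcd); rewrite mulr0 -[RHS]gu Ex !dotE !(grad_homogZ _ _ _ hu); ring.
    - apply: (mulfI nzcd); rewrite mulr0 -[RHS]gv Ex !dotE !(grad_homogZ _ _ _ hv); ring.
    by exists (e / c) => i; rewrite Ee E; field.
  have comb s r : dot (grad u x) (lc2 s b1 r o) = 0 -> dot (grad v x) (lc2 s b1 r o) = 0 ->
      s = 0 /\ r = 0.
    move=> h1 h2; have [c Ec] := transx _ h1 h2.
    have c0 : c = 0.
      apply: (mulIf Dx); rewrite mul0r.
      transitivity (det3 (lc2 s b1 r o) b1 o); last by rewrite det3E /lc2; ring.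
      by rewrite !det3E !Ec; ring.
    have z' i : s * b1 i + r * o i = 0 by have := Ec i; rewrite c0 mul0r.
    split; apply: (mulIf Dx); rewrite mul0r.
      transitivity (det3 x (lc2 s b1 r o) o); first by rewrite !det3E /lc2; ring.
      by rewrite det3E /lc2 !z'; ring.
    transitivity (det3 x b1 (lc2 s b1 r o)); first by rewrite !det3E /lc2; ring.
    by rewrite det3E /lc2 !z'; ring.
  apply/eqP => J.
  have [||so sb] := comb (dot (grad v x) o) (- dot (grad v x) b1).
  - by rewrite dot_lc2 -[RHS]J; ring.
  - by rewrite dot_lc2; ring.
  have [||uo' ub'] := comb (dot (grad u x) o) (- dot (grad u x) b1).
  - by rewrite dot_lc2; ring.
  - by rewrite dot_lc2 so; move/eqP: sb; rewrite oppr_eq0 => /eqP ->; ring.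
  have [||_ /eqP] := comb 0 1; rewrite ?dot_lc2 ?so ?uo' ?mul0r ?mul1r ?addr0 ?oner_eq0 //.
have [rs Er] := closed_field_poly_normal R.
have nzl : lead_coef R != 0 by rewrite lead_coef_eq0.
have urs : uniq rs.
  rewrite -separable_prod_XsubC.
  have : separable_poly R.
    rewrite separable_poly.unlock /coprimep eqn_leq; apply/andP; split; last first.
      by rewrite lt0n size_poly_eq0 gcdp_eq0 negb_and nzR.
    rewrite leqNgt; apply/negP => gt1; have [t ht] := poly_root gt1.
    have : root (gcdp R R^`()) t by apply/rootP.
    by rewrite root_gcd => /andP [/simple /negbTE ->].
  by rewrite Er (eqp_separable (eqp_scale _ nzl)).
have rsR t : t \in rs -> root R t by rewrite Er rootZ // root_prod_XsubC.
have exJ t : exists k : nat, t \in rs -> exists (j : 'I_n) z, k = j /\ proportional (a j) (mov (mov b0 b1 t) o z).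
  have [/rsR /rootR [z [j [_ _ pj]]]|_] := boolP (t \in rs); last by exists 0%N.
  by exists j => _; exists j, z.
pose J t := proj1_sig (constructive_indefinite_description _ (exJ t)).
have JP t : t \in rs -> exists (j : 'I_n) z, J t = j /\ proportional (a j) (mov (mov b0 b1 t) o z).
  by rewrite /J; case: constructive_indefinite_description.
have uJ : uniq [seq J t | t <- rs].
  rewrite map_inj_in_uniq // => t t' /JP [j [z [Ej pj]]] /JP [j' [z' [Ej' pj']]] EJ.
  have Ejj : j = j' by apply: val_inj; rewrite /= -Ej -Ej'.
  by rewrite Ejj in pj; have [-> _] := same _ _ _ _ _ pj pj'.
have le_rs : (size rs <= n)%N.
  rewrite -(size_map J) -[n](size_iota 0); apply: uniq_leq_size => // k /mapP [t /JP [j [z [Ej _]]] ->].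
  by rewrite mem_iota Ej /=.
apply: leq_trans le_rs; move: sR; rewrite Er size_scale // size_prod_XsubC ltnS //.
Qed.

End BezoutLower.

(** * Base points, generic fibres and contracted values *)

Section Jac.
Variable K : numClosedFieldType.
Implicit Types (x y b c : 'I_3 -> K) (f : triple K).

Lemma mderiv_linf (m : 'I_3 -> K) i : (linf m)^`M(i) = (m i)%:MP.
Proof.
rewrite /linf raddf_sum /= (bigD1 i) //= mderivZ mderivXU eqxx big1 ?addr0 => [|l ne].
  by rewrite -mul_mpolyC mulr1.
by rewrite mderivZ mderivXU (negbTE ne) scaler0.
Qed.

Lemma euler_at (p : {mpoly K[3]}) d x : p \is d.-homog ->
  dot (grad p x) x = d%:R * p.@[x].
Proof.
move=> hp; have := congr1 (meval x) (Euler_homog hp); rewrite raddf_sum mevalMn mulr_natl => <-.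
by apply: eq_bigr => i _; rewrite /= mevalM mevalXU mulrC.
Qed.

Lemma jac_neq0_inj f x b : (jac f).@[x] != 0 -> (forall i, dot (grad (f i) x) b = 0) ->
  forall i, b i = 0.
Proof.
rewrite meval_jac => nz h i; apply/eqP; apply: contraT => bi.
case/eqP: nz; apply/eqP; rewrite -det_tr; apply/det0P; exists (\row_j b j).
  by apply/eqP => /rowP /(_ i); rewrite !mxE => /eqP; rewrite (negbTE bi).
apply/rowP => j; rewrite !mxE -[RHS](h j); apply: eq_bigr => k _.
by rewrite !mxE mulrC.
Qed.

Lemma jac_eq0_of_row f x c : nonzero_vec c ->
  (forall j, \sum_(i < 3) c i * grad (f i) x j = 0) -> (jac f).@[x] = 0.
Proof.
move=> [i ci] h; rewrite meval_jac; apply/eqP/det0P; exists (\row_j c j).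
  by apply/eqP => /rowP /(_ i); rewrite !mxE => /eqP; rewrite (negbTE ci).
by apply/rowP => j; rewrite !mxE -[RHS](h j); apply: eq_bigr => k _; rewrite !mxE.
Qed.

(** By Euler's formula a base point lies in the kernel of the differential there, so base points are
    critical. *)
Lemma jac_neq0_value f d x : (forall i, f i \is d.-homog) -> (0 < d)%N ->
  nonzero_vec x -> (jac f).@[x] != 0 -> nonzero_vec (eval_triple f x).
Proof.
move=> hf d0 [k xk] nzj; apply: NNPP => /not_nonzero_vec z.
have /eqP := xk; apply; apply: (jac_neq0_inj nzj) => i.
by rewrite (euler_at _ (hf i)) -/(eval_triple f x i) z mulr0.
Qed.

Lemma jac_neq0_nonzero f d x : (forall i, f i \is d.-homog) -> (1 < d)%N ->
  (jac f).@[x] != 0 -> nonzero_vec x.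
Proof.
move=> hf d1 nzj; apply: NNPP => /not_nonzero_vec z; case/eqP: nzj.
rewrite (@meval_eq _ _ _ (fun i => 0 * x i)); last by move=> i; rewrite z mul0r.
rewrite (meval_homogZ _ _ (jac_homog hf)) expr0n.
by have -> : (3 * d.-1 == 0)%N = false; [apply/eqP; lia|rewrite mul0r].
Qed.

End Jac.

Section FixedMap.
Variables (K : numClosedFieldType) (f : triple K) (d : nat).
Hypotheses (red : reduced_of_degree f d) (dom : dominant f) (top : top_degree f d)
  (d2 : (2 <= d)%N).
Implicit Types (x y p a b q : 'I_3 -> K).

Let hf : forall i, f i \is d.-homog. Proof. by case: red. Qed.
Let d0 : (0 < d)%N. Proof. exact: leq_trans d2. Qed.

Lemma f_hcoprime : hcoprime f.
Proof. by apply: no_common_factor_hcoprime; case: red. Qed.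

Lemma base_points_pfinite : pfinite (fun x => forall i, (f i).@[x] = 0).
Proof. exact: hcoprime_zeros_pfinite hf f_hcoprime. Qed.

Lemma eval_scale x c i : eval_triple f (fun j => c * x j) i = c ^+ d * eval_triple f x i.
Proof. exact: meval_homogZ. Qed.

(** The critical values lie on a curve by [image_of_curve], so its equation can be added to that of
    the exceptional locus of the topological degree. *)
Lemma generic_fibre : exists (Q : {mpoly K[3]}) k, [/\ Q != 0, Q \is k.-homog &
  forall y, nonzero_vec y -> Q.@[y] != 0 ->
    exists w : 'I_d -> ('I_3 -> K),
        [/\ forall j, is_preimage f y (w j),
            forall j j', j != j' -> ~ proportional (w j) (w j'),
            forall v, is_preimage f y v -> exists j, proportional (w j) v
          & forall j, (jac f).@[w j] != 0]].
Proof.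
have [Q [nzQ [[e hQ] HQ]]] := top.
have [Q1 [k [nz1 h1 H1]]] := image_of_curve hf d0 (dominant_jac_neq0 dom) (jac_homog hf).
exists (Q * Q1), (e + k)%N; split; [by rewrite mulf_neq0|exact: dhomogM|].
move=> y nzy; rewrite mevalM mulf_eq0 negb_or => /andP [Qy Q1y].
have [w [w1 w2 w3]] := HQ y nzy Qy; exists w; split=> // j.
have [_ _ [c [nzc E]]] := w1 j.
apply: contraNneq Q1y => /H1 z; rewrite (@meval_eq _ _ _ (fun i => c * eval_triple f (w j) i)) //.
by rewrite (meval_homogZ _ _ h1) z mulr0.
Qed.

(** Two lines through a general [y] pull back to curves of degree [d]. Without base points these
    meet only in the [d] points of the fibre, transversally since the fibre is not critical, and
    [bezout_lower] gives d^2 <= d. *)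
Lemma base_point_exists : exists q, nonzero_vec q /\ forall i, (f i).@[q] = 0.
Proof.
apply: NNPP => nobase.
have nb x : nonzero_vec x -> nonzero_vec (eval_triple f x).
  by move=> nzx; apply: NNPP => /not_nonzero_vec z; apply: nobase; exists x.
have [Q [k [nzQ hQ HQ]]] := generic_fibre.
have nzX : ('X_i0 : {mpoly K[3]}) != 0.
  by apply/eqP => /(congr1 (meval (fun=> 1))); rewrite mevalXU meval0 => /eqP; rewrite oner_eq0.
have [y] := mpoly_nonzero_at (mulf_neq0 nzQ nzX); rewrite mevalM mevalXU mulf_eq0 negb_or => /andP [Qy y0].
have nzy : nonzero_vec y by exists i0.
have [w [w1 w2 w3 w4]] := HQ y nzy Qy.
have [b [c D]] := complete_basis nzy.
pose m1 := cross y b; pose m2 := cross y c.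
have m12 z : dot m1 z = 0 -> dot m2 z = 0 -> exists t, forall i, z i = t * y i.
  move=> h1 h2; apply: cross0_proportional => // i; apply: (mulfI D); rewrite mulr0.
  transitivity (dot m1 z * m2 i - dot m2 z * m1 i); last by rewrite h1 h2; ring.
  by rewrite det3E !dotE /m1 /m2; elim/ord3_ind: i; rewrite !crossE; ring.
have my1 : dot m1 y = 0 by rewrite dotE /m1 !crossE; ring.
have my2 : dot m2 y = 0 by rewrite dotE /m2 !crossE; ring.
pose L m := linf m \mPo tup f.
have LE m x : (L m).@[x] = dot m (eval_triple f x) by rewrite meval_comp meval_linf.
have hL m : L m \is d.-homog.
  have := dhomog_comp (linf_homog m) (lq := tup f) (d := d); rewrite mul1n; apply=> i.
  by rewrite tnth_mktuple.
have gradL m x z : dot (grad (L m) x) z = dot m (fun i => dot (grad (f i) x) z).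
  have E j : grad (L m) x j = \sum_(i < 3) m i * grad (f i) x j.
    rewrite /grad /L mderiv_comp raddf_sum /=; apply: eq_bigr => i _.
    by rewrite mevalM tnth_mktuple mderiv_linf comp_mpolyC mevalC.
  by rewrite !dotE !E !sum3; ring.
have nzL m : nonzero_vec m -> L m != 0.
  by move=> nzm; apply/eqP => /dom /eqP; rewrite (negbTE (linf_neq0 nzm)).
have nzm1 : nonzero_vec m1.
  apply: (@det3_nz_cross _ c); move: D; congr (_ != _); rewrite !det3E; ring.
have nzm2 : nonzero_vec m2.
  apply: (@det3_nz_cross _ b); rewrite -oppr_eq0; move: D; congr (_ != _); rewrite !det3E; ring.
have : (d * d <= d)%N.
  apply: (@bezout_lower K d d (L m1) (L m2) w); rewrite ?nzL ?hL //.
  - by move=> j; case: (w1 j).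
  - move=> j; rewrite LE; case: (w1 j) => _ _ /proportional_sym [e [nze E]].
    by rewrite -[RHS](mulr0 e) -my1 !dotE !E; ring.
  - move=> j; rewrite LE; case: (w1 j) => _ _ /proportional_sym [e [nze E]].
    by rewrite -[RHS](mulr0 e) -my2 !dotE !E; ring.
  - move=> x nzx; rewrite !LE => h1 h2; have [t Et] := m12 _ h1 h2.
    apply: w3; split=> //; first exact: nb.
    have nzt : t != 0.
      by apply/eqP => t0; case: (nb x nzx) => i; rewrite Et t0 mul0r eqxx.
    by apply: proportional_sym; exists t.
  move=> j z; rewrite !gradL => h1 h2; have [t Et] := m12 _ h1 h2.
  have [nzw _ /proportional_sym [e [nze E]]] := w1 j.
  have nzd : d%:R != 0 :> K by rewrite pnatr_eq0 -lt0n.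
  (* The differential sends [z] to a multiple of [y]; by Euler's formula this multiple of [w j] has
     the same image, and the differential is injective. *)
  exists (t / e / d%:R) => i; apply/eqP; rewrite -subr_eq0; apply/eqP; move: i.
  apply: (jac_neq0_inj (w4 j)) => i.
  transitivity (dot (grad (f i) (w j)) z - (t / e / d%:R) * dot (grad (f i) (w j)) (w j)).
    by rewrite !dotE; ring.
  rewrite Et (euler_at _ (hf i)) -/(eval_triple f (w j) i) E; field.
  by rewrite nzd nze.
by rewrite -{3}(muln1 d) leq_pmul2l // leqNgt d2.
Qed.

(** The fibre over [p] together with the base points; this makes it the zero set of the forms
    [crossf p]. *)
Definition fibre p x := forall i, cross p (eval_triple f x) i = 0.

Definition crossf p : triple K := fun i =>
  p (nx i) *: f (nx (nx i)) - p (nx (nx i)) *: f (nx i).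

Lemma meval_crossf p i x : (crossf p i).@[x] = cross p (eval_triple f x) i.
Proof. by rewrite /crossf /cross /eval_triple mevalB !mevalZ. Qed.

Lemma crossf_homog p i : crossf p i \is d.-homog.
Proof. by apply: rpredB; apply: rpredZ; apply: hf. Qed.

Lemma grad_crossf p i x j :
  grad (crossf p i) x j = cross p (fun l => grad (f l) x j) i.
Proof. by rewrite /grad /crossf /cross mderivB !mderivZ mevalB !mevalZ. Qed.

(** If [crossf p] is [h] times [qf], then at a zero of [h] its differential has rank at most one,
    which forces that zero to be critical for [f]. The contracted values are thus among the values
    of [f] at the critical points of one fixed line. *)
Lemma exceptional_list : exists P : seq ('I_3 -> K), (forall p, List.In p P -> nonzero_vec p) /\
  forall p, nonzero_vec p -> ~ pfinite (fibre p) -> exists p', List.In p' P /\ proportional p' p.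
Proof.
(* Since [l1] is not critical, the critical points of the test line are l0 + t l1 up to a scalar;
   the choice of [l0] keeps such points away from the base points. *)
have [l1 jl1] := mpoly_nonzero_at (dominant_jac_neq0 dom).
have nzl1 := jac_neq0_nonzero hf d2 jl1.
have [A [nzA HA]] := pfinite_avoid_lines nzl1 base_points_pfinite.
have [l0 /HA [cl nbase]] := mpoly_nonzero_at nzA.
pose r := rl l0 l1 (jac f).
have nzr : r != 0 by rewrite -size_poly_eq0 (size_rl _ (jac_homog hf) jl1).
have [rs Er] := closed_field_poly_normal r.
have nb s t : s != 0 -> nonzero_vec (eval_triple f (lc2 s l0 t l1)).
  by move=> nzs; apply: NNPP => /not_nonzero_vec z; apply: (nbase s t nzs).
exists [seq eval_triple f (lc2 1 l0 t l1) | t <- rs]; split.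
  by move=> p /List.in_map_iff [t [<- _]]; apply: nb; rewrite oner_neq0.
move=> p nzp inf.
have [|h [e [nzh hh e0 dv]]] := @common_factor_of_infinite K (crossf p) d (crossf_homog p).
  by apply: contra_not inf; apply: pfinite_sub => x _ fx i; rewrite meval_crossf.
have [s [t [st hx]]] := curve_meets_line l0 l1 hh e0.
set x := lc2 s l0 t l1 in hx.
have [qf Eq] : exists qf : triple K, forall i, crossf p i = h * qf i.
  pose qf i := proj1_sig (constructive_indefinite_description _ (dv i)).
  by exists qf => i; rewrite /qf; case: constructive_indefinite_description.
pose qx i := (qf i).@[x].
have Gg i j : grad (crossf p i) x j = qx i * grad h x j.
  by rewrite /grad Eq mderivM mevalD !mevalM hx mul0r addr0 mulrC.
have jx : (jac f).@[x] = 0.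
  have [b [c D]] := complete_basis nzp.
  (* The differential of [crossf p] is [qx] times that of [h]. Pairing it with [u] orthogonal to
     [qx] gives 0, and this pairing is also that of [cross u p] with the differential of [f]. *)
  have [u [eu cu]] : exists u, dot u qx = 0 /\ nonzero_vec (cross u p).
    case: (classic (dot b qx = 0)) => [bq|/eqP bq].
      exists b; split => //; apply: (@det3_nz_cross _ c).
      by rewrite -oppr_eq0; move: D; congr (_ != _); rewrite !det3E; ring.
    exists (lc2 (dot c qx) b (- dot b qx) c); split; first by rewrite !dotE /lc2; ring.
    apply: (@det3_nz_cross _ b).
    rewrite (_ : det3 _ _ _ = - (dot b qx * det3 p b c)) ?oppr_eq0 ?mulf_neq0 //.
    by rewrite !det3E /lc2 !dotE; ring.
  apply: (jac_eq0_of_row cu) => j.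
  transitivity (\sum_(i < 3) u i * grad (crossf p i) x j).
    by rewrite !sum3 !grad_crossf !crossE; ring.
  under eq_bigr => i _ do rewrite Gg mulrA.
  by rewrite -mulr_suml -/(dot u qx) eu mul0r.
have nzs : s != 0.
  apply/eqP => s0; move: st jx; rewrite s0 eqxx /= => nzt /eqP.
  rewrite (@meval_eq _ _ _ (fun i => t * l1 i)); last by move=> i; rewrite /x /lc2 s0; ring.
  by rewrite (meval_homogZ _ _ (jac_homog hf)) mulf_eq0 expf_eq0 (negbTE nzt) andbF (negbTE jl1).
have Ex : x = (fun i => s * lc2 1 l0 (t / s) l1 i).
  by apply: functional_extensionality => i; rewrite /x /lc2; field.
exists (eval_triple f (lc2 1 l0 (t / s) l1)); split.
  apply/List.in_map_iff; exists (t / s); split => //.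
  have : root r (t / s).
    move/eqP: jx; rewrite Ex (meval_homogZ _ _ (jac_homog hf)) mulf_eq0 expf_eq0 (negbTE nzs) andbF /=.
    rewrite /root horner_rl; congr (_ == _); apply: meval_eq => i; rewrite /lc2; ring.
  rewrite Er rootZ ?lead_coef_eq0 // root_prod_XsubC.
  elim: (rs) => //= w l IH; rewrite inE => /orP [/eqP ->|/IH]; first by left.
  by right.
have fx i : cross p (eval_triple f x) i = 0 by rewrite -meval_crossf Eq mevalM hx mul0r.
have [z Ez] := cross0_proportional nzp fx.
have nzf := nb s t nzs; rewrite -/x in nzf.
have nzz : z != 0 by apply/eqP => z0; case: nzf => i; rewrite Ez z0 mul0r eqxx.
exists (s ^+ d / z); split; first by rewrite mulf_neq0 ?invr_eq0 ?expf_neq0.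
move=> i; apply: (mulfI nzz); rewrite -Ez Ex eval_scale; by field.
Qed.

End FixedMap.

(** * Generic conditions on the matrix *)

Section Generic.
Variable K : numClosedFieldType.
Implicit Types (T : 'M[K]_3) (phi : 'M[K]_3 -> K).

(** The equations live on all matrices and invertibility enters only in the conclusion, so that a
    singular matrix may witness that an equation is nonzero. *)
Definition Gen (Phi : 'M[K]_3 -> Prop) := exists Z : nat -> {mpoly K[3 * 3]},
  (forall m, Z m != 0 /\ exists e, Z m \is e.-homog) /\
  forall T, T \in unitmx -> (forall m, (Z m).@[mat_coords T] != 0) -> Phi T.

Lemma Gen_impl (Phi Psi : 'M[K]_3 -> Prop) :
  (forall T, T \in unitmx -> Phi T -> Psi T) -> Gen Phi -> Gen Psi.
Proof. by move=> h [Z [Z1 Z2]]; exists Z; split=> // T uT /(Z2 T uT); apply: h. Qed.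

Lemma Gen_countable (Phi : nat -> 'M[K]_3 -> Prop) :
  (forall n, Gen (Phi n)) -> Gen (fun T => forall n, Phi n T).
Proof.
move=> H; pose Z n := proj1_sig (constructive_indefinite_description _ (H n)).
have HZ n : (forall m, Z n m != 0 /\ exists e, Z n m \is e.-homog) /\
  forall T, T \in unitmx -> (forall m, (Z n m).@[mat_coords T] != 0) -> Phi n T.
  by rewrite /Z; case: constructive_indefinite_description.
(* The doubly indexed equations are enumerated by [pickle]; a code of no pair gets the equation 1,
   which excludes nothing. *)
exists (fun k => if @unpickle (nat * nat)%type k is Some nm then Z nm.1 nm.2 else 1); split.
  move=> k; case: unpickle => [[n m]|]; first by case: (HZ n).
  by split; [rewrite oner_neq0|exists 0%N; apply: dhomog1].
move=> T uT h n; case: (HZ n) => _; apply=> // m.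
by have := h (pickle (n, m)); rewrite pickleK.
Qed.

Lemma Gen_and (Phi Psi : 'M[K]_3 -> Prop) :
  Gen Phi -> Gen Psi -> Gen (fun T => Phi T /\ Psi T).
Proof.
move=> h1 h2; have := @Gen_countable (fun n => if n is 0 then Phi else Psi) _.
by move=> H; apply: Gen_impl (H _) => [T _ h|[|n]//]; split; [apply: (h 0%N)|apply: (h 1%N)].
Qed.

Lemma Gen_true : Gen (fun=> True).
Proof.
by exists (fun=> 1); split=> // m; split; [rewrite oner_neq0|exists 0%N; apply: dhomog1].
Qed.

Lemma Gen_list (I : Type) (s : seq I) (Phi : I -> 'M[K]_3 -> Prop) :
  (forall i, List.In i s -> Gen (Phi i)) -> Gen (fun T => forall i, List.In i s -> Phi i T).
Proof.
elim: s => [_|i s IH H]; first by apply: Gen_impl Gen_true.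
have h1 : Gen (Phi i) by apply: H; left.
have h2 : Gen (fun T => forall i, List.In i s -> Phi i T) by apply: IH => j js; apply: H; right.
by apply: Gen_impl (Gen_and h1 h2) => T _ [a b] j [<-//|/b].
Qed.

(* homogeneous polynomial functions of degree [e] in the entries *)
Definition hpf e phi := exists2 P : {mpoly K[3 * 3]}, P \is e.-homog &
  forall T, P.@[mat_coords T] = phi T.

Lemma Gen_hpf e phi : hpf e phi -> (exists T, phi T != 0) -> Gen (fun T => phi T != 0).
Proof.
move=> [P hP EP] [T0 nz]; exists (fun=> P); split.
  move=> _; split; last by exists e.
  by apply: contraNneq nz => P0; rewrite -EP P0 meval0.
by move=> T _ /(_ 0%N); rewrite EP.
Qed.

Lemma hpf_entry i j : hpf 1 (fun T => T i j).
Proof.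
exists 'X_(mxvec_index i j); first by rewrite dhomogX /= mdeg1.
by move=> T; rewrite mevalXU /mat_coords mxvecE.
Qed.

Lemma hpf_const c : hpf 0 (fun=> c).
Proof.
exists c%:MP; last by move=> T; rewrite mevalC.
by rewrite -[c%:MP]mulr1 mul_mpolyC rpredZ // dhomog1.
Qed.

Lemma hpfD e phi psi : hpf e phi -> hpf e psi -> hpf e (fun T => phi T + psi T).
Proof.
by move=> [P h E] [Q h' E']; exists (P + Q); [exact: rpredD|move=> T; rewrite mevalD E E'].
Qed.

Lemma hpfM e e' phi psi : hpf e phi -> hpf e' psi -> hpf (e + e') (fun T => phi T * psi T).
Proof.
by move=> [P h E] [Q h' E']; exists (P * Q); [exact: dhomogM|move=> T; rewrite mevalM E E'].
Qed.

Lemma hpfZ c e phi : hpf e phi -> hpf e (fun T => c * phi T).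
Proof. by move=> h; have := hpfM (hpf_const c) h. Qed.

Lemma hpf_ext e phi psi : (forall T, phi T = psi T) -> hpf e phi -> hpf e psi.
Proof. by move=> h [P hP E]; exists P => // T; rewrite E h. Qed.

Lemma hpfB e phi psi : hpf e phi -> hpf e psi -> hpf e (fun T => phi T - psi T).
Proof.
move=> h1 h2; apply: hpf_ext (hpfD h1 (hpfZ (-1) h2)) => T; by rewrite mulN1r.
Qed.

Lemma hpf_comp (p : {mpoly K[3]}) k e (v : 'M[K]_3 -> 'I_3 -> K) : p \is k.-homog ->
  (forall i, hpf e (fun T => v T i)) -> hpf (k * e) (fun T => p.@[v T]).
Proof.
move=> hp H.
have H' i : exists P : {mpoly K[3 * 3]}, P \is e.-homog /\ forall T, P.@[mat_coords T] = v T i.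
  by case: (H i) => P h E; exists P.
pose P i := proj1_sig (constructive_indefinite_description _ (H' i)).
have HP i : P i \is e.-homog /\ forall T, (P i).@[mat_coords T] = v T i.
  by rewrite /P; case: constructive_indefinite_description.
exists (p \mPo [tuple P i | i < 3]).
  by apply: dhomog_comp => // i; rewrite tnth_mktuple; case: (HP i).
move=> T; rewrite comp_mpoly_meval; apply: meval_eq => i; rewrite tnth_mktuple.
by case: (HP i).
Qed.

Definition tact T (v : 'I_3 -> K) : 'I_3 -> K := fun i => dot (fun j => T i j) v.

Lemma hpf_tact e (v : 'M[K]_3 -> 'I_3 -> K) i : (forall j, hpf e (fun T => v T j)) ->
  hpf (1 + e) (fun T => tact T (v T) i).
Proof.
move=> h; apply: (@hpf_ext _ (fun T => T i i0 * v T i0 + T i i1 * v T i1 + T i i2 * v T i2)).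
  by move=> T; rewrite /tact dotE.
by apply: hpfD; first apply: hpfD; apply: hpfM (hpf_entry _ _) (h _).
Qed.

Lemma hpf_det3 e e' e'' (a b c : 'M[K]_3 -> 'I_3 -> K) :
  (forall i, hpf e (fun T => a T i)) -> (forall i, hpf e' (fun T => b T i)) ->
  (forall i, hpf e'' (fun T => c T i)) ->
  hpf (e + (e' + e'')) (fun T => det3 (a T) (b T) (c T)).
Proof.
move=> ha hb hc.
apply: (@hpf_ext _ (fun T => a T i0 * (b T i1 * c T i2 - b T i2 * c T i1)
  + a T i1 * (b T i2 * c T i0 - b T i0 * c T i2) + a T i2 * (b T i0 * c T i1 - b T i1 * c T i0))).
  by move=> T; rewrite det3E.
by apply: hpfD; first apply: hpfD; (apply: hpfM => //; apply: hpfB; apply: hpfM).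
Qed.

Definition tcol T j : 'I_3 -> K := fun i => T i j.
(** The adjugate of T applied to [q]: it represents T^-1 q projectively and is polynomial in the
    entries of T. *)
Definition adjv T (q : 'I_3 -> K) : 'I_3 -> K :=
  fun i => det3 q (tcol T (nx i)) (tcol T (nx (nx i))).
Definition tdet T := det3 (tcol T i0) (tcol T i1) (tcol T i2).

Lemma tact_adjv T q i : tact T (adjv T q) i = tdet T * q i.
Proof. by rewrite /tact dotE /adjv /tdet !det3E /tcol; elim/ord3_ind: i; rewrite /nx /=; ring. Qed.

Lemma adjv_tact T v i : adjv T (tact T v) i = tdet T * v i.
Proof. by rewrite /adjv /tdet !det3E /tcol /tact !dotE; elim/ord3_ind: i; rewrite /nx /=; ring. Qed.

Lemma det3_tact T a b c : det3 (tact T a) (tact T b) (tact T c) = tdet T * det3 a b c.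
Proof. by rewrite /tdet !det3E /tcol /tact !dotE; ring. Qed.

Lemma tdetE T : tdet T = \det T.
Proof. by rewrite -det_tr det_mx33 /tdet !det3E /tcol !mxE. Qed.

Lemma tdet_unit T : T \in unitmx -> tdet T != 0.
Proof. by rewrite unitmxE unitfE tdetE. Qed.

Lemma exists_map (a b c a' b' c' : 'I_3 -> K) : det3 a b c != 0 ->
  exists T, [/\ forall i, tact T a i = a' i, forall i, tact T b i = b' i
              & forall i, tact T c i = c' i].
Proof.
move=> D; exists (\matrix_(i, j) ((a' i * cross b c j + b' i * cross c a j + c' i * cross a b j)
   / det3 a b c)).
by split=> i; apply: (mulfI D); move: D; rewrite /tact dotE !mxE !crossE !det3E => D; field.
Qed.

End Generic.

(** * Orbits, fibres and lines for a general matrix *)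

Section Conditions.
Variables (K : numClosedFieldType) (f : triple K) (d : nat).
Hypotheses (red : reduced_of_degree f d) (dom : dominant f) (top : top_degree f d)
  (d2 : (2 <= d)%N).
Implicit Types (x y p a b q v : 'I_3 -> K) (T : 'M[K]_3).

Let hf : forall i, f i \is d.-homog. Proof. by case: red. Qed.
Let d0 : (0 < d)%N. Proof. exact: leq_trans d2. Qed.

(** The orbit starts at T p, the point to which T o f contracts a curve that [f] contracts to
    [p]. *)
Fixpoint orb T p n : 'I_3 -> K :=
  if n is n'.+1 then tact T (eval_triple f (orb T p n')) else tact T p.

Lemma hpf_orb p n : exists e, forall i, hpf e (fun T => orb T p n i).
Proof.
elim: n => [|n [e IH]].
  exists 1%N => i; have := @hpf_tact K 0 (fun=> p) i; rewrite addn0; apply=> j.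
  exact: hpf_const.
exists (1 + d * e)%N => i; apply: (@hpf_tact K _ (fun T => eval_triple f (orb T p n))) => j.
by apply: hpf_comp.
Qed.

Lemma binary_expand (g : {mpoly K[3]}) v1 v2 (s t : K) : g \is d.-homog ->
  g.@[lc2 s v1 t v2] = \sum_(k < d.+1) (rl v1 v2 g)`_k * s ^+ (d - k) * t ^+ k.
Proof.
move=> hg; have [sz tp] := rl_top v1 v2 hg.
have [->|nzs] := eqVneq s 0.
  rewrite (@meval_eq _ _ _ (fun i => t * v2 i)); last by move=> i; rewrite /lc2; ring.
  rewrite (meval_homogZ _ _ hg) big_ord_recr /= subnn expr0 mulr1 tp big1 => [|k _]; first by rewrite add0r mulrC.
  by rewrite expr0n subn_eq0 leqNgt ltn_ord mulr0 mul0r.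
rewrite (@meval_eq _ _ _ (fun i => s * (v1 i + (t / s) * v2 i))); last first.
  by move=> i; rewrite /lc2; field.
rewrite (meval_homogZ _ _ hg) -horner_rl (@horner_coef_wide _ d.+1) // mulr_sumr.
apply: eq_bigr => k _; have le_k : (k <= d)%N by rewrite -ltnS.
have -> : s ^+ d = s ^+ (d - k) * s ^+ k by rewrite -exprD subnK.
by rewrite exprMn exprVn; field; rewrite expf_neq0.
Qed.

Definition Lf m : {mpoly K[3]} := linf m \mPo tup f.

Lemma meval_Lf m x : (Lf m).@[x] = dot m (eval_triple f x).
Proof. by rewrite meval_comp meval_linf. Qed.

Lemma Lf_homog m : Lf m \is d.-homog.
Proof.
have := dhomog_comp (linf_homog m) (lq := tup f) (d := d); rewrite mul1n; apply=> i.
by rewrite tnth_mktuple.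
Qed.

Lemma grad_Lf m x j : grad (Lf m) x j = \sum_(i < 3) m i * grad (f i) x j.
Proof.
rewrite /grad /Lf mderiv_comp raddf_sum /=; apply: eq_bigr => i _.
by rewrite mevalM tnth_mktuple mderiv_linf comp_mpolyC mevalC.
Qed.

Lemma rl_coef1 (g : {mpoly K[3]}) v1 v2 : (rl v1 v2 g)`_1 = dot (grad g v1) v2.
Proof.
have -> : (rl v1 v2 g)`_1 = ((rl v1 v2 g)^`()).[0] by rewrite horner_coef0 coef_deriv mulr1n.
rewrite deriv_rl horner_sum; apply: eq_bigr => i _; rewrite hornerZ horner_rl mulrC; congr (_ * _).
by apply: meval_eq => j; rewrite mul0r addr0.
Qed.

Lemma rl_coef0 (g : {mpoly K[3]}) v1 v2 : (rl v1 v2 g)`_0 = g.@[v1].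
Proof.
by rewrite -horner_coef0 horner_rl; apply: meval_eq => j; rewrite mul0r addr0.
Qed.

Section Witness.
Variables (p v1 v2 l1 l2 : 'I_3 -> K).
Hypotheses (jv : (jac f).@[v1] != 0) (h21 : dot l2 (eval_triple f v1) = 0)
  (h11 : dot l1 (eval_triple f v1) != 0) (h1p : dot l1 p != 0) (h2p : dot l2 p != 0)
  (h2v : dot (grad (Lf l2) v1) v2 != 0) (v12 : nonzero_vec (cross v1 v2)).

Definition Ts (s : K) : 'M[K]_3 := \matrix_(i, j) (v1 i * l1 j + s * v2 i * l2 j).

Lemma tact_Ts s v i : tact (Ts s) v i = lc2 (dot l1 v) v1 (s * dot l2 v) v2 i.
Proof. by rewrite /tact !dotE /lc2 !mxE; ring. Qed.

(** The form [Lf l2] vanishes at [v1] while its derivative along [v2] does not, so it preserves the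
    order in s of the second coordinate; the factor s in [Ts] then raises that order by one at each
    step. The first coordinate stays nonzero at s = 0 because [l1] does not vanish at f(v1). *)
Lemma orb_Ts n : exists A B : {poly K}, [/\ A.[0] != 0, B.[0] != 0 &
  forall s i, orb (Ts s) p n i = lc2 A.[s] v1 (s ^+ n.+1 * B.[s]) v2 i].
Proof.
elim: n => [|n [A [B [A0 B0 E]]]].
  exists (dot l1 p)%:P, (dot l2 p)%:P; rewrite !hornerC; split=> // s i /=.
  by rewrite tact_Ts !hornerC.
pose r1 := rl v1 v2 (Lf l1); pose r2 := rl v1 v2 (Lf l2).
exists (\sum_(k < d.+1) r1`_k *: (A ^+ (d - k) * ('X^(n.+1) * B) ^+ k)).
exists (\sum_(k < d) r2`_k.+1 *: (A ^+ (d - k.+1) * B ^+ k.+1 * 'X^(n.+1 * k))).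
have r20 : r2`_0 = 0 by rewrite rl_coef0 meval_Lf.
split.
- rewrite horner_sum (bigD1 ord0) //= big1 => [|k nk].
    by rewrite addr0 subn0 expr0 mulr1 hornerZ horner_exp mulf_neq0 ?expf_neq0 // rl_coef0 meval_Lf.
  rewrite hornerZ hornerM !horner_exp hornerM hornerXn exprS mul0r mul0r expr0n.
  by have -> : (nat_of_ord k == 0)%N = false; [apply/negbTE|rewrite mulr0n !mulr0].
- rewrite horner_sum (bigD1 (Ordinal d0)) //= big1 => [|k nk].
    rewrite addr0 muln0 expr0 mulr1 hornerZ hornerM !horner_exp expr1.
    by rewrite !mulf_neq0 ?expf_neq0 // rl_coef1.
  rewrite hornerZ !hornerM hornerXn expr0n muln_eq0 /=.
  by have -> : (nat_of_ord k == 0)%N = false; [apply/negbTE|rewrite mulr0n !mulr0].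
move=> s i; rewrite /= tact_Ts.
have Eo : orb (Ts s) p n = lc2 A.[s] v1 (s ^+ n.+1 * B.[s]) v2.
  by apply: functional_extensionality.
rewrite Eo; congr (lc2 _ v1 _ v2 i).
  rewrite -meval_Lf (binary_expand _ _ _ _ (Lf_homog l1)) horner_sum; apply: eq_bigr => k _.
  by rewrite hornerZ hornerM !horner_exp hornerM hornerXn mulrA.
rewrite -meval_Lf (binary_expand _ _ _ _ (Lf_homog l2)) big_ord_recl /= -/r2 r20 !mul0r add0r.
rewrite horner_sum !mulr_sumr; apply: eq_bigr => k _.
rewrite hornerZ !hornerM !horner_exp hornerX /bump /= add1n exprMn.
rewrite [in RHS]exprM [(s ^+ n.+1) ^+ k.+1]exprS [s ^+ n.+2]exprS; ring.
Qed.

Lemma orb_witness_jac n : exists T, (jac f).@[orb T p n] != 0.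
Proof.
have [A [B [A0 B0 E]]] := orb_Ts n; exists (Ts 0).
rewrite (@meval_eq _ _ _ (fun i => A.[0] * v1 i)); last first.
  by move=> i; rewrite E /lc2 exprS; ring.
by rewrite (meval_homogZ _ _ (jac_homog hf)) mulf_neq0 ?expf_neq0.
Qed.

(** The ratio of the two coordinates of the n-th point has order exactly n+1 at s = 0, which
    separates different times. *)
Lemma orb_witness_cross m n : (m < n)%N ->
  exists i T, cross (orb T p m) (orb T p n) i != 0.
Proof.
move=> lt_mn; case: v12 => i nzi; exists i.
have [A [B [A0 B0 E]]] := orb_Ts m; have [A' [B' [A0' B0' E']]] := orb_Ts n.
have nzP : A * 'X^(n - m) * B' - A' * B != 0.
  apply/eqP => /(congr1 (horner^~ 0)); rewrite hornerD hornerN !hornerM hornerXn expr0n subn_eq0.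
  rewrite leqNgt lt_mn mulr0n horner0 mulr0 mul0r sub0r => /eqP.
  by rewrite oppr_eq0 mulf_eq0 (negbTE A0') (negbTE B0).
(* The factor ['X] ensures that s is nonzero. *)
have [s hs] : exists s, ('X * (A * 'X^(n - m) * B' - A' * B)).[s] != 0.
  apply: NNPP => h; have : 'X * (A * 'X^(n - m) * B' - A' * B) = 0.
    by apply: poly_vanish => s; apply/eqP; apply: contraT => hs; case: h; exists s.
  by move=> /eqP; rewrite mulf_eq0 polyX_eq0 (negbTE nzP).
exists (Ts s).
have -> : cross (orb (Ts s) p m) (orb (Ts s) p n) i =
   s ^+ m.+1 * (A.[s] * s ^+ (n - m) * B'.[s] - A'.[s] * B.[s]) * cross v1 v2 i.
  have En : n.+1 = (m.+1 + (n - m))%N by lia.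
  by rewrite /cross !E !E' /lc2 En exprD; ring.
move: hs; rewrite !(hornerE, hornerXn) /= mulf_eq0 negb_or => /andP [nzs h].
by rewrite !mulf_neq0 // expf_neq0.
Qed.

End Witness.

Lemma Lf_neq0 m : nonzero_vec m -> Lf m != 0.
Proof. by move=> nzm; apply/eqP => /dom /eqP; rewrite (negbTE (linf_neq0 nzm)). Qed.

Lemma crossf_neq0 p : nonzero_vec p -> exists i, crossf f p i != 0.
Proof.
move=> nzp; have [c [c' D]] := complete_basis nzp.
have nzm : nonzero_vec (cross c p).
  by apply: (@det3_nz_cross _ c'); rewrite -oppr_eq0; move: D; congr (_ != _); rewrite !det3E; ring.
apply: NNPP => h; case/eqP: (Lf_neq0 nzm); apply: mpoly_vanish => x.
have z i : cross p (eval_triple f x) i = 0.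
  rewrite -meval_crossf; suff -> : crossf f p i = 0 by rewrite meval0.
  by apply/eqP; apply: contraT => hi; case: h; exists i.
rewrite meval_Lf -[RHS](mulr0 0).
transitivity (dot c (fun i => cross p (eval_triple f x) i)).
  by rewrite !dotE !crossE; ring.
by rewrite dotE !z; ring.
Qed.

Lemma witness_exists p : nonzero_vec p -> exists v1 v2 l1 l2 : 'I_3 -> K,
  [/\ (jac f).@[v1] != 0 /\ dot l2 (eval_triple f v1) = 0,
      dot l1 (eval_triple f v1) != 0, dot l1 p != 0, dot l2 p != 0
    & dot (grad (Lf l2) v1) v2 != 0 /\ nonzero_vec (cross v1 v2)].
Proof.
move=> nzp; have [k nzc] := crossf_neq0 nzp.
have [v1] := mpoly_nonzero_at (mulf_neq0 (dominant_jac_neq0 dom) nzc).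
rewrite mevalM mulf_eq0 negb_or meval_crossf => /andP [jv ck].
set y := eval_triple f v1 in ck.
have nzv1 := jac_neq0_nonzero hf d2 jv.
have nzy : nonzero_vec y := jac_neq0_value hf d0 nzv1 jv.
have nzpy : nonzero_vec (cross p y) by exists k.
have [c hc] := mpoly_nonzero_at (linf_neq0 nzpy); rewrite meval_linf in hc.
have [l1] := mpoly_nonzero_at (mulf_neq0 (linf_neq0 nzy) (linf_neq0 nzp)).
rewrite mevalM mulf_eq0 negb_or !meval_linf => /andP [l1y l1p].
(* Orthogonal to [y] but not to [p], because [c] is off the line through [p] and [y]. *)
pose l2 := cross y c.
have l2y : dot l2 y = 0 by rewrite dotE /l2 !crossE; ring.
have l2p : dot l2 p != 0 by move: hc; congr (_ != _); rewrite !dotE /l2 !crossE; ring.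
have nzl2 : nonzero_vec l2.
  by apply: NNPP => /not_nonzero_vec z; case/eqP: l2p; rewrite dotE !z; ring.
have nzr : nonzero_vec (grad (Lf l2) v1).
  apply: NNPP => /not_nonzero_vec z; case/eqP: jv; apply: (jac_eq0_of_row nzl2) => j.
  by rewrite -grad_Lf z.
have [b [b' hb]] := complete_basis nzv1.
have nzvb : nonzero_vec (cross v1 b).
  by apply: (@det3_nz_cross _ b'); move: hb; congr (_ != _); rewrite !det3E; ring.
have [w hw] := mpoly_nonzero_at (linf_neq0 nzr); rewrite meval_linf in hw.
exists v1, w, l1, l2; split=> //.
- by move: l1y; rewrite !dotE ![y _ * _]mulrC.
- by move: l1p; rewrite !dotE ![p _ * _]mulrC.
split=> //; apply: not_proportional_cross => //.
  by apply: NNPP => /not_nonzero_vec z; case/eqP: hw; rewrite dotE !z; ring.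
(* Since [Lf l2] vanishes at [v1], Euler's formula puts [v1] in the kernel of its gradient there,
   and [w] is outside that kernel. *)
move=> [e [nze Ee]]; case/eqP: hw.
have -> : dot (grad (Lf l2) v1) w = e * dot (grad (Lf l2) v1) v1 by rewrite !dotE !Ee; ring.
by rewrite (euler_at _ (Lf_homog l2)) meval_Lf l2y !mulr0.
Qed.

Lemma Gen_orbits p : nonzero_vec p -> Gen (fun T => (forall n, (jac f).@[orb T p n] != 0) /\
   forall m n, (m < n)%N -> ~ proportional (orb T p m) (orb T p n)).
Proof.
move=> nzp; have [v1 [v2 [l1 [l2 [[w1 w2] w3 w4 w5 [w6 w7]]]]]] := witness_exists nzp.
apply: Gen_and.
  apply: Gen_countable => n; have [e he] := hpf_orb p n.
  apply: (Gen_hpf (hpf_comp (jac_homog hf) he)).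
  exact: (orb_witness_jac w1 w2 w3 w4 w5 w6).
apply: Gen_countable => m; apply: Gen_countable => n.
have [lt_mn|_] := boolP (m < n)%N; last by apply: Gen_impl (Gen_true K).
have [i [T0 nz]] := orb_witness_cross w1 w2 w3 w4 w5 w6 w7 lt_mn.
have [e he] := hpf_orb p m; have [e' he'] := hpf_orb p n.
have H : hpf (e + e') (fun T => cross (orb T p m) (orb T p n) i).
  by apply: hpfB; [apply: hpfM|rewrite addnC; apply: (hpf_ext _ (hpfM (he' _) (he _))) => T; rewrite mulrC].
apply: Gen_impl (Gen_hpf H (ex_intro _ T0 nz)) => T _ h _ pr.
by case/eqP: h; apply: proportional_cross.
Qed.

(** The preimages of [q] under T o f are those of T^-1 q under [f]; for general T the base point [q]
    itself therefore has a generic fibre. *)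
Lemma Gen_fibre (Q : {mpoly K[3]}) k q : Q != 0 -> Q \is k.-homog -> nonzero_vec q ->
  Gen (fun T => Q.@[adjv T q] != 0).
Proof.
move=> nzQ hQ nzq.
have hadj i : hpf 2 (fun T => adjv T q i).
  have h j : forall l, hpf 1 (fun T : 'M[K]_3 => tcol T j l) by move=> l; apply: hpf_entry.
  exact: (@hpf_det3 _ 0 1 1 (fun=> q) _ _ (fun l => hpf_const (q l)) (h _) (h _)).
apply: (Gen_hpf (hpf_comp hQ hadj)).
have nzX : ('X_i0 : {mpoly K[3]}) != 0.
  by apply/eqP => /(congr1 (meval (fun=> 1))); rewrite mevalXU meval0 => /eqP; rewrite oner_eq0.
have [y] := mpoly_nonzero_at (mulf_neq0 nzQ nzX); rewrite mevalM mevalXU mulf_eq0 negb_or => /andP [Qy y0].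
have nzy : nonzero_vec y by exists i0.
have [b [c D]] := complete_basis nzy; have [b' [c' D']] := complete_basis nzq.
have [T [h1 h2 h3]] := exists_map q b' c' D; exists T.
have E1 : tact T y = q by apply: functional_extensionality.
have E2 : tact T b = b' by apply: functional_extensionality.
have E3 : tact T c = c' by apply: functional_extensionality.
have nzd : tdet T != 0.
  by have := det3_tact T y b c; rewrite E1 E2 E3 => E; apply: contraNneq D' => z; rewrite E z mul0r.
rewrite (@meval_eq _ _ _ (fun i => tdet T * y i)); last by move=> i; rewrite -E1 adjv_tact.
by rewrite (meval_homogZ _ _ hQ) mulf_neq0 // expf_neq0.
Qed.

(** Otherwise, at a noncritical [a], the differential sends [q] to a multiple of f(a). By Euler's
    formula it then kills [q] minus a multiple of [a], so [q] is a multiple of [a]. *)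
Lemma nonradial_points q : nonzero_vec q -> exists a t,
  nonzero_vec (cross (eval_triple f a) (eval_triple f (mov a q t))).
Proof.
move=> nzq.
have [c [c' D]] := complete_basis nzq.
have nzqc : nonzero_vec (cross q c).
  by apply: (@det3_nz_cross _ c'); move: D; congr (_ != _); rewrite !det3E; ring.
have [a] := mpoly_nonzero_at (mulf_neq0 (dominant_jac_neq0 dom) (linf_neq0 nzqc)).
rewrite mevalM mulf_eq0 negb_or meval_linf => /andP [ja haq].
have nza := jac_neq0_nonzero hf d2 ja.
have nzfa := jac_neq0_value hf d0 nza ja.
set y := eval_triple f a in nzfa.
have [i nzi] : nonzero_vec (cross y (fun l => dot (grad (f l) a) q)).
  apply: NNPP => /not_nonzero_vec z; have [s Es] := cross0_proportional nzfa z.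
  have nzd : d%:R != 0 :> K by rewrite pnatr_eq0 -lt0n.
  have E j : q j - s / d%:R * a j = 0.
    apply: (jac_neq0_inj ja (b := fun j => q j - s / d%:R * a j)) => l.
    transitivity (dot (grad (f l) a) q - s / d%:R * dot (grad (f l) a) a); first by rewrite !dotE; ring.
    by rewrite Es (euler_at _ (hf l)) -/(eval_triple f a l) -/y; field.
  have E' j : q j = s / d%:R * a j by apply/eqP; rewrite -subr_eq0 E.
  case/eqP: haq; rewrite dotE !crossE !E'; ring.
exists a; apply: NNPP => h.
have R0 : rl a q (crossf f y i) = 0.
  apply: poly_vanish => t; rewrite horner_rl meval_crossf; apply/eqP; apply: contraT => nz.
  by case: h; exists t, i.
have : dot (grad (crossf f y i) a) q = 0 by rewrite -rl_coef1 R0 coef0.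
apply/eqP; move: nzi; congr (_ != _); rewrite dotE !grad_crossf /cross !dotE; ring.
Qed.

(** Some line through [q] is not mapped into a line through [q], which rules out the pencil centred
    at the base point as an invariant foliation. *)
Lemma Gen_nonradial q : nonzero_vec q -> Gen (fun T => exists a t,
  det3 q (tact T (eval_triple f a)) (tact T (eval_triple f (mov a q t))) != 0).
Proof.
move=> nzq; have [a [t nz]] := nonradial_points nzq.
set x := eval_triple f a in nz; set y := eval_triple f _ in nz.
have h j v : hpf 1 (fun T : 'M[K]_3 => tact T v j).
  by have := @hpf_tact K 0 (fun=> v) j; rewrite addn0; apply=> l; apply: hpf_const.
have H := @hpf_det3 K 0 1 1 (fun=> q) (fun T => tact T x) (fun T => tact T y)
  (fun l => hpf_const (q l)) (fun j => h j x) (fun j => h j y).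
apply: Gen_impl (Gen_hpf H _) => [T _ hT|]; first by exists a, t.
have [c hc] := mpoly_nonzero_at (linf_neq0 nz); rewrite meval_linf in hc.
have D : det3 x y c != 0 by move: hc; congr (_ != _); rewrite det3E dotE !crossE; ring.
have [b' [c' D']] := complete_basis nzq.
have [T [h1 h2 _]] := exists_map b' c' q D; exists T.
have -> : tact T x = b' by apply: functional_extensionality.
by have -> : tact T y = c' by apply: functional_extensionality.
Qed.

End Conditions.

(** * Algebraic stability *)

Section Stability.
Variables (K : numClosedFieldType) (f : triple K) (d : nat).
Hypotheses (red : reduced_of_degree f d) (d2 : (2 <= d)%N).
Variables (P : seq ('I_3 -> K)) (T : 'M[K]_3).
Hypotheses (HP : forall p, nonzero_vec p -> ~ pfinite (fibre f p) ->
    exists p', List.In p' P /\ proportional p' p)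
  (uT : T \in unitmx)
  (orbP : forall p, List.In p P -> (forall n, (jac f).@[orb f T p n] != 0) /\
     forall m n, (m < n)%N -> ~ proportional (orb f T p m) (orb f T p n)).
Implicit Types (x y r v : 'I_3 -> K).

Let hf : forall i, f i \is d.-homog. Proof. by case: red. Qed.
Let d0 : (0 < d)%N. Proof. exact: leq_trans d2. Qed.
Let F := act_triple T f.
Let it n x := eval_triple (iter_triple n F) x.

Lemma act_eval x : eval_triple F x = tact T (eval_triple f x).
Proof.
apply: functional_extensionality => i; rewrite /eval_triple /F /act_triple raddf_sum /tact.
by apply: eq_bigr => j _; rewrite /= mevalZ.
Qed.

Lemma act_homog i : F i \is d.-homog.
Proof. by apply: rpred_sum => j _; apply: rpredZ; apply: hf. Qed.

Lemma iter_homog n i : iter_triple n F i \is (d ^ n).-homog.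
Proof.
elim: n i => [|n IH] i; first by rewrite expn0; apply: dhomogU.
rewrite expnS; apply: dhomog_comp (act_homog i) _ => j.
by rewrite tnth_mktuple.
Qed.

Lemma itS n x : it n.+1 x = eval_triple F (it n x).
Proof.
apply: functional_extensionality => i; rewrite /it /eval_triple /= /comp_triple comp_mpoly_meval.
by apply: meval_eq => j; rewrite tnth_mktuple.
Qed.

Lemma it0 x : it 0 x = x.
Proof. by apply: functional_extensionality => i; rewrite /it /eval_triple /= mevalXU. Qed.

Lemma it_orb n p : it n (tact T p) = orb f T p n.
Proof. by elim: n => [|n IH]; rewrite ?it0 // itS IH act_eval. Qed.

Lemma itD m n x : it (m + n) x = it m (it n x).
Proof. by elim: m => [|m IH]; rewrite ?it0 // addSn !itS IH. Qed.

Lemma it_scale n x c i : it n (fun j => c * x j) i = c ^+ (d ^ n) * it n x i.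
Proof. exact: meval_homogZ (iter_homog n i). Qed.

Lemma tact_nonzero v : nonzero_vec v -> nonzero_vec (tact T v).
Proof.
move=> [i vi]; apply: NNPP => /not_nonzero_vec z; case/eqP: vi.
apply: (mulfI (tdet_unit uT)); rewrite mulr0 -adjv_tact /adjv det3E !z; ring.
Qed.

Lemma adjv_nonzero v : nonzero_vec v -> nonzero_vec (adjv T v).
Proof.
move=> [i vi]; apply: NNPP => /not_nonzero_vec z; case/eqP: vi.
by apply: (mulfI (tdet_unit uT)); rewrite mulr0 -tact_adjv /tact dotE !z; ring.
Qed.

(** The fibre of T o f over [r] is that of [f] over T^-1 r; if it is infinite, T^-1 r is a
    contracted value. *)
Lemma act_fibre r : nonzero_vec r ->
  pfinite (fun x => forall i, cross r (eval_triple F x) i = 0) \/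
  exists p', List.In p' P /\ proportional (tact T p') r.
Proof.
move=> nzr; have nza := adjv_nonzero nzr.
case: (classic (pfinite (fibre f (adjv T r)))) => [fin|inf].
  left; apply: pfinite_sub fin => x _ h i.
  have [c Ec] := cross0_proportional nzr h; rewrite act_eval in Ec.
  apply: (mulfI (tdet_unit uT)); rewrite mulr0.
  have E j : tdet T * eval_triple f x j = c * adjv T r j.
    by rewrite -adjv_tact /adjv !det3E !Ec; ring.
  rewrite /cross mulrBr [X in X - _]mulrCA E [X in _ - X]mulrCA E; ring.
right; have [p' [pP [c [nzc E]]]] := HP nza inf; exists p'; split=> //.
exists (c^-1^-1 / tdet T); split.
  by rewrite mulf_neq0 ?invr_eq0 ?tdet_unit // invrK.
move=> i; apply: (mulfI (tdet_unit uT)); rewrite -tact_adjv.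
rewrite invrK /tact !dotE !E; field; exact: tdet_unit.
Qed.

Lemma orb_value_nonzero p n : List.In p P ->
  nonzero_vec (orb f T p n) /\ nonzero_vec (eval_triple F (orb f T p n)).
Proof.
move=> /orbP [/(_ n) j _]; have nz := jac_neq0_nonzero hf d2 j.
split=> //; rewrite act_eval; apply: tact_nonzero.
exact: jac_neq0_value hf d0 nz j.
Qed.

Lemma act_zero x : ~ nonzero_vec x -> ~ nonzero_vec (eval_triple F x).
Proof.
move=> /not_nonzero_vec z [i ]; rewrite /eval_triple (@meval_eq _ _ _ (fun j => 0 * x j)).
  by rewrite (meval_homogZ _ _ (act_homog i)) expr0n eqn0Ngt d0 mul0r eqxx.
by move=> j; rewrite z mulr0.
Qed.

Lemma it_nonzero_back m n x : nonzero_vec (it (m + n) x) -> nonzero_vec (it n x).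
Proof.
elim: m => // m IH; rewrite addSn itS => h; apply: IH.
by apply: NNPP => /act_zero.
Qed.

Lemma iter_zeros_pfinite n : pfinite (fun x => forall i, (iter_triple n F i).@[x] = 0).
Proof.
elim: n => [|n IH].
  by exists [::] => x h [i ]; have := h i; rewrite mevalXU => ->; rewrite eqxx.
(* The points whose orbit meets a base point exactly at time n. *)
pose A x := nonzero_vec (it n x) /\ ~ nonzero_vec (it n.+1 x).
(* The images of [A] are pulled back one step at a time: for j = 0 they are base points, for j = n
   they are [A] itself. *)
have im j : (j <= n)%N -> pfinite (fun y => exists x, A x /\ y = it (n - j) x).
  elim: j => [_|j IHj lt_j].
    rewrite subn0; apply: pfinite_sub (base_points_pfinite red) => y nzy [x [[nz zz] ->]] i.
    move: zz; rewrite itS act_eval => zz; apply: (@not_nonzero_vec _ (eval_triple f (it n x))).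
    by apply: contra_not zz; apply: tact_nonzero.
  have [s hs] := IHj (ltnW lt_j).
  pose exc v := exists p', List.In p' P /\ proportional (tact T p') v.
  have fin : pfinite (fun y => exists v, List.In v s /\
      (nonzero_vec v /\ ~ exc v /\ forall i, cross v (eval_triple F y) i = 0)).
    apply: pfinite_bigor => v _; case: (classic (nonzero_vec v /\ ~ exc v)) => [[nzv nexc]|h].
      have [fin|//] := act_fibre nzv.
      by apply: pfinite_sub fin => y _ [_ [_]].
    by exists [::] => y [nzv [ne _]]; case: h.
  apply: pfinite_sub fin => y nzy [x [[nz zz] Ey]].
  have Ej : (n - j = (n - j.+1).+1)%N by lia.
  have EF : it (n - j) x = eval_triple F y by rewrite Ej itS -Ey.
  have nzF : nonzero_vec (it (n - j) x).
    by apply: (@it_nonzero_back j); rewrite subnKC // ltnW.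
  have [v [vs pv]] := hs _ (ex_intro _ x (conj (conj nz zz) erefl)) nzF.
  exists v; split=> //; split; first exact: nonzero_proportional nzF (proportional_sym pv).
  split; last by move=> i; rewrite -EF; apply: proportional_cross.
  (* The iterates of T p' are never zero, whereas [it n.+1 x] is. *)
  move=> [p' [pP pp]]; have [c [nzc Ec]] := proportional_trans pp pv.
  apply: zz; have -> : n.+1 = (j.+1 + (n - j))%N by lia.
  have E2 : it (n - j) x = (fun i => c * tact T p' i) by apply: functional_extensionality.
  rewrite itD E2; have [i nzi] := (orb_value_nonzero j pP).2.
  by exists i; rewrite it_scale itS it_orb mulf_neq0 ?expf_neq0.
have finA : pfinite A.
  by apply: pfinite_sub (im n (leqnn _)) => x _ Ax; exists x; rewrite subnn it0.
apply: pfinite_sub (pfinite_or IH finA) => x _ h.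
case: (classic (nonzero_vec (it n x))) => [nz|/not_nonzero_vec z]; last by left.
by right; split=> // [[i ]]; rewrite /it /eval_triple h eqxx.
Qed.

Lemma iter_no_common_factor n : no_common_factor (iter_triple n F) /\ exists i, iter_triple n F i != 0.
Proof.
have fin := iter_zeros_pfinite n.
have nz : exists i, iter_triple n F i != 0.
  apply: NNPP => h; apply: (@curve_not_pfinite K 'X_i0 1 _ (dhomogU K i0)) => //.
    by apply/eqP => /(congr1 (meval (fun=> 1))); rewrite mevalXU meval0 => /eqP; rewrite oner_eq0.
  apply: pfinite_sub fin => x _ _ i; suff -> : iter_triple n F i = 0 by rewrite meval0.
  by apply/eqP; apply: contraT => hi; case: h; exists i.
by split=> //; apply: (no_common_factor_of_pfinite (iter_homog n) nz fin).
Qed.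

Lemma iter_reduced n : reduced_of_degree (iter_triple n F) (d ^ n).
Proof.
by have [ncf nz] := iter_no_common_factor n; split=> // i; apply: iter_homog.
Qed.

Lemma iter1 i : iter_triple 1 F i = F i.
Proof. by apply: mpoly_eval_inj => x; have := congr1 (fun g => g i) (itS 0 x); rewrite it0. Qed.

Lemma act_reduced : reduced_of_degree F d.
Proof.
have := iter_reduced 1; rewrite expn1.
by have -> : iter_triple 1 F = F by apply: functional_extensionality => i; apply: iter1.
Qed.

Lemma reduced_alg_degree (G : triple K) e : reduced_of_degree G e -> alg_degree G e.
Proof.
by move=> h; exists 1, G; split=> // [|i]; rewrite ?oner_neq0 // mul1r.
Qed.

Lemma act_alg_stable : alg_stable F.
Proof.
exists d; split; first exact: reduced_alg_degree act_reduced.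
by move=> n _; apply: reduced_alg_degree (iter_reduced n).
Qed.

(** [first_dyn_degree] quantifies over every [e] that [alg_degree] admits; with no common factor,
    the factor split off can only be constant. *)
Lemma alg_degree_uniq n e : alg_degree (iter_triple n F) e -> e = (d ^ n)%N.
Proof.
move=> [h [G [nzh [hG [i nzGi] _] E]]].
have [hI [j nzI] ncf] := iter_reduced n.
have sh : (msize h <= 1)%N by apply: ncf => l; exists (G l).
have Ec := msize1_polyC sh; set c := h@_0 in Ec.
have nzc : c != 0 by apply: contraNneq nzh => z; rewrite Ec z mpolyC0.
apply: (dhomog_uniq nzGi (hG i)).
have -> : G i = c^-1 *: iter_triple n F i.
  by rewrite E Ec mul_mpolyC scalerA mulVf // scale1r.
by apply: rpredZ.
Qed.

Lemma act_first_dyn_degree : first_dyn_degree F d%:R.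
Proof.
move=> eps eps0; exists 0%N => n e _ n0 /alg_degree_uniq ->.
by rewrite natrX exprCK ?ler0n // subrr normr0.
Qed.

Lemma act_preimage y v : is_preimage F y v <-> is_preimage f (adjv T y) v.
Proof.
have uD := tdet_unit uT.
split=> [[nzv nzF [c [nzc E]]]|[nzv nzF [c [nzc E]]]].
  have E' i : adjv T y i = (c * tdet T) * eval_triple f v i.
    rewrite -mulrA -adjv_tact -act_eval /adjv !det3E !E; ring.
  split=> //; last by exists (c * tdet T); rewrite mulf_neq0.
  apply: NNPP => /not_nonzero_vec z; move: nzF => [i ]; rewrite act_eval /tact dotE !z.
  by rewrite !mulr0 !addr0 eqxx.
have nzT : nonzero_vec (eval_triple F v) by rewrite act_eval; apply: tact_nonzero.
split=> //; exists (c / tdet T); split; first by rewrite mulf_neq0 // invr_eq0.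
move=> i; apply: (mulfI uD); rewrite -tact_adjv act_eval /tact !dotE !E; field.
exact: uD.
Qed.

Lemma act_top_degree k : top_degree f k -> top_degree F k.
Proof.
move=> [Q [nzQ [[e hQ] H]]].
pose tp := [tuple linf (fun j => adjv T (fun l => (l == j)%:R) i) | i < 3].
have Etp x i : (tnth tp i).@[x] = adjv T x i.
  rewrite tnth_mktuple meval_linf dotE /adjv !det3E -!val_eqE /=; ring.
exists (Q \mPo tp); split.
  have [y hy] := mpoly_nonzero_at nzQ.
  apply: contraNneq hy => z; have := congr1 (meval (tact T y)) z.
  rewrite comp_mpoly_meval meval0 (@meval_eq _ _ _ (fun i => tdet T * y i)); last first.
    by move=> i; rewrite Etp adjv_tact.
  move=> /eqP; rewrite (meval_homogZ _ _ hQ) mulf_eq0 expf_eq0 (negbTE (tdet_unit uT)) andbF /=.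
  by [].
split.
  exists e; have := dhomog_comp hQ (lq := tp) (d := 1); rewrite muln1; apply=> i.
  by rewrite tnth_mktuple linf_homog.
move=> y nzy; rewrite comp_mpoly_meval (@meval_eq _ _ _ (adjv T y)) // => Qy.
have [w [w1 w2 w3]] := H _ (adjv_nonzero nzy) Qy.
exists w; split=> // [j|v /act_preimage]; first by apply/act_preimage.
exact: w3.
Qed.

End Stability.

(** * Invariant foliations *)

Section UnivariateCoprime.
Variable K : numClosedFieldType.

Lemma coprime3 (u : 'I_3 -> {poly K}) : (forall t, exists i, (u i).[t] != 0) ->
  exists e : 'I_3 -> {poly K}, \sum_(i < 3) e i * u i = 1.
Proof.
move=> h; pose g := gcdp (gcdp (u i0) (u i1)) (u i2).
have rg t : ~ root g t.
  rewrite !root_gcd => /andP [/andP [/rootP r0 /rootP r1] /rootP r2].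
  by have [i ] := h t; elim/ord3_ind: i; rewrite ?r0 ?r1 ?r2 eqxx.
have sg : size g = 1%N.
  have [s0|[//|]] : size g = 0%N \/ size g = 1%N \/ (1 < size g)%N by lia.
    by case: (rg 0); move/eqP: s0; rewrite size_poly_eq0 => /eqP ->; apply: root0.
  by move=> /poly_root [t ht]; case: (rg t); apply/rootP.
have [a Ea] := Bezoutp (gcdp (u i0) (u i1)) (u i2).
have [b Eb] := Bezoutp (u i0) (u i1).
have /eqpP [[c1 c2] /= /andP [n1 n2] E1] := Eb.
have : a.1 * gcdp (u i0) (u i1) + a.2 * u i2 %= 1.
  by apply: eqp_trans Ea _; rewrite -size_poly_eq1 -/g sg.
move=> /eqpP [[c3 c4] /= /andP [n3 n4] E2].
have G : gcdp (u i0) (u i1) = (c1 / c2) *: (b.1 * u i0 + b.2 * u i1).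
  by rewrite mulrC -scalerA E1 scalerA mulVf // scale1r.
exists (fun i => (c3 / c4) *: (match val i with 0 => (c1 / c2) *: (a.1 * b.1)
   | 1 => (c1 / c2) *: (a.1 * b.2) | _ => a.2 end)).
rewrite sum3 /=.
have -> : 1 = (c3 / c4) *: (a.1 * gcdp (u i0) (u i1) + a.2 * u i2) :> {poly K}.
  by rewrite mulrC -scalerA E2 scalerA mulVf // scale1r.
by rewrite G -!mul_polyC; ring.
Qed.

Lemma dvdp_deriv_eq0 (p : {poly K}) q : p^`() = p * q -> p^`() = 0.
Proof.
move=> E; have [->|nzp] := eqVneq p 0; first by rewrite deriv0.
apply/eqP; apply: contraT => nz; have := lt_size_deriv nzp.
have nzq : q != 0 by apply: contraNneq nz => z; rewrite E z mulr0.
have : (0 < size q)%N by rewrite lt0n size_poly_eq0.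
rewrite E size_mul //; move: (size p) (size q) => m n; lia.
Qed.

End UnivariateCoprime.

(** * Homogeneous one-forms recovered from their exterior derivative *)

Section Curl.
Variable K : numClosedFieldType.
Implicit Types (om : triple K) (x : 'I_3 -> K).

(** The coefficient of the exterior derivative of [om] on dx_(i+1) ^ dx_(i+2), with cyclic
    indices. *)
Definition curl om : triple K := fun i =>
  (om (nx (nx i)))^`M(nx i) - (om (nx i))^`M(nx (nx i)).

Lemma curl_homog om k i : (forall i, om i \is k.+1.-homog) -> curl om i \is k.-homog.
Proof. by move=> h; apply: rpredB; apply: (dhomog_mderiv _ (h _)). Qed.

(** Cartan's formula for the radial field: the form annihilates it, so contracting the exterior
    derivative gives the Lie derivative, which is k+2 times the form. Hence a form with k = 0 comes
    from a constant vector, and one with k = 1 from a linear field. *)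
Lemma curl_cross om k x i : (forall i, om i \is k.+1.-homog) ->
  \sum_(i < 3) 'X_i * om i = 0 ->
  cross (eval_triple (curl om) x) x i = k.+2%:R * (om i).@[x].
Proof.
move=> h e.
have E1 : \sum_(j < 3) grad (om i) x j * x j = k.+1%:R * (om i).@[x].
  by rewrite -(euler_at x (h i)).
have E2 : (om i).@[x] + \sum_(j < 3) x j * grad (om j) x i = 0.
  transitivity (((\sum_(j < 3) 'X_j * om j)^`M(i)).@[x]); last by rewrite e mderiv0 meval0.
  have -> : ((\sum_(j < 3) 'X_j * om j)^`M(i)).@[x] = \sum_(j < 3) (('X_j * om j)^`M(i)).@[x].
    by rewrite !sum3 !mderivD !mevalD.
  apply: esym; transitivity (\sum_(j < 3) ((j == i)%:R * (om j).@[x] + x j * grad (om j) x i)).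
    apply: eq_bigr => j _; rewrite mderivM mderivXU mevalD !mevalM mevalXU; congr (_ * _ + _).
    by case: (j == i); rewrite ?meval1 ?meval0.
  rewrite big_split /=; congr (_ + _).
  by move: (i) => l; rewrite sum3; elim/ord3_ind: l; rewrite -!val_eqE /=; ring.
transitivity (\sum_(j < 3) grad (om i) x j * x j - \sum_(j < 3) x j * grad (om j) x i); last first.
  rewrite E1 -[X in _ - X](addKr (om i).@[x]) E2 addr0 -[k.+2]addn1 natrD; ring.
rewrite !sum3 /eval_triple /curl /grad.
by elim/ord3_ind: i {E1 E2}; rewrite !crossE /nx /= !mevalB; ring.
Qed.

Lemma homog0_const (p : {mpoly K[3]}) : p \is 0.-homog -> exists c, p = c%:MP.
Proof.
move=> hp; have [->|nz] := eqVneq p 0; first by exists 0; rewrite mpolyC0.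
exists p@_0; apply: msize1_polyC.
have := dhomog_uniq nz hp (dhomog_msize hp).
by case: (mmeasure _ _) => [|[|?]].
Qed.

Lemma homog1_linear (p : {mpoly K[3]}) : p \is 1.-homog -> exists a, p = linf a.
Proof.
move=> hp.
have H i : exists c, p^`M(i) = c%:MP by apply: homog0_const; apply: (dhomog_mderiv i hp).
pose a i := proj1_sig (constructive_indefinite_description _ (H i)).
have Ea i : p^`M(i) = (a i)%:MP by rewrite /a; case: constructive_indefinite_description.
exists a; rewrite -[LHS]mulr1n -(Euler_homog hp); apply: eq_bigr => i _.
by rewrite Ea mulrC mul_mpolyC.
Qed.

End Curl.

(** * Pull-backs and cofactors of the Jacobian matrix *)

Section JacTriple.
Variable K : numClosedFieldType.
Implicit Types (F om : triple K) (x a b : 'I_3 -> K).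

Definition dapp F x b : 'I_3 -> K := fun i => dot (grad (F i) x) b.

Lemma jac_act (T : 'M[K]_3) (f : triple K) x :
  (jac (act_triple T f)).@[x] = \det T * (jac f).@[x].
Proof.
rewrite !meval_jac -det_mulmx; congr (\det _); apply/matrixP => i j; rewrite !mxE.
by rewrite /act_triple !sum3 !mderivD !mevalD !mderivZ !mevalZ !mxE.
Qed.

Lemma meval_pullback F om x j :
  (pullback F om j).@[x] = \sum_(i < 3) (om i).@[eval_triple F x] * grad (F i) x j.
Proof.
rewrite /pullback raddf_sum; apply: eq_bigr => i _; rewrite /= mevalM; congr (_ * _).
exact: meval_comp.
Qed.

Lemma pullback_homog F om d k j : (forall i, F i \is d.-homog) -> (forall i, om i \is k.-homog) ->
  pullback F om j \is (k * d + d.-1).-homog.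
Proof.
move=> hF ho; apply: rpred_sum => i _; apply: dhomogM; last exact: dhomog_mderiv.
by apply: dhomog_comp => // l; rewrite tnth_mktuple.
Qed.

Lemma jac_rows F x : (jac F).@[x] = det3 (grad (F i0) x) (grad (F i1) x) (grad (F i2) x).
Proof. by rewrite meval_jac det_mx33 !det3E !mxE. Qed.

Definition cofrow F i : triple K :=
  cross (fun j => (F (nx i))^`M(j)) (fun j => (F (nx (nx i)))^`M(j)).

Lemma meval_cofrow F i j x :
  (cofrow F i j).@[x] = cross (grad (F (nx i)) x) (grad (F (nx (nx i))) x) j.
Proof. by rewrite /cofrow /cross mevalB !mevalM. Qed.

(** The adjugate strips the differential from the pull-back, at the price of the Jacobian
    determinant. *)
Lemma pullback_cofrow F om x i :
  \sum_(j < 3) (pullback F om j).@[x] * (cofrow F i j).@[x] =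
  (jac F).@[x] * (om i).@[eval_triple F x].
Proof.
rewrite !sum3 !meval_pullback !meval_cofrow !sum3 jac_rows det3E.
by elim/ord3_ind: i; rewrite !crossE /nx /=; ring.
Qed.

(** The cofactor matrix is the action of the differential on bivectors, encoded as cross
    products. *)
Lemma cofrow_cross F x a b i :
  \sum_(j < 3) cross a b j * (cofrow F i j).@[x] = cross (dapp F x a) (dapp F x b) i.
Proof.
rewrite !sum3 !meval_cofrow /dapp.
by elim/ord3_ind: i; rewrite !crossE /nx /= !dotE; ring.
Qed.

End JacTriple.

(** * The multiplier and the degree of an invariant foliation *)

Section Foliation.
Variables (K : numClosedFieldType) (f : triple K) (d : nat).
Hypotheses (red : reduced_of_degree f d) (dom : dominant f) (d2 : (2 <= d)%N).
Variables (P : seq ('I_3 -> K)) (T : 'M[K]_3).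
Hypotheses (HP : forall p, nonzero_vec p -> ~ pfinite (fibre f p) ->
    exists p', List.In p' P /\ proportional p' p)
  (uT : T \in unitmx)
  (orbP : forall p, List.In p P -> (forall n, (jac f).@[orb f T p n] != 0) /\
     forall m n, (m < n)%N -> ~ proportional (orb f T p m) (orb f T p n)).
Variable q : 'I_3 -> K.
Hypotheses (nzq : nonzero_vec q) (baseq : forall i, (f i).@[q] = 0).
Hypothesis fibq : exists a1 a2, [/\ is_preimage f (adjv T q) a1, is_preimage f (adjv T q) a2,
  ~ proportional a1 a2, (jac f).@[a1] != 0 & (jac f).@[a2] != 0].
Hypothesis radq : exists a t,
  det3 q (tact T (eval_triple f a)) (tact T (eval_triple f (mov a q t))) != 0.
Implicit Types (x y r v a b : 'I_3 -> K).

Let F := act_triple T f.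
Let ev x := eval_triple F x.

Variables (k : nat) (om : triple K).
Hypotheses (fol : foliation k om) (inv : invariant_foliation F om).

Let d0 : (0 < d)%N. Proof. exact: leq_trans d2. Qed.
Let hF i : F i \is d.-homog. Proof. exact: (act_homog red T i). Qed.
Let ho i : om i \is k.+1.-homog. Proof. by case: fol => [[]]. Qed.
Let copo : hcoprime om. Proof. by apply: no_common_factor_hcoprime; case: fol => [[]]. Qed.
Let copF : hcoprime F.
Proof. by apply: no_common_factor_hcoprime; case: (act_reduced red d2 HP uT orbP). Qed.
Let euler : \sum_(i < 3) 'X_i * om i = 0. Proof. by case: fol. Qed.

Let eF x : ev x = tact T (eval_triple f x). Proof. exact: act_eval. Qed.

Lemma jacF x : (jac F).@[x] = \det T * (jac f).@[x].
Proof. exact: jac_act. Qed.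

Lemma jacF_neq0 x : (jac f).@[x] != 0 -> (jac F).@[x] != 0.
Proof. by move=> h; rewrite jacF mulf_neq0 // -tdetE tdet_unit. Qed.

Lemma pullback_multiple : exists g, [/\ g != 0, g \is (k.+2 * d.-1).-homog &
  forall i, pullback F om i = g * om i].
Proof.
case: inv => [[j nzj] par].
have [g Eg] := parallel_multiple ho copo par; exists g.
have nzg : g != 0 by apply: contraNneq nzj => z; rewrite Eg z mul0r.
have nzo : om j != 0 by apply: contraNneq nzj => z; rewrite Eg z mulr0.
split=> //.
have := homog_cofactor nzo (ho j) (pullback_homog j hF ho) (etrans (Eg j) (mulrC _ _)).
congr (_ \is _.-homog); case: (d) d0 => // e _ /=; rewrite mulSn mulnS; lia.
Qed.

Lemma sing_pfinite : pfinite (fun x => forall i, (om i).@[x] = 0).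
Proof. exact: hcoprime_zeros_pfinite ho copo. Qed.

Lemma om_scale x c i : (om i).@[fun j => c * x j] = c ^+ k.+1 * (om i).@[x].
Proof. exact: meval_homogZ (ho i). Qed.

(** At a singular point the pull-back vanishes, so the value of [om] at the image annihilates an
    invertible differential. *)
Lemma sing_forward x : (jac f).@[x] != 0 -> (forall i, (om i).@[x] = 0) ->
  forall i, (om i).@[ev x] = 0.
Proof.
move=> /jacF_neq0 nzj z; have [g [_ _ Eg]] := pullback_multiple.
apply: (@not_nonzero_vec _ (fun i => (om i).@[ev x])) => nz.
case/eqP: nzj; apply: (jac_eq0_of_row nz) => j.
by rewrite -meval_pullback Eg mevalM z mulr0.
Qed.

Lemma exceptional_not_sing p : List.In p P -> ~ (forall i, (om i).@[tact T p] = 0).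
Proof.
move=> pP z.
have all n : forall i, (om i).@[orb f T p n] = 0.
  elim: n => // n IH; have := sing_forward ((orbP pP).1 n) IH.
  by rewrite eF.
have [n|m [n [lt_mn pr]]] := pfinite_pigeonhole sing_pfinite all.
  exact: (orb_value_nonzero red d2 uT orbP n pP).1.
exact: (orbP pP).2 pr.
Qed.

(** The base points belong to this set, since [ev x] is zero there. *)
Definition bad x := forall i, (om i).@[ev x] = 0.

Lemma bad_pfinite : pfinite bad.
Proof.
have [s hs] := sing_pfinite.
pose exc v := exists p', List.In p' P /\ proportional (tact T p') v.
have fin : pfinite (fun y => exists v, List.In v s /\
    (nonzero_vec v /\ ~ exc v /\ forall i, cross v (eval_triple F y) i = 0)).
  apply: pfinite_bigor => v _; case: (classic (nonzero_vec v /\ ~ exc v)) => [[nzv nexc]|h].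
    have [fin|//] := act_fibre HP uT nzv.
    by apply: pfinite_sub fin => y _ [_ [_]].
  by exists [::] => y [nzv [ne _]]; case: h.
apply: pfinite_sub (pfinite_or (base_points_pfinite red) fin) => x nzx bx.
case: (classic (nonzero_vec (ev x))) => [nzF|zF]; last first.
  left; apply: (@not_nonzero_vec _ (eval_triple f x)); apply: contra_not zF => h.
  by rewrite eF; apply: tact_nonzero.
right; have [v [vs pv]] := hs _ bx nzF; exists v; split=> //.
split; first exact: nonzero_proportional nzF (proportional_sym pv).
split; last by move=> i; apply: proportional_cross.
move=> [p' [pP pp]]; apply: (exceptional_not_sing pP) => i.
have [c [nzc E]] := proportional_sym (proportional_trans pp pv).
by rewrite (@meval_eq _ _ _ (fun j => c * ev x j)) // om_scale bx mulr0.
Qed.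

(** The cofactor identity makes [g] divide the Jacobian times each om_i(F). On a line without bad
    points these three factors have no common zero, and a Bezout identity in K[t] removes them. *)
Lemma line_divides g a b : (forall i, pullback F om i = g * om i) ->
  (forall t, ~ bad (lc2 1 a t b)) -> exists C, rl a b (jac F) = rl a b g * C.
Proof.
move=> Eg nb.
pose u i := rl a b (om i \mPo tup F).
have [t|e Ee] := @coprime3 K u.
  apply: NNPP => h; apply: (nb t) => i; apply/eqP; apply: contraT => nz; case: h; exists i.
  rewrite /u horner_rl meval_comp; move: nz; congr (_ != _); apply: meval_eq => j.
  by congr (eval_triple F _ j); apply: functional_extensionality => l; rewrite /lc2 mul1r.
pose ro i := rl a b (\sum_(j < 3) om j * cofrow F i j).
have E i : rl a b (jac F) * u i = rl a b g * ro i.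
  rewrite /u /ro -!rlM; congr (rl a b _); apply: mpoly_eval_inj => x.
  rewrite !mevalM meval_comp -pullback_cofrow raddf_sum mulr_sumr; apply: eq_bigr => j _.
  by rewrite Eg /= !mevalM mulrA.
exists (\sum_(i < 3) e i * ro i).
rewrite -[LHS]mulr1 -Ee !mulr_sumr; apply: eq_bigr => i _.
by rewrite mulrCA E mulrCA.
Qed.

Lemma good_direction g : g != 0 -> exists b, [/\ g.@[b] != 0, (jac F).@[b] != 0 & nonzero_vec b].
Proof.
move=> nzg; have [b] := mpoly_nonzero_at (mulf_neq0 nzg (dominant_jac_neq0 dom)).
rewrite mevalM mulf_eq0 negb_or => /andP [gb jb]; exists b; split=> //.
  exact: jacF_neq0.
by apply: (jac_neq0_nonzero _ d2 jb); case: red.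
Qed.

Lemma foliation_degree_le1 : (k <= 1)%N.
Proof.
have [g [nzg hg Eg]] := pullback_multiple.
have [b [gb jb nzb]] := good_direction nzg.
have [A [nzA HA]] := pfinite_avoid_lines nzb bad_pfinite.
have [a /HA [_ nb]] := mpoly_nonzero_at nzA.
have [|C EC] := @line_divides g a b Eg; first by move=> t; apply: nb; rewrite oner_neq0.
have sJ := size_rl a (jac_homog hF) jb.
have sg := size_rl a hg gb.
have nzC : C != 0 by apply/eqP => z; move: sJ; rewrite EC z mulr0 size_poly0.
have nzrg : rl a b g != 0 by rewrite -size_poly_eq0 sg.
have : (0 < size C)%N by rewrite lt0n size_poly_eq0.
move: sJ; rewrite EC size_mul // sg => sJ c0.
have key (e s : nat) : (0 < e -> 0 < s -> ((k.+2 * e).+1 + s).-1 = (3 * e).+1 -> k <= 1)%N by nia.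
by apply: (key d.-1 (size C)) => //; rewrite -ltnS prednK.
Qed.

(** Equal degrees make the quotient of [line_divides] constant on each general line through [b], and
    these lines share the point [b], which fixes the constant. *)
Lemma jac_multiple g : k = 1%N -> g != 0 -> g \is (k.+2 * d.-1).-homog ->
  (forall i, pullback F om i = g * om i) -> exists2 c, c != 0 & jac F = c *: g.
Proof.
move=> k1 nzg hg Eg.
have [b [gb jb nzb]] := good_direction nzg.
have [A [nzA HA]] := pfinite_avoid_lines nzb bad_pfinite.
exists ((jac F).@[b] / g.@[b]); first by rewrite mulf_neq0 // invr_eq0.
apply: (mpoly_cancel nzA) => a /HA [_ nb].
have [|C EC] := @line_divides g a b Eg; first by move=> t; apply: nb; rewrite oner_neq0.
have [sJ tJ] := rl_top a b (jac_homog hF); have [sg tg] := rl_top a b hg.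
have sg' := size_rl a hg gb.
have nzrg : rl a b g != 0 by rewrite -size_poly_eq0 sg'.
have sC : (size C <= 1)%N.
  have [->|nzC] := eqVneq C 0; first by rewrite size_poly0.
  move: sJ; rewrite EC size_mul // sg' k1; move: (size C) => s; lia.
have Ec := size1_polyC sC; set c := C`_0 in Ec.
have EJ : rl a b (jac F) = c *: rl a b g by rewrite EC Ec mulrC mul_polyC.
have Ea : (jac F).@[a] = c * g.@[a].
  by have := congr1 (fun p : {poly K} => p`_0) EJ; rewrite coefZ !rl_coef0.
have Eb : (jac F).@[b] = c * g.@[b].
  by rewrite -tJ EJ coefZ -tg k1.
by rewrite mevalZ Ea Eb mulfK.
Qed.

(** * Degree one: foliations by linear vector fields *)

Section DegreeOne.
Hypothesis k1 : k = 1%N.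
Variable A : 'I_3 -> 'I_3 -> K.
Let ap x : 'I_3 -> K := fun i => dot (A i) x.
Hypothesis EA : forall x i, (om i).@[x] = cross (ap x) x i.

Definition lder (p : {mpoly K[3]}) : {mpoly K[3]} := \sum_(j < 3) p^`M(j) * linf (A j).

Lemma meval_lder p x : (lder p).@[x] = dot (grad p x) (ap x).
Proof.
rewrite /lder raddf_sum; apply: eq_bigr => j _ /=; rewrite mevalM meval_linf //.
Qed.

Lemma lder_mul (p r : {mpoly K[3]}) : lder (p * r) = lder p * r + p * lder r.
Proof. by rewrite /lder !sum3 !mderivM; ring. Qed.

Lemma lder_add (p r : {mpoly K[3]}) : lder (p + r) = lder p + lder r.
Proof. by rewrite /lder !sum3 !mderivD; ring. Qed.

Lemma lder_homog p e : p \is e.-homog -> (0 < e)%N -> lder p \is e.-homog.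
Proof.
move=> hp e0; apply: rpred_sum => j _.
by have := dhomogM (dhomog_mderiv j hp) (linf_homog (A j)); rewrite addn1 prednK.
Qed.

(** With g cancelled, [kap] times om(F) is the cross product of the images of Ax and x under the
    differential. Here om(F) is the cross product of AF and F, and by Euler's formula the image of x
    is d F. Hence [E] is parallel to F, and by coprimality and degree it is a constant multiple of
    F. *)
Lemma linear_semiconjugacy : exists c nu : K, forall i,
  lder (F i) = c *: \sum_(l < 3) A i l *: F l - nu *: F i.
Proof.
have [g [nzg hg Eg]] := pullback_multiple.
have [kap nzk Ej] := jac_multiple k1 nzg hg Eg.
have E1 i x : kap * (om i).@[ev x] = cross (dapp F x (ap x)) (dapp F x x) i.
  have hyp : kap *: (om i \mPo tup F) = \sum_(j < 3) om j * cofrow F i j.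
    apply: (mulfI nzg); apply: mpoly_eval_inj => y.
    rewrite !mevalM mevalZ meval_comp.
    transitivity ((jac F).@[y] * (om i).@[eval_triple F y]).
      by rewrite Ej mevalZ; ring.
    rewrite -pullback_cofrow [in RHS]raddf_sum /= mulr_sumr; apply: eq_bigr => j _.
    by rewrite Eg !mevalM mulrA.
  have := congr1 (meval x) hyp; rewrite mevalZ meval_comp => ->.
  rewrite raddf_sum -cofrow_cross; apply: eq_bigr => j _; rewrite /= mevalM EA //.
have dx x i : dapp F x x i = d%:R * ev x i by rewrite /dapp (euler_at _ (hF i)).
pose E i := kap *: \sum_(l < 3) A i l *: F l - d%:R *: lder (F i).
have evE i x : (E i).@[x] = kap * ap (ev x) i - d%:R * dapp F x (ap x) i.
  rewrite /E mevalB !mevalZ meval_lder; congr (_ * _ - _).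
  by rewrite raddf_sum; apply: eq_bigr => l _; rewrite /= mevalZ.
have par i j : E i * F j = E j * F i.
  apply: mpoly_eval_inj => x; rewrite !mevalM.
  apply: (@cross0_eq _ (fun i => (E i).@[x]) (fun i => (F i).@[x])) => l.
  transitivity (kap * cross (ap (ev x)) (ev x) l - cross (dapp F x (ap x)) (dapp F x x) l).
    by rewrite /cross !evE !dx /ev /eval_triple; ring.
  by rewrite -EA E1 subrr.
have hE i : E i \is d.-homog.
  apply: rpredB; apply: rpredZ; last exact: lder_homog.
  by apply: rpred_sum => l _; apply: rpredZ.
have [nu Enu] := parallel_multiple hF copF par.
have [[j nzj] _] : (exists j, F j != 0) /\ True.
  by split=> //; case: (act_reduced red d2 HP uT orbP).
have := homog_cofactor nzj (hF j) (hE j) (etrans (Enu j) (mulrC _ _)).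
rewrite subnn => /homog0_const [n En].
have nzd : d%:R != 0 :> K by rewrite pnatr_eq0 -lt0n.
exists (kap / d%:R), (n / d%:R) => i; apply: (scalerI nzd).
have -> : d%:R *: lder (F i) = kap *: \sum_(l < 3) A i l *: F l - nu * F i.
  by rewrite -Enu /E subKr.
by rewrite En mul_mpolyC scalerBr !scalerA ![d%:R * _]mulrC !divfK.
Qed.

Lemma lder_inideal p : inideal F p -> inideal F (lder p).
Proof.
have [c [nu H]] := linear_semiconjugacy.
have HF i : inideal F (lder (F i)).
  exists (fun l => (c * A i l - (i == l)%:R * nu)%:MP); rewrite H.
  under [in RHS]eq_bigr => l _ do rewrite mul_mpolyC scalerBl -!scalerA.
  rewrite sumrB -scaler_sumr; congr (_ - _).
  rewrite (bigD1 i) //= eqxx scale1r big1 ?addr0 // => l ne.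
  by rewrite eq_sym (negbTE ne) scale0r.
move=> [C ->].
have -> : lder (\sum_(i < 3) C i * F i) = \sum_(i < 3) (lder (C i) * F i + C i * lder (F i)).
  by rewrite !sum3 !lder_add !lder_mul.
have h i : inideal F (lder (C i) * F i + C i * lder (F i)).
  by apply: inidealD; apply: inidealM => //; apply: inideal_gen.
by rewrite sum3; apply: inidealD => //; apply: inidealD.
Qed.

Let Fq i : (F i).@[q] = 0.
Proof. by rewrite -[LHS]/(ev q i) eF /tact dotE /eval_triple !baseq; ring. Qed.

(* If [l^(e+1) s] is in the base ideal with [s q <> 0] and the derivative of [l]
   does not vanish at [q], differentiating lowers the exponent. *)
Lemma tangent_at_base l e s : s.@[q] != 0 -> inideal F (linf l ^+ e * s) -> dot l q = 0 ->
  dot l (ap q) = 0.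
Proof.
elim: e s => [|e IH] s nzs I lq.
  by case/eqP: nzs; rewrite -(inideal_eval I Fq) expr0 mul1r.
have [//|nz] := eqVneq (dot l (ap q)) 0.
have El : lder (linf l ^+ e.+1) = e.+1%:R * (linf l ^+ e * lder (linf l)).
  elim: e {IH I} => [|n IHn]; first by rewrite expr1 expr0 !mul1r.
  rewrite exprS lder_mul IHn -[n.+2]addn1 natrD !exprS; ring.
apply: (IH (e.+1%:R * lder (linf l) * s + linf l * lder s)) => //.
  rewrite mevalD !mevalM rmorph_nat meval_linf lq mul0r addr0 !mulf_neq0 ?pnatr_eq0 //.
  rewrite meval_lder; move: nz; congr (_ != _); congr dot.
  by apply: functional_extensionality => i; rewrite /grad mderiv_linf mevalC.
have := lder_inideal I; rewrite lder_mul El; congr (inideal F _).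
by rewrite exprS; ring.
Qed.

(** Elimination from a centre [o] puts a product of lines through [o] into the base ideal. Only the
    line joining [o] to [q] can vanish at [q], so [tangent_at_base] puts Aq on it; varying [o]
    leaves only multiples of [q]. *)
Lemma base_eigenvector : exists al, forall i, ap q i = al * q i.
Proof.
apply: cross0_proportional => //.
have key o : det3 o q (ap q) = 0.
  case: (classic (nonzero_vec (cross o q))) => [nzoq|/not_nonzero_vec z]; last first.
    transitivity (dot (cross o q) (ap q)); first by rewrite det3E dotE !crossE; ring.
    by rewrite dotE !z; ring.
  have nzo : nonzero_vec o.
    by apply: NNPP => /not_nonzero_vec z; case: nzoq => i; rewrite /cross !z !mul0r subrr eqxx.
  have [r [hr Ir]] := elimination hF copF nzo.
  suff [e [s [nzs Is]]] : exists e s, s.@[q] != 0 /\ inideal F (linf (cross o q) ^+ e * s).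
    have := tangent_at_base nzs Is _; rewrite !dotE !det3E !crossE => h.
    by rewrite -[RHS]h; ring.
  have [e [s [nzs Es]]] : exists e s, s.@[q] != 0 /\
      \prod_(a <- r) linf a = linf (cross o q) ^+ e * s.
    elim: r hr {Ir} => [|a r IH] hr; first by exists 0%N, 1; rewrite meval1 oner_neq0 big_nil expr0 mul1r.
    have [e [s [nzs Es]]] : exists e s, s.@[q] != 0 /\
      \prod_(a <- r) linf a = linf (cross o q) ^+ e * s by apply: IH => a' ha; apply: hr; right.
    have [nza ao] : nonzero_vec a /\ dot a o = 0 by apply: hr; left.
    have [aq|aq] := eqVneq (dot a q) 0; last first.
      by exists e, (linf a * s); rewrite big_cons Es mevalM meval_linf mulf_neq0 //; split=> //; ring.
    have [c Ec] : exists c, forall i, a i = c * cross o q i.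
      apply: cross0_proportional => // i.
      transitivity (dot a o * q i - dot a q * o i); last by rewrite ao aq; ring.
      by rewrite !dotE; elim/ord3_ind: i; rewrite !crossE; ring.
    have nzc : c != 0 by apply/eqP => c0; case: nza => i; rewrite Ec c0 mul0r eqxx.
    exists e.+1, (c *: s); rewrite mevalZ mulf_neq0 //; split=> //.
    have Ela : linf a = c *: linf (cross o q).
      by apply: mpoly_eval_inj => x; rewrite mevalZ !meval_linf !dotE !Ec; ring.
    by rewrite big_cons Es Ela exprS -!mul_mpolyC; ring.
  by exists e, s; rewrite -Es.
elim/ord3_ind; [have := key (pt3 1 0 0)|have := key (pt3 0 1 0)|have := key (pt3 0 0 1)];
  by rewrite det3E /pt3 /= !crossE => h; rewrite -[RHS]h; ring.
Qed.

Lemma degree_one_false : False.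
Proof.
have [c [nu H]] := linear_semiconjugacy.
have [al Eal] := base_eigenvector.
have nzd : d%:R != 0 :> K by rewrite pnatr_eq0 -lt0n.
pose be := (c * al - nu) / d%:R.
(* F(a) is a multiple of the eigenvector [q], so the differential at [a] sends Aa to a multiple of
   F(a), which by Euler's formula is also the image of be a. As [a] is not critical, Aa = be a, and
   [be] depends only on the eigenvalue at [q]. *)
have eig a : is_preimage f (adjv T q) a -> (jac f).@[a] != 0 -> forall i, ap a i = be * a i.
  move=> /(proj2 (act_preimage f uT q a)) [nza nzF pr] /jacF_neq0 ja.
  have [t [nzt Et]] := proportional_sym pr.
  have z i : ap a i - be * a i = 0.
    apply: (jac_neq0_inj ja (b := fun i => ap a i - be * a i)) => j.
    transitivity (dot (grad (F j) a) (ap a) - be * dot (grad (F j) a) a); first by rewrite !dotE; ring.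
    rewrite -meval_lder H (euler_at _ (hF j)) mevalB !mevalZ raddf_sum.
    have -> : \sum_(l < 3) meval a (A j l *: F l) = al * (F j).@[a].
      transitivity (t * ap q j); last by rewrite Eal -[(F j).@[a]]/(eval_triple F a j) Et; ring.
      rewrite /ap /dot mulr_sumr; apply: eq_bigr => l _.
      by rewrite mevalZ -[(F l).@[a]]/(eval_triple F a l) Et mulrCA.
    by rewrite /be; field.
  by move=> i; apply/eqP; rewrite -subr_eq0 z.
have [a1 [a2 [p1 p2 np j1 j2]]] := fibq.
have e1 := eig _ p1 j1; have e2 := eig _ p2 j2.
have nz1 : nonzero_vec a1 by case: p1.
have nz2 : nonzero_vec a2 by case: p2.
apply: (plane_not_pfinite (not_proportional_cross nz1 nz2 np)).
apply: pfinite_sub sing_pfinite => x _ [t ->] i; rewrite EA.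
have E j : ap (fun i => a1 i + t * a2 i) j = be * (a1 j + t * a2 j).
  transitivity (ap a1 j + t * ap a2 j); first by rewrite /ap !dotE; ring.
  by rewrite e1 e2; ring.
by rewrite /cross !E; ring.
Qed.

End DegreeOne.

(** * Degree zero: the pencil of lines through a point *)

Section DegreeZero.
Variable c : 'I_3 -> K.
Hypothesis Ec : forall x i, (om i).@[x] = cross c x i.

Let nzc : nonzero_vec c.
Proof.
apply: NNPP => /not_nonzero_vec z; case: fol => [[_ [i nzi] _] _].
case/eqP: nzi; apply: mpoly_vanish => x; rewrite Ec /cross !z; ring.
Qed.

(** Both sides of the invariance relation are evaluated on the direction [c], which [om]
    annihilates. *)
Lemma dot_direction x : dot (cross c (ev x)) (dapp F x c) = 0.
Proof.
have [g [nzg hg Eg]] := pullback_multiple.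
transitivity (\sum_(j < 3) (pullback F om j).@[x] * c j).
  rewrite !sum3 !meval_pullback !sum3 !Ec dotE /dapp !dotE; ring.
rewrite !sum3 !Eg !mevalM !Ec !crossE; ring.
Qed.

(** Along direction [c] the vector [cross c F] is parallel to its derivative, by [dot_direction]. On
    a general such line its components have no common zero, so each divides its own derivative,
    which must be 0 by degree; density extends this to every line. *)
Lemma const_along_direction x t i : cross c (ev (mov x c t)) i = cross c (ev x) i.
Proof.
pose G j := crossf F c j.
have EG j y : (G j).@[y] = cross c (ev y) j by exact: meval_crossf.
have dG j y : dot (grad (G j) y) c = cross c (dapp F y c) j.
  by rewrite dotE !(grad_crossf F) /cross /dapp !dotE; ring.
have [Q [nzQ HQ]] := pfinite_avoid_lines nzc bad_pfinite.
have D0 j : \sum_(l < 3) c l *: (G j)^`M(l) = 0.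
  apply: (mpoly_cancel nzQ) => a /HQ [_ nb]; rewrite meval0.
  have -> : (\sum_(l < 3) c l *: (G j)^`M(l)).@[a] = dot (grad (G j) a) c.
    by rewrite raddf_sum; apply: eq_bigr => l _; rewrite /= mevalZ mulrC.
  pose ph l := rl a c (G l).
  have ph_eval l s : (ph l).[s] = cross c (ev (mov a c s)) l by rewrite horner_rl -EG.
  have dph_eval l s : ((ph l)^`()).[s] = cross c (dapp F (mov a c s) c) l.
    rewrite deriv_rl horner_sum -dG; apply: eq_bigr => m _.
    by rewrite hornerZ horner_rl mulrC.
  have [s|e Ee] := @coprime3 K ph.
    apply: NNPP => h; apply: (nb 1 s); first by rewrite oner_neq0.
    move=> l; rewrite Ec; apply/eqP; apply: contraT => nz; case: h; exists l.
    rewrite ph_eval; move: nz; congr (_ != _); congr (cross c (ev _) l).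
    by apply: functional_extensionality => m; rewrite /lc2 /mov mul1r.
  have par l m : ph l * (ph m)^`() = ph m * (ph l)^`().
    apply/eqP; rewrite -subr_eq0; apply/eqP; apply: poly_vanish => s.
    rewrite hornerD hornerN !hornerM !ph_eval !dph_eval.
    apply/eqP; rewrite subr_eq0; apply/eqP.
    apply: (@cross0_eq _ (cross c (ev (mov a c s))) (cross c (dapp F (mov a c s) c))) => n.
    transitivity (dot (cross c (ev (mov a c s))) (dapp F (mov a c s) c) * c n).
      by rewrite dotE; elim/ord3_ind: n; rewrite !crossE; ring.
    by rewrite dot_direction mul0r.
  have z : (ph j)^`() = 0.
    apply: (@dvdp_deriv_eq0 _ _ (\sum_(l < 3) e l * (ph l)^`())).
    rewrite -[LHS]mulr1 -Ee !mulr_sumr; apply: eq_bigr => l _.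
    by rewrite mulrCA [_ * ph l]mulrC par mulrCA.
  rewrite -rl_coef1 -[rl a c (G j)]/(ph j); have := congr1 (fun p : {poly K} => p`_0) z.
  by rewrite coef_deriv coef0.
have dz : (rl x c (G i))^`() = 0.
  rewrite deriv_rl -[RHS](_ : rl x c 0 = 0); last by rewrite /rl mmap0.
  rewrite -(D0 i) rl_sum; apply: eq_bigr => l _; by rewrite rlZ.
rewrite -!EG; have -> : (G i).@[x] = (rl x c (G i))`_0 by rewrite rl_coef0.
have -> : (G i).@[mov x c t] = (rl x c (G i)).[t] by rewrite horner_rl.
have sz : (size (rl x c (G i)) <= 1)%N.
  apply/leq_sizeP => [[//|j]] _; have := congr1 (fun p : {poly K} => p`_j) dz.
  by rewrite coef_deriv coef0 => /eqP; rewrite -mulr_natr mulf_eq0 pnatr_eq0 orbF => /eqP.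
by rewrite {1}(size1_polyC sz) hornerC.
Qed.

Lemma degree_zero_false : False.
Proof.
have Fq i : ev q i = 0 by rewrite eF /tact dotE /eval_triple !baseq; ring.
(* If [q] and [c] differ as points, [cross c F] is constant in direction [c] and zero at [q], hence
   zero on the line joining them, where every point is then bad. *)
case: (classic (nonzero_vec (cross q c))) => [nz|/not_nonzero_vec z].
  apply: (plane_not_pfinite nz); apply: pfinite_sub bad_pfinite => x _ [t ->] i.
  by rewrite Ec const_along_direction /cross !Fq; ring.
have [s Es] : exists s, forall i, q i = s * c i.
  apply: cross0_proportional => // i; apply/eqP; rewrite -oppr_eq0 -[X in _ == X](z i).
  by apply/eqP; rewrite /cross; ring.
(* Now [q] is a multiple of [c], and constancy of [cross c F] makes the images of two points of a
   line through [q] collinear with [q]. *)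
have [a [t /eqP]] := radq; apply; rewrite -!eF.
have -> : mov a q t = mov a c (t * s).
  by apply: functional_extensionality => i; rewrite /mov Es mulrA.
set u := ev a; set v := ev _.
have Euv i : cross c v i = cross c u i by rewrite const_along_direction.
transitivity (s * dot (cross c u) v); first by rewrite det3E dotE !crossE !Es; ring.
by rewrite dotE -!Euv !crossE; ring.
Qed.

End DegreeZero.

Lemma no_invariant_foliation : False.
Proof.
have := foliation_degree_le1; case Ek: k => [|[|//]] _.
  have H i : exists c, curl om i = c%:MP.
    by apply: homog0_const; have := curl_homog i ho; rewrite Ek.
  pose c0 i := proj1_sig (constructive_indefinite_description _ (H i)).
  have E0 i : curl om i = (c0 i)%:MP by rewrite /c0; case: constructive_indefinite_description.
  apply: (@degree_zero_false (fun i => c0 i / 2%:R)) => x i.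
  have := curl_cross x i ho euler; rewrite Ek /cross /eval_triple !E0 !mevalC => E.
  have nz2 : 2%:R != 0 :> K by rewrite pnatr_eq0.
  by apply: (mulfI nz2); rewrite -E; field.
have H i : exists a, curl om i = linf a.
  by apply: homog1_linear; have := curl_homog i ho; rewrite Ek.
pose A0 i := proj1_sig (constructive_indefinite_description _ (H i)).
have E0 i : curl om i = linf (A0 i) by rewrite /A0; case: constructive_indefinite_description.
apply: (@degree_one_false Ek (fun i j => A0 i j / 3%:R)) => x i.
have := curl_cross x i ho euler; rewrite Ek /cross /eval_triple !E0 !meval_linf => E.
have nz3 : 3%:R != 0 :> K by rewrite pnatr_eq0.
have Ed j : dot (fun l => A0 j l / 3%:R) x = dot (A0 j) x / 3%:R by rewrite !dotE; field.
by apply: (mulfI nz3); rewrite -E !Ed; field.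
Qed.

End Foliation.

Lemma generic_conclusion (K : numClosedFieldType) (f : triple K) d :
  reduced_of_degree f d -> dominant f -> top_degree f d -> (2 <= d)%N ->
  Gen (fun T => [/\ alg_stable (act_triple T f),
          exists l : nat, top_degree (act_triple T f) l /\
                          first_dyn_degree (act_triple T f) l%:R
        & forall (k : nat) (w : triple K),
            foliation k w -> ~ invariant_foliation (act_triple T f) w]).
Proof.
move=> red dom top d2.
have [q [nzq baseq]] := base_point_exists red dom top d2.
have [Q [e [nzQ hQ HQ]]] := generic_fibre red dom top d2.
have [P [nzP HP]] := exceptional_list red dom d2.
have GA : Gen (fun T => forall p, List.In p P ->
    (forall n, (jac f).@[orb f T p n] != 0) /\
    forall m n, (m < n)%N -> ~ proportional (orb f T p m) (orb f T p n)).
  by apply: Gen_list => p pP; apply: (Gen_orbits red dom d2 (nzP p pP)).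
have GB := Gen_fibre nzQ hQ nzq.
have GC := Gen_nonradial red dom d2 nzq.
apply: Gen_impl (Gen_and GA (Gen_and GB GC)) => T uT [hA [hB hC]]; split.
- exact: (act_alg_stable red d2 HP uT hA).
- exists d; split; first exact: act_top_degree.
  exact: (act_first_dyn_degree red d2 HP uT hA).
move=> k w fol inv.
apply: (no_invariant_foliation red dom d2 HP uT hA nzq baseq _ hC fol inv).
have [u [u1 u2 _ u4]] := HQ _ (adjv_nonzero uT nzq) hB.
pose j0 := Ordinal (leq_trans (isT : (0 < 2)%N) d2); pose j1 := Ordinal d2.
by exists (u j0), (u j1); split=> //; apply: u2.
Qed.

(** The argument works over any algebraically closed field of type [numClosedFieldType]; [complex R]
    is specialised only here. *)
Theorem theoremB (R : realType) (f : triple (complex R)) (d : nat) :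
  reduced_of_degree f d -> dominant f -> top_degree f d -> (2 <= d)%N ->
  exists Z : nat -> {mpoly (complex R)[3 * 3]},
    (forall m, Z m != 0 /\ exists e, Z m \is e.-homog) /\
    forall T : 'M[complex R]_3, T \in unitmx ->
      (forall m, (Z m).@[mat_coords T] != 0) ->
      [/\ alg_stable (act_triple T f),
          exists l : nat, top_degree (act_triple T f) l /\
                          first_dyn_degree (act_triple T f) l%:R
        & forall (k : nat) (w : triple (complex R)),
            foliation k w -> ~ invariant_foliation (act_triple T f) w].
Proof. exact: (@generic_conclusion (complex R) f d). Qed.
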